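(* Let $i\in\{1,2,3\}$. There are bijections between the following three sets: (1) topological Lie bialgebra structures $\delta$ on $\mathfrak{g}[\![x]\!]$ with topological double $\mathfrak{D}_i$; (2) formal $r$-matrices of the form $r(x,y)=\frac{y^{i-1}\Omega}{x-y}+g(x,y)$ with $g\in(\mathfrak{g}\otimes\mathfrak{g})[\![x,y]\!]$; (3) Lagrangian Lie subalgebras $W\subset\mathfrak{D}_i$ complementary to $\mathfrak{g}[\![x]\!]$, i.e. $\mathfrak{D}_i=\iota(\mathfrak{g}[\![x]\!])\oplus W$ as vector spaces. They are given by $r\mapsto -dr$ (from (2) to (1)) and $r\mapsto W_r$ (from (2) to (3)). Moreover, these bijections preserve the equivalences: two structures in (1) are formally isomorphic if and only if the corresponding formal $r$-matrices are formally gauge equivalent, if and only if the corresponding Lagrangian Lie subalgebras are formally isomorphic.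
   Context: $F$ is an algebraically closed field of characteristic $0$, $\mathfrak{g}$ a finite-dimensional simple Lie algebra over $F$ with Killing form $\kappa$, $\{I_\alpha\}_{\alpha=1}^n$ an orthonormal basis of $\mathfrak{g}$ for $\kappa$, $\Omega=\sum_\alpha I_\alpha\otimes I_\alpha$. $\mathfrak{g}[\![x]\!]=\mathfrak{g}\otimes F[\![x]\!]$ has the $F[\![x]\!]$-bilinear bracket and the $(x)$-adic topology. Topological Lie bialgebra structure on $\mathfrak{g}[\![x]\!]$: a continuous linear map $\delta\colon\mathfrak{g}[\![x]\!]\to(\mathfrak{g}\otimes\mathfrak{g})[\![x,y]\!]$ such that $\delta(f)+\overline\tau\delta(f)=0$, $\overline{\mathrm{Alt}}((\delta\overline\otimes 1)\delta(f))=0$ and $\delta([f,h])=[f(x)\otimes1+1\otimes f(y),\delta(h)]-[h(x)\otimes1+1\otimes h(y),\delta(f)]$ for all $f,h$. Here $\overline\tau$ swaps the tensor factors together with their variables, $\overline{\mathrm{Alt}}$ is the continuous extension of $a\otimes b\otimes c\mapsto a\otimes b\otimes c+b\otimes c\otimes a+c\otimes a\otimes b$, and $\delta\overline\otimes1$ is the continuous extension of $\delta\otimes1$. Topological double: let $\mathfrak{g}\{x\}$ be the space of continuous linear functionals on $\mathfrak{g}[\![x]\!]$. $\mathfrak{D}(\mathfrak{g}[\![x]\!],\delta)=\mathfrak{g}[\![x]\!]\oplus\mathfrak{g}\{x\}$ with form $B(a+f,b+h)=f(b)+h(a)$ and the bracket extending that of $\mathfrak{g}[\![x]\!]$ with $[f,h]=(f\otimes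 h)\circ\delta$ and $[a,f]=-f\circ\mathrm{ad}_a+(f\overline\otimes1)(\delta(a))$ for $a\in\mathfrak{g}[\![x]\!]$, $f,h\in\mathfrak{g}\{x\}$. $\mathfrak{D}_i=\mathfrak{g}(\!(x)\!)\times\mathfrak{g}[x]/x^{i-1}\mathfrak{g}[x]$ with form $B_i((f_1,[f_2]),(g_1,[g_2]))=\mathrm{coeff}_{i-2}\{\kappa(f_1,g_1)\}-\mathrm{coeff}_{i-2}\{\kappa(f_2,g_2)\}$, where $\kappa$ is extended $F(\!(x)\!)$-bilinearly and $\mathrm{coeff}_k$ is the coefficient of $x^k$. $\iota\colon\mathfrak{g}[\![x]\!]\to\mathfrak{D}_i$, $f\mapsto(f,[f])$. A structure $\delta$ has topological double $\mathfrak{D}_i$ if there is a Lie algebra isomorphism $\mathfrak{D}(\mathfrak{g}[\![x]\!],\delta)\to\mathfrak{D}_i$ intertwining the forms $B$ and $B_i$ and restricting to $\iota$ on $\mathfrak{g}[\![x]\!]$. A subalgebra $W$ is Lagrangian if $W^\perp=W$. Formal $r$-matrix: a series $r=\frac{s(y)\Omega}{x-y}+g(x,y)\in(\mathfrak{g}\otimes\mathfrak{g})(\!(x)\!)[\![y]\!]$ with $s\in F[\![y]\!]$, $g\in(\mathfrak{g}\otimes\mathfrak{g})[\![x,y]\!]$, $\frac{1}{x-y}:=\sum_{k\ge0}x^{-k-1}y^k$, solving $[r^{12}(x_1,x_2),r^{13}(x_1,x_3)]+[r^{12}(x_1,x_2),r^{23}(x_2,x_3)]+[r^{13}(x_1,x_3),r^{23}(x_2,x_3)]=0$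 in $(\mathfrak{g}^{\otimes3})(\!(x_1)\!)(\!(x_2)\!)[\![x_3]\!]$ (usual leg notation, e.g. $[(a\otimes b)^{13},(c\otimes d)^{23}]=a\otimes c\otimes[b,d]$). $dr(f):=[f(x)\otimes1+1\otimes f(y),r(x,y)]$. $W_r$: put $m=i-1$ and write $g(x,y)=\sum_{k\ge0}\sum_\alpha p_k^\alpha(x)\otimes I_\alpha y^k$. Then $W_r\subset\mathfrak{D}_i$ is the $F$-span of $w_{k,\alpha}=(p_k^\alpha(x),\,-I_\alpha[x]^{m-k-1}+p_k^\alpha([x]))$ for $0\le k\le m-1$ and $w_{k,\alpha}=(I_\alpha x^{m-k-1}+p_k^\alpha(x),\,p_k^\alpha([x]))$ for $k\ge m$, $1\le\alpha\le n$, where $[x]$ is the class of $x$ modulo $x^m$. Equivalences: let $\phi$ denote an $F[\![x]\!]$-linear Lie algebra automorphism of $\mathfrak{g}[\![x]\!]$ (extended to $\mathfrak{g}(\!(x)\!)$, and inducing $[\phi]$ on $\mathfrak{g}[x]/x^{i-1}\mathfrak{g}[x]$). $\delta,\tilde\delta$ are formally isomorphic if $(\phi\overline\otimes\phi)\delta=\tilde\delta\phi$ for some $\phi$; $r,\tilde r$ are formally gauge equivalent if $\tilde r=(\phi\overline\otimes\phi)r$ (i.e. $\phi$ applied to the first factor in the variable $x$ and the second in $y$) for some $\phi$; $W,\widetilde W$ are formally isomorphic if $\widetilde W=(\phi\times[\phi])(W)$ for some $\phi$. *)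

(* Defs.v *)
From HB Require Import structures.
From mathcomp Require Import all_boot all_order all_algebra.
From mathcomp Require Import all_classical.

Set Implicit Arguments.
Unset Strict Implicit.
Unset Printing Implicit Defensive.

Import GRing.Theory.
Local Open Scope classical_set_scope.
Local Open Scope ring_scope.

HB.mixin Record Vector_isLie (F : fieldType) (V : Type) of Vector F V := {
  lie : V -> V -> V;
  lie_linearl : forall z : V, linear (lie ^~ z);
  lie_linearr : forall z : V, linear (lie z);
  liexx : forall x : V, lie x x = 0;
  lie_jacobi : forall x y z : V,
    lie x (lie y z) + lie y (lie z x) + lie z (lie x y) = 0
}.

#[short(type="lieAlgType")]
HB.structure Definition LieAlgebra (F : fieldType) :=
  { V of Vector_isLie F V & Vector F V }.

Section FiniteDimensional.
Variables (F : fieldType) (g : lieAlgType F).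

Definition simple_lie : Prop :=
  (exists x y : g, lie x y <> 0) /\
  (forall U : {vspace g},
     (forall x u : g, u \in U -> lie x u \in U) -> U = 0%VS \/ U = fullv).

Definition endo_trace (V : vectType F) (f : V -> V) : F :=
  \sum_(i < \dim {:V}) coord (vbasis {:V}) i (f (vbasis {:V})`_i).

Definition killing (a b : g) : F := endo_trace (fun x => lie a (lie b x)).

Definition killing_orthonormal (n : nat) (I : n.-tuple g) : Prop :=
  basis_of {:g} I /\
  forall a b : 'I_n, killing I`_a I`_b = (a == b)%:R.

End FiniteDimensional.

(* U (x) V is modelled by matrices of coefficients with respect to the
   tensors of basis vectors; [tens_lift_tens] and [tens_liftE] below are the
   universal property. *)
Section Tensor.
Variable F : fieldType.

Definition tensor (U V : vectType F) : vectType F :=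
  'M[F]_(\dim {:U}, \dim {:V}).

Definition tens (U V : vectType F) (u : U) (v : V) : tensor U V :=
  \matrix_(i, j) (coord (vbasis {:U}) i u * coord (vbasis {:V}) j v).

Definition tens_lift (U V : vectType F) (W : lmodType F) (b : U -> V -> W)
    (t : tensor U V) : W :=
  \sum_i \sum_j t i j *: b (vbasis {:U})`_i (vbasis {:V})`_j.

Definition tens_map (U V U' V' : vectType F) (f : U -> U') (h : V -> V') :
    tensor U V -> tensor U' V' :=
  tens_lift (fun u v => tens (f u) (h v)).

Lemma tens_lift_linear (U V : vectType F) (W : lmodType F) (b : U -> V -> W) :
  linear (tens_lift b).
Proof.
move=> c s t; rewrite /tens_lift scaler_sumr -big_split /=.
apply: eq_bigr => i _; rewrite scaler_sumr -big_split /=.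
by apply: eq_bigr => j _; rewrite !mxE scalerDl scalerA.
Qed.

Lemma tens_lift_tens (U V : vectType F) (W : lmodType F) (b : U -> V -> W)
    (u : U) (v : V) :
  (forall y, linear (b^~ y)) -> (forall x, linear (b x)) ->
  tens_lift b (tens u v) = b u v.
Proof.
move=> bl br.
pose bL y := GRing.isLinear.Build F U W *:%R (b^~ y) (bl y).
pose BL y : {linear U -> W} := HB.pack (b^~ y) (bL y).
pose bR x := GRing.isLinear.Build F V W *:%R (b x) (br x).
pose BR x : {linear V -> W} := HB.pack (b x) (bR x).
rewrite [in RHS](coord_vbasis (memvf u)).
have -> w : b (\sum_i coord (vbasis {:U}) i u *: (vbasis {:U})`_i) w =
    \sum_i coord (vbasis {:U}) i u *: b (vbasis {:U})`_i w.
  by rewrite -[LHS]/(BL w _) linear_sum; apply: eq_bigr => i _; rewrite linearZ.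
apply: eq_bigr => i _; rewrite [in RHS](coord_vbasis (memvf v)).
rewrite -[X in _ = _ *: X]/(BR _ _) linear_sum scaler_sumr; apply: eq_bigr => j _.
by rewrite mxE linearZ scalerA.
Qed.

Lemma tens_liftE (U V : vectType F) (W : lmodType F)
    (f : {linear tensor U V -> W}) (t : tensor U V) :
  f t = tens_lift (fun u v => f (tens u v)) t.
Proof.
have free_vb (X : vectType F) := basis_free (vbasisP {:X}).
rewrite [t in LHS]matrix_sum_delta linear_sum; apply: eq_bigr => i _.
rewrite linear_sum; apply: eq_bigr => j _; rewrite linearZ; congr (_ *: f _).
by apply/matrixP => k l; rewrite !mxE !coord_free // -natrM mulnb !(eq_sym i, eq_sym j).
Qed.

End Tensor.

(* V[[x]] is [nat -> V] and V[[x,y]] is [nat -> nat -> V] (exponent of x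
   first); V((x)) sits inside [int -> V] and V((x))[[y]] inside
   [int -> nat -> V].  A sum [\sum_(p \in setT)] over an infinite index set is
   the sum over the support of the summand; all those below have finite
   support on the series concerned. *)
Section Series.

Definition mono (V : nmodType) (a : V) (k : nat) : nat -> V :=
  fun j => if j == k then a else 0.

Definition lmono (V : nmodType) (a : V) (k : int) : int -> V :=
  fun j => if j == k then a else 0.

Definition is_laurent (V : nmodType) (f : int -> V) : Prop :=
  exists N : int, forall k : int, k < N -> f k = 0.

Definition lser (V : nmodType) (f : nat -> V) : int -> V :=
  fun k => if k is Posz n then f n else 0.

Definition lser2 (V : nmodType) (t : nat -> nat -> V) : int -> nat -> V :=
  fun k l => lser (t^~ l) k.

(* The part of a series in V((x))[[y]] with nonnegative powers of x. *)
Definition regpart (V : nmodType) (r : int -> nat -> V) : nat -> nat -> V :=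
  fun k l => r k%:Z l.

(* Agreement modulo (x)^N, resp. modulo (x,y)^N. *)
Definition xadic_eq (V : Type) (N : nat) (f h : nat -> V) : Prop :=
  forall k, (k < N)%N -> f k = h k.

Definition xyadic_eq (V : Type) (N : nat) (t u : nat -> nat -> V) : Prop :=
  forall k l, (k + l < N)%N -> t k l = u k l.

(* V[x] / x^m V[x] is modelled by the coefficients of 1, ..., x^(m-1). *)
Definition trunc (V : nmodType) (m : nat) (f : nat -> V) : {ffun 'I_m -> V} :=
  [ffun k : 'I_m => f k].

Definition trunc_rep (V : nmodType) (m : nat) (u : {ffun 'I_m -> V}) :
    nat -> V :=
  fun k => oapp u 0 (insub k : option 'I_m).

Definition smul (F : fieldType) (V : lmodType F) (s : nat -> F)
    (f : nat -> V) : nat -> V :=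
  fun k => \sum_(p < k.+1) s p *: f (k - p)%N.

End Series.

Section Manin.
Variables (F : fieldType) (g : lieAlgType F).

Local Notation g2 := (tensor g g).
Local Notation g3 := (tensor (tensor g g) g).
Local Notation dualseries := ((nat -> g) -> F^o).

Definition sbracket (f h : nat -> g) : nat -> g :=
  fun k => \sum_(p < k.+1) lie (f p) (h (k - p)%N).

Definition lbracket (f h : int -> g) : int -> g :=
  fun k => \sum_(p \in [set: int]) lie (f p) (h (k - p)).

Definition tbracket (m : nat) (f h : {ffun 'I_m -> g}) : {ffun 'I_m -> g} :=
  [ffun k : 'I_m => \sum_(p < m) \sum_(q < m | (p + q)%N == k) lie (f p) (h q)].

(* [f(x) (x) 1 + 1 (x) f(y), t(x,y)] *)
Definition act (f : nat -> g) (t : int -> nat -> g2) : int -> nat -> g2 :=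
  fun k l =>
    \sum_(p \in [set: nat]) tens_map (lie (f p)) id (t (k - p%:Z) l)
    + \sum_(q < l.+1) tens_map id (lie (f q)) (t k (l - q)%N).

Definition flip (t : nat -> nat -> g2) : nat -> nat -> g2 :=
  fun k l => tens_lift (fun a b => tens b a) (t l k).

Definition cycle3 : g3 -> g3 :=
  tens_lift (fun ab c => tens_lift (fun a b => tens (tens b c) a) ab).

Definition alt3 (t : nat -> nat -> nat -> g3) : nat -> nat -> nat -> g3 :=
  fun p q l => t p q l + cycle3 (t l p q) + cycle3 (cycle3 (t q l p)).

(* The continuous extension of delta (x) 1. *)
Definition delta_tens1 (delta : (nat -> g) -> (nat -> nat -> g2))
    (t : nat -> nat -> g2) : nat -> nat -> nat -> g3 :=
  fun p q l => \sum_(k \in [set: nat])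
    tens_lift (fun a b => tens (delta (mono a k) p q) b) (t k l).

Definition lie_bialgebra (delta : (nat -> g) -> (nat -> nat -> g2)) : Prop :=
  [/\ linear delta,
      forall (f : nat -> g) (N : nat), exists M : nat, forall h : nat -> g,
        xadic_eq M f h -> xyadic_eq N (delta f) (delta h),
      forall f, delta f + flip (delta f) = 0,
      forall f, alt3 (delta_tens1 delta (delta f)) = 0
    & forall f h, lser2 (delta (sbracket f h)) =
        act f (lser2 (delta h)) - act h (lser2 (delta f))].

Definition cont_functional (f : dualseries) : Prop :=
  linear f /\
  forall a, exists M : nat, forall b, xadic_eq M a b -> f a = f b.

(* The continuous extensions of f (x) h and f (x) 1 to (g (x) g)[[x,y]]. *)
Definition fun_tens (f h : dualseries) (t : nat -> nat -> g2) : F^o :=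
  \sum_(kl \in [set: nat * nat])
    tens_lift (fun a b => f (mono a kl.1) * h (mono b kl.2) : F^o)
              (t kl.1 kl.2).

Definition fun_tens1 (f : dualseries) (t : nat -> nat -> g2) : nat -> g :=
  fun l => \sum_(k \in [set: nat])
    tens_lift (fun a b => f (mono a k) *: b) (t k l).

Definition double : set ((nat -> g) * dualseries) :=
  [set u | cont_functional u.2].

Definition double_form (u v : (nat -> g) * dualseries) : F :=
  u.2 v.1 + v.2 u.1.

Definition double_bracket (delta : (nat -> g) -> (nat -> nat -> g2))
    (u v : (nat -> g) * dualseries) : (nat -> g) * dualseries :=
  let: (a, f) := u in let: (b, h) := v in
  (sbracket a b + fun_tens1 h (delta a) - fun_tens1 f (delta b),
   (fun c => fun_tens f h (delta c))
   + (fun c => f (sbracket b c)) - (fun c => h (sbracket a c))).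

Section DoubleD.
Variable i : nat.

Local Notation ambient := ((int -> g) * {ffun 'I_i.-1 -> g})%type.

Definition Dcal : set ambient := [set u | is_laurent u.1].

Definition Dbracket (u v : ambient) : ambient :=
  (lbracket u.1 v.1, tbracket u.2 v.2).

(* The second sum is the coefficient of x^(i-2) of kappa(u.2, v.2); it is
   empty for i = 1. *)
Definition Dform (u v : ambient) : F :=
  \sum_(p \in [set: int]) killing (u.1 p) (v.1 (i%:Z - 2 - p))
  - \sum_(p < i.-1) \sum_(q < i.-1 | (p + q + 2)%N == i)
      killing (u.2 p) (v.2 q).

Definition Diota (f : nat -> g) : ambient := (lser f, trunc i.-1 f).

Definition has_double (delta : (nat -> g) -> (nat -> nat -> g2)) : Prop :=
  exists Phi : (nat -> g) * dualseries -> ambient,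
    [/\ set_bij double Dcal Phi,
        forall (c : F) u v, double u -> double v ->
          Phi (c *: u + v) = c *: Phi u + Phi v,
        forall u v, double u -> double v ->
          Phi (double_bracket delta u v) = Dbracket (Phi u) (Phi v),
        forall u v, double u -> double v ->
          Dform (Phi u) (Phi v) = double_form u v
      & forall f, Phi (f, 0) = Diota f].

Definition bialgebras_with_double :
    set ((nat -> g) -> (nat -> nat -> g2)) :=
  [set delta | lie_bialgebra delta /\ has_double delta].

Definition is_subalgebra (W : set ambient) : Prop :=
  [/\ W `<=` Dcal, W 0,
      forall (c : F) u v, W u -> W v -> W (c *: u + v)
    & forall u v, W u -> W v -> W (Dbracket u v)].

Definition orthogonal_of (W : set ambient) : set ambient :=
  [set u | Dcal u /\ forall w, W w -> Dform u w = 0].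

Definition complementary (W : set ambient) : Prop :=
  (forall u, Dcal u -> exists f w, W w /\ u = Diota f + w) /\
  (forall f, W (Diota f) -> Diota f = 0).

Definition lagrangian_complements : set (set ambient) :=
  [set W | [/\ is_subalgebra W, orthogonal_of W = W & complementary W]].

End DoubleD.

Section RMatrix.
Variables (n : nat) (I : n.-tuple g).

Definition Omega : g2 := \sum_(a < n) tens I`_a I`_a.

(* s(y) Omega / (x - y), with 1 / (x - y) = sum_(j >= 0) x^(-j-1) y^j;
   recall that [Negz j] is - (j + 1). *)
Definition polar (s : nat -> F) : int -> nat -> g2 :=
  fun k l => if k is Negz j then
               if (j <= l)%N then s (l - j)%N *: Omega else 0
             else 0.

Definition br12_13 (X Y : g2) : g3 :=
  tens_lift (fun a b =>
    tens_lift (fun c d => tens (tens (lie a c) b) d) Y) X.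

Definition br12_23 (X Y : g2) : g3 :=
  tens_lift (fun a b =>
    tens_lift (fun c d => tens (tens a (lie b c)) d) Y) X.

Definition br13_23 (X Y : g2) : g3 :=
  tens_lift (fun a b =>
    tens_lift (fun c d => tens (tens a c) (lie b d)) Y) X.

(* Coefficient of x1^a x2^b x3^c. *)
Definition cybe (r : int -> nat -> g2) : Prop :=
  forall (a b : int) (c : nat),
    \sum_(p \in [set: int]) br12_13 (lser (r p) b) (r (a - p) c)
    + \sum_(p \in [set: nat]) br12_23 (r a p) (r (b - p%:Z) c)
    + \sum_(p < c.+1) br13_23 (r a p) (r b (c - p)%N) = 0.

Definition rmatrices (s : nat -> F) : set (int -> nat -> g2) :=
  [set r | (exists h : nat -> nat -> g2, r = polar s + lser2 h) /\ cybe r].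

Lemma regpart_polar (s : nat -> F) (h : nat -> nat -> g2) :
  regpart (polar s + lser2 h) = h.
Proof. by apply/funext => k; apply/funext => l; exact: add0r. Qed.

Definition dr (r : int -> nat -> g2) (f : nat -> g) : int -> nat -> g2 :=
  act f r.

(* - dr, as a map into (g (x) g)[[x,y]]; since [regpart] drops negative powers
   of x, this is - dr only when those vanish. *)
Definition neg_dr (r : int -> nat -> g2) : (nat -> g) -> (nat -> nat -> g2) :=
  fun f => regpart (- dr r f).

Definition pcoef (h : nat -> nat -> g2) (k : nat) (a : 'I_n) : nat -> g :=
  fun j => tens_lift (fun u v => coord I a v *: u) (h j k).

Lemma pcoefE (h : nat -> nat -> g2) (j k : nat) :
  basis_of {:g} I -> h j k = \sum_(a < n) tens (pcoef h k a j) I`_a.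
Proof.
move=> bI.
have tensl (v : g) : linear (fun u : g => tens u v).
  by move=> c x y; apply/matrixP => p q; rewrite !mxE linearP mulrDl mulrA.
have tensr (u : g) : linear (fun v : g => tens u v).
  by move=> c x y; apply/matrixP => p q; rewrite !mxE linearP mulrDr mulrCA.
pose L1 v : {linear g -> g2} := HB.pack (fun u : g => tens u v)
  (GRing.isLinear.Build F g g2 *:%R _ (tensl v)).
pose L2 u : {linear g -> g2} := HB.pack (tens u : g -> g2)
  (GRing.isLinear.Build F g g2 *:%R _ (tensr u)).
rewrite [LHS](tens_liftE idfun) /pcoef /tens_lift.
under [RHS]eq_bigr => a _.
  rewrite -[tens _ _]/(L1 _ _) linear_sum.
  under eq_bigr => p _.
    rewrite linear_sum.
    under eq_bigr => q _.
      rewrite linearZ /= -[tens _ _]/(L1 _ _) linearZ scalerA.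
      over.
    over.
  over.
rewrite [RHS]exchange_big; apply: eq_bigr => p _ /=.
rewrite [RHS]exchange_big; apply: eq_bigr => q _ /=.
rewrite {1}(coord_basis bI (memvf (vbasis {:g})`_q)).
rewrite -[tens _ _]/(L2 _ _) linear_sum scaler_sumr.
by apply: eq_bigr => a _; rewrite linearZ scalerA.
Qed.

Section Wspace.
Variable i : nat.
Local Notation m := (i.-1).
Local Notation ambient := ((int -> g) * {ffun 'I_i.-1 -> g})%type.

Definition wvec (h : nat -> nat -> g2) (k : nat) (a : 'I_n) : ambient :=
  if (k < m)%N then
    (lser (pcoef h k a),
     - trunc m (mono I`_a (m - k - 1)%N) + trunc m (pcoef h k a))
  else
    (lmono I`_a (m%:Z - k%:Z - 1) + lser (pcoef h k a),
     trunc m (pcoef h k a)).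

Definition Wspace (r : int -> nat -> g2) : set ambient :=
  [set u | exists (N : nat) (c : 'I_N -> 'I_n -> F),
     u = \sum_(k < N) \sum_(a < n) c k a *: wvec (regpart r) k a].

End Wspace.

End RMatrix.

Section Equivalences.

Definition is_fx_automorphism (phi : (nat -> g) -> (nat -> g)) : Prop :=
  [/\ bijective phi,
      forall f h, phi (f + h) = phi f + phi h,
      forall (s : nat -> F) f, phi (smul s f) = smul s (phi f)
    & forall f h, phi (sbracket f h) = sbracket (phi f) (phi h)].

(* F((x))-linear extension: sum_p f_p x^p |-> sum_p x^p phi(f_p). *)
Definition laurent_ext (phi : (nat -> g) -> (nat -> g)) (f : int -> g) :
    int -> g :=
  fun k => \sum_(p \in [set: int]) lser (phi (mono (f p) 0%N)) (k - p).

Definition trunc_ext (m : nat) (phi : (nat -> g) -> (nat -> g))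
    (u : {ffun 'I_m -> g}) : {ffun 'I_m -> g} :=
  trunc m (phi (trunc_rep u)).

(* phi applied to the first factor in x and to the second one in y. *)
Definition tens2_ext (phi : (nat -> g) -> (nat -> g)) (t : int -> nat -> g2) :
    int -> nat -> g2 :=
  fun k l => \sum_(p \in [set: int]) \sum_(q < l.+1)
    tens_map (fun a => lser (phi (mono a 0%N)) (k - p))
             (fun b => phi (mono b 0%N) (l - q)%N) (t p q).

Definition bialgebra_iso (delta delta' : (nat -> g) -> (nat -> nat -> g2)) :
    Prop :=
  exists2 phi, is_fx_automorphism phi &
    forall f, tens2_ext phi (lser2 (delta f)) = lser2 (delta' (phi f)).

Definition gauge_equiv (r r' : int -> nat -> g2) : Prop :=
  exists2 phi, is_fx_automorphism phi & r' = tens2_ext phi r.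

Definition subspace_iso (i : nat)
    (W W' : set ((int -> g) * {ffun 'I_i.-1 -> g})) : Prop :=
  exists2 phi, is_fx_automorphism phi &
    W' = (fun u => (laurent_ext phi u.1, trunc_ext phi u.2)) @` W.

End Equivalences.

End Manin.

Arguments bialgebras_with_double {F} g i.
Arguments lagrangian_complements {F} g i.
Arguments neg_dr {F g} r.
Arguments Wspace {F g n} I i r.

(* Main.v *)
Require Import Defs.
From HB Require Import structures.
From mathcomp Require Import all_boot all_order all_algebra.
From mathcomp Require Import all_classical.
From mathcomp Require Import zify.

Set Implicit Arguments.
Unset Strict Implicit.
Unset Printing Implicit Defensive.

Import Order.TTheory GRing.Theory Num.Theory.
Local Open Scope classical_set_scope.
Local Open Scope ring_scope.

(* Put m = i - 1. Modulo iota(g[[x]]), which is Lagrangian, D_i has a basis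
   dual to the I_alpha x^k, so a complement of iota(g[[x]]) is the graph of an
   arbitrary series g(x,y): it is W_r, with basis w_{k,alpha}, and the first
   components of the w_{k,alpha} are the coefficients of r.  W_r is isotropic
   iff g + tau(g) = (x^m - y^m)/(x - y) Omega, that is iff r is skew-symmetric.

   Contracting the Yang-Baxter equation with v in the second and w in the third
   factor gives [w_{b,v}, w_{c,w}] as a combination of the w_p, in first
   components.  Antisymmetrizing and comparing poles shows that r is
   skew-symmetric; then W_r is Lagrangian and, by invariance of the form, the
   coefficients in question are the projections of the bracket along
   iota(g[[x]]), so that the equation says exactly that W_r is a subalgebra.
   The same computation gives B(f, [w_{b,v}, w_{c,w}]) = the (b,c) coefficient
   of -dr(f) paired with v (x) w.  Hence -dr is the cobracket dual to the
   bracket of W_r, its axioms being the Lie algebra axioms of D_i, and every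
   delta with double D_i is -dr for W_r the image of g{x}.

   An F[[x]]-linear automorphism is orthogonal for the F[[x]]-bilinear Killing
   form, which identifies its action on r, on dr and on the basis of W_r. *)

(** * Sums and convolutions of series *)

(** The Yang-Baxter equation sees only first components, in g((x)), whereas subalgebra, form and
    complement also involve g[x]/x^m. The projections [pr k] bridge this gap. For k >= m they read
    the pole of the first component, for k < m the difference of the two components at x^(m-k-1);
    they vanish together exactly on iota(g[[x]]), where the first component is injective. So an
    element of D_i is known from its first component and its projections. The projections are
    pairings with a x^k, so invariance of the form computes them for brackets; matching the result
    with the coefficients of the Yang-Baxter equation uses that W_r is isotropic. Since
    skew-symmetry is not part of the definition of a formal r-matrix, it has to be extracted from
    the equation before W_r can be shown to be a subalgebra. Two devices keep the computations
    finite: tensors are tested by contracting their factors through the Killing form, and a Laurent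
    series is written as x^(-M) times a power series, which turns identities in D_i into termwise
    identities of finite convolutions. *)

Section FiniteSupport.
Variable V : nmodType.

Lemma fsum_seq (T : choiceType) (s : seq T) (G : T -> V) :
  uniq s -> (forall t, t \notin s -> G t = 0) ->
  \sum_(t \in [set: T]) G t = \sum_(t <- s) G t.
Proof.
move=> us Gs; rewrite (fsbigE s) //; last by move=> t _; exact: Gs.
by apply: eq_bigl => t; rewrite in_setT.
Qed.

Lemma fsum_nat (N : nat) (G : nat -> V) :
  (forall p, (N <= p)%N -> G p = 0) ->
  \sum_(p \in [set: nat]) G p = \sum_(p < N) G p.
Proof.
move=> GN; rewrite (fsum_seq (iota_uniq 0 N)).
  by rewrite -{1}[N]subn0 -/(index_iota 0 N) big_mkord.
by move=> p; rewrite mem_iota /= add0n -leqNgt; exact: GN.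
Qed.

Lemma fsum_int (N : int) (K : nat) (G : int -> V) :
  (forall p, (p < N)%R -> G p = 0) ->
  (forall p, (N + K%:Z <= p)%R -> G p = 0) ->
  \sum_(p \in [set: int]) G p = \sum_(p < K) G (N + p%:Z).
Proof.
move=> GN GK; rewrite (@fsum_seq _ [seq N + p%:Z | p <- iota 0 K]).
- by rewrite big_map -{1}[K]subn0 -/(index_iota 0 K) big_mkord.
- by rewrite map_inj_uniq ?iota_uniq // => p q Epq; lia.
move=> p; apply: contraNeq => Gp.
have lep : (N <= p)%R by case: leP => // /GN Gp0; rewrite Gp0 eqxx in Gp.
have ltp : (p < N + K%:Z)%R by case: ltP => // /GK Gp0; rewrite Gp0 eqxx in Gp.
apply/mapP; exists `|p - N|%N; first by rewrite mem_iota /=; lia.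
lia.
Qed.

End FiniteSupport.

Section Triangular.
Variable V : nmodType.

Lemma sum_triangle (G : nat -> nat -> V) (k : nat) :
  \sum_(p < k.+1) \sum_(q < p.+1) G q (p - q)%N =
  \sum_(p < k.+1) \sum_(q < (k - p).+1) G p q.
Proof.
elim: k => [|k IH]; first by rewrite !big_ord1.
rewrite big_ord_recr /= IH [RHS]big_ord_recr /= [in RHS]subnn big_ord1.
rewrite [X in _ + X = _]big_ord_recr /= subnn addrA; congr (_ + _).
rewrite -big_split /=; apply: eq_bigr => p _.
by rewrite subSn ?[RHS]big_ord_recr //= -ltnS.
Qed.

Lemma sum_convC (G : nat -> nat -> V) (k : nat) :
  \sum_(p < k.+1) G p (k - p)%N = \sum_(p < k.+1) G (k - p)%N p.
Proof.
rewrite (reindex_inj rev_ord_inj) /=; apply: eq_bigr => p _.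
by rewrite subSS subKn // -ltnS.
Qed.

Lemma exchange_triangle (G : nat -> nat -> V) (k : nat) :
  \sum_(p < k.+1) \sum_(q < (k - p).+1) G p q =
  \sum_(q < k.+1) \sum_(p < (k - q).+1) G p q.
Proof.
rewrite -(sum_triangle G) -(sum_triangle (fun q p => G p q)).
by apply: eq_bigr => p _; exact: sum_convC.
Qed.

End Triangular.

Section Bilinear.
Variables (F : fieldType) (U V W : lmodType F) (b : U -> V -> W).

Definition bilin := (forall y, linear (b^~ y)) /\ (forall x, linear (b x)).

Hypothesis bb : bilin.

Definition bilin_l (y : V) : {linear U -> W} :=
  HB.pack (b^~ y) (GRing.isLinear.Build F U W *:%R (b^~ y) (bb.1 y)).
Definition bilin_r (x : U) : {linear V -> W} :=
  HB.pack (b x) (GRing.isLinear.Build F V W *:%R (b x) (bb.2 x)).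

Lemma bilin0l y : b 0 y = 0. Proof. exact: (linear0 (bilin_l y)). Qed.
Lemma bilin0r x : b x 0 = 0. Proof. exact: (linear0 (bilin_r x)). Qed.
Lemma bilinDl x x' y : b (x + x') y = b x y + b x' y.
Proof. exact: (linearD (bilin_l y)). Qed.
Lemma bilinDr x y y' : b x (y + y') = b x y + b x y'.
Proof. exact: (linearD (bilin_r x)). Qed.
Lemma bilinNl x y : b (- x) y = - b x y.
Proof. exact: (linearN (bilin_l y)). Qed.
Lemma bilinNr x y : b x (- y) = - b x y.
Proof. exact: (linearN (bilin_r x)). Qed.
Lemma bilinZl c x y : b (c *: x) y = c *: b x y.
Proof. exact: (linearZ_LR (bilin_l y)). Qed.
Lemma bilinZr c x y : b x (c *: y) = c *: b x y.
Proof. exact: (linearZ_LR (bilin_r x)). Qed.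
Lemma bilin_suml J (r : seq J) (P : pred J) G y :
  b (\sum_(j <- r | P j) G j) y = \sum_(j <- r | P j) b (G j) y.
Proof. exact: (linear_sum (bilin_l y)). Qed.
Lemma bilin_sumr J (r : seq J) (P : pred J) G x :
  b x (\sum_(j <- r | P j) G j) = \sum_(j <- r | P j) b x (G j).
Proof. exact: (linear_sum (bilin_r x)). Qed.

End Bilinear.

Section Shift.
Variable V : nmodType.

(** The Laurent series x^(-M) a(x). Every Laurent series has this form for all large M, so finitely
    many of them can share one M. *)
Definition sh (M : nat) (a : nat -> V) : int -> V := fun k => lser a (k + M%:Z).

Lemma sh0 (a : nat -> V) : lser a = sh 0 a.
Proof. by apply/funext => k; rewrite /sh addr0. Qed.

Lemma lser_neg (a : nat -> V) (k : int) : (k < 0)%R -> lser a k = 0.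
Proof. by case: k. Qed.

Lemma sh_neg (a : nat -> V) (M : nat) (k : int) : (k < - M%:Z)%R -> sh M a k = 0.
Proof. by move=> kM; apply: lser_neg; lia. Qed.

Lemma laurent_sh (f : int -> V) : is_laurent f ->
  exists M0, forall M, (M0 <= M)%N -> exists a, f = sh M a.
Proof.
case=> N fN; exists `|N|%N => M leM; exists (fun k => f (k%:Z - M%:Z)).
apply/funext => k; rewrite /sh; case E: (k + M%:Z) => [p|p] /=.
  by congr f; lia.
by rewrite fN //; lia.
Qed.

Lemma sh_laurent (M : nat) (a : nat -> V) : is_laurent (sh M a).
Proof. by exists (- M%:Z) => k; exact: sh_neg. Qed.

Lemma lser_laurent (a : nat -> V) : is_laurent (lser a).
Proof. by rewrite sh0; exact: sh_laurent. Qed.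

(** The coefficient of y^l in [act] or [tens2_ext] mixes those of y^0, ..., y^l of the argument, so
    a common pole bound is needed. *)
Lemma laurent_bound (t : int -> nat -> V) l :
  (forall q, is_laurent (t^~ q)) ->
  exists N : int, forall q k, (q <= l)%N -> (k < N)%R -> t k q = 0.
Proof.
move=> tl; elim: l => [|l [N tN]].
  by have [N tN] := tl 0%N; exists N => q k; rewrite leqn0 => /eqP ->; exact: tN.
have [N' tN'] := tl l.+1; exists (Num.min N N') => q k.
rewrite lt_min leq_eqVlt ltnS => /orP[/eqP->|ql] /andP[kN kN'].
  exact: tN'.
exact: tN.
Qed.

Lemma lmono_sh (v : V) (M : nat) (p : nat) :
  lmono v (p%:Z - M%:Z) = sh M (mono v p).
Proof.
apply/funext => k; rewrite /lmono /sh /mono; case E: (k + M%:Z) => [q|q] /=.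
  have -> : (k == p%:Z - M%:Z) = (q == p) by apply/eqP/eqP; lia.
  by [].
by rewrite ifF //; apply/eqP; lia.
Qed.

End Shift.

Section Laurent.
Variables (F : fieldType) (V : lmodType F).
Implicit Types f h : int -> V.

Lemma shP M (c : F) (a a' : nat -> V) :
  c *: sh M a + sh M a' = sh M (c *: a + a').
Proof.
apply/funext => k; rewrite /sh /= !fctE; case: (k + M%:Z) => //= _.
by rewrite scaler0 addr0.
Qed.

Lemma laurentP (c : F) f h :
  is_laurent f -> is_laurent h -> is_laurent (c *: f + h).
Proof.
move=> /laurent_sh[M1 Hf] /laurent_sh[M2 Hh].
have [a ->] := Hf _ (leq_maxl M1 M2); have [a' ->] := Hh _ (leq_maxr M1 M2).
by rewrite shP; exact: sh_laurent.
Qed.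

Lemma laurent0 : is_laurent (0 : int -> V). Proof. by exists 0. Qed.

End Laurent.

Section Convolution.
Variables (F : fieldType) (U V W : lmodType F) (b : U -> V -> W).

Definition conv (f : nat -> U) (h : nat -> V) : nat -> W :=
  fun k => \sum_(p < k.+1) b (f p) (h (k - p)%N).

Definition lconv (f : int -> U) (h : int -> V) : int -> W :=
  fun k => \sum_(p \in [set: int]) b (f p) (h (k - p)).

Hypothesis bb : bilin b.

Lemma conv_mono0l u h k : conv (mono u 0) h k = b u (h k).
Proof.
rewrite /conv big_ord_recl /= subn0 /mono /= big1 ?addr0 // => p _.
by rewrite (bilin0l bb).
Qed.

Lemma conv_monor f v j k :
  conv f (mono v j) k = if (j <= k)%N then b (f (k - j)%N) v else 0.
Proof.
rewrite /conv /mono; case: leqP => jk.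
  have jk' : (k - j < k.+1)%N by lia.
  rewrite (bigD1 (Ordinal jk')) //= subKn // eqxx big1 ?addr0 // => p pj.
  rewrite ifF ?(bilin0r bb) //; apply: contraNF pj => /eqP E.
  by apply/eqP/val_inj => /=; have := ltn_ord p; lia.
rewrite big1 // => p _; rewrite ifF ?(bilin0r bb) //.
by apply/eqP; lia.
Qed.

Lemma lconv_sh M N a c : lconv (sh M a) (sh N c) = sh (M + N) (conv a c).
Proof.
apply/funext => k; rewrite /lconv [RHS]/sh.
have vanish p : (p < - M%:Z)%R \/ (k + N%:Z < p)%R ->
    b (sh M a p) (sh N c (k - p)) = 0.
  case=> Hp; first by rewrite sh_neg // (bilin0l bb).
  by rewrite (@sh_neg _ c) ?(bilin0r bb) //; lia.
case E: (k + (M + N)%N%:Z) => [n|n] /=.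
  rewrite (@fsum_int _ (- M%:Z) n.+1) => [|p Hp|p Hp]; last 2 first.
  - by apply: vanish; left.
  - by apply: vanish; right; lia.
  apply: eq_bigr => p _; congr b; rewrite /sh.
    by have -> : - M%:Z + p%:Z + M%:Z = p by lia.
  have -> : k - (- M%:Z + p%:Z) + N%:Z = (n - p)%N by have := ltn_ord p; lia.
  by [].
apply: fsbig1 => p _; apply: vanish.
have [Hp|Hp] := ltP p (- M%:Z); [by left|right; lia].
Qed.

Lemma lconv_laurent f h : is_laurent f -> is_laurent h -> is_laurent (lconv f h).
Proof.
move=> /laurent_sh[M Hf] /laurent_sh[N Hh].
have [a ->] := Hf _ (leqnn _); have [c ->] := Hh _ (leqnn _).
by rewrite lconv_sh; exact: sh_laurent.
Qed.

Lemma conv_bilin : bilin conv.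
Proof.
split=> y c f f'; apply/funext => k; rewrite !fctE /conv scaler_sumr -big_split /=;
  apply: eq_bigr => p _; rewrite ?fctE.
  by rewrite (bilinDl bb) (bilinZl bb).
by rewrite (bilinDr bb) (bilinZr bb).
Qed.

Lemma lconvPl c f f' h : is_laurent f -> is_laurent f' -> is_laurent h ->
  lconv (c *: f + f') h = c *: lconv f h + lconv f' h.
Proof.
move=> /laurent_sh[M1 Hf] /laurent_sh[M2 Hf'] /laurent_sh[N Hh].
have [a ->] := Hf _ (leq_maxl M1 M2); have [a' ->] := Hf' _ (leq_maxr M1 M2).
have [e ->] := Hh _ (leqnn _); rewrite shP !lconv_sh shP.
by rewrite (bilinDl conv_bilin) (bilinZl conv_bilin).
Qed.

Lemma lconvPr c f h h' : is_laurent f -> is_laurent h -> is_laurent h' ->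
  lconv f (c *: h + h') = c *: lconv f h + lconv f h'.
Proof.
move=> /laurent_sh[N Hf] /laurent_sh[M1 Hh] /laurent_sh[M2 Hh'].
have [a ->] := Hh _ (leq_maxl M1 M2); have [a' ->] := Hh' _ (leq_maxr M1 M2).
have [e ->] := Hf _ (leqnn _); rewrite shP !lconv_sh shP.
by rewrite (bilinDr conv_bilin) (bilinZr conv_bilin).
Qed.

End Convolution.

Lemma convC (F : fieldType) (U V W : lmodType F) (b : U -> V -> W) f h :
  conv b f h = conv (fun y x => b x y) h f.
Proof. by apply/funext => k; rewrite /conv (sum_convC (fun p q => b (f p) (h q))). Qed.

(** Common normal form of both bracketings of a triple product; Jacobi, invariance and associativity
    are then compared term by term. *)
Definition conv3 (U V W : Type) (Y : nmodType) (T : U -> V -> W -> Y)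
    (f : nat -> U) (g : nat -> V) (h : nat -> W) : nat -> Y := fun k =>
  \sum_(p < k.+1) \sum_(q < (k - p).+1) T (f p) (g q) (h (k - p - q)%N).

Lemma conv3C (U V W : Type) (Y : nmodType) (T : U -> V -> W -> Y) f g h :
  conv3 T f g h = conv3 (fun y x z => T x y z) g f h.
Proof.
apply/funext => k; rewrite /conv3.
rewrite (exchange_triangle (fun p q => T (f p) (g q) (h (k - p - q)%N))).
by apply: eq_bigr => p _; apply: eq_bigr => q _; rewrite subnAC.
Qed.

Section Associativity.
Variables (F : fieldType) (U V W X Y : lmodType F).

Lemma conv_convr (b : U -> X -> Y) (b' : V -> W -> X) f g h : bilin b ->
  conv b f (conv b' g h) = conv3 (fun x y z => b x (b' y z)) f g h.
Proof.
move=> bb; apply/funext => k; apply: eq_bigr => p _.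
by rewrite /conv (bilin_sumr bb).
Qed.

Lemma conv_convl (b : X -> W -> Y) (b' : U -> V -> X) f g h : bilin b ->
  conv b (conv b' f g) h = conv3 (fun x y z => b (b' x y) z) f g h.
Proof.
move=> bb; apply/funext => k; rewrite /conv /conv3.
rewrite -(sum_triangle (fun p q => b (b' (f p) (g q)) (h (k - p - q)%N))).
apply: eq_bigr => p _; rewrite (bilin_suml bb); apply: eq_bigr => q _.
by congr (b _ (h _)); have := ltn_ord q; lia.
Qed.

End Associativity.

Definition mk_linear (F : fieldType) (V W : lmodType F) (L : V -> W)
    (linL : linear L) : {linear V -> W} :=
  HB.pack L (GRing.isLinear.Build F V W *:%R L linL).

Section FiniteSupportLinear.
Variables (F : fieldType) (V W : lmodType F) (L : V -> W).
Hypothesis linL : linear L.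

Let L0 : L 0 = 0.
Proof. by have := linL (-1) 0 0; rewrite scaler0 addr0 scaleN1r addNr. Qed.

Let L_sum (J : Type) (r : seq J) (G : J -> V) :
  L (\sum_(j <- r) G j) = \sum_(j <- r) L (G j).
Proof.
elim: r => [|j r IH]; first by rewrite !big_nil.
by rewrite !big_cons -IH -[G j in LHS]scale1r linL scale1r.
Qed.

Lemma linear_fsum_int (N K : int) (G : int -> V) :
  (forall p, (p < N)%R -> G p = 0) -> (forall p, (K < p)%R -> G p = 0) ->
  L (\sum_(p \in [set: int]) G p) = \sum_(p \in [set: int]) L (G p).
Proof.
move=> GN GK; have GK' p : (N + `|K - N|.+1%:Z <= p)%R -> G p = 0.
  by move=> pK; apply: GK; lia.
rewrite (fsum_int GN GK') (@fsum_int _ N `|K - N|.+1) ?L_sum //.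
  by move=> p /GN ->.
by move=> p /GK' ->.
Qed.

Lemma linear_fsum_nat (N : nat) (G : nat -> V) :
  (forall p, (N <= p)%N -> G p = 0) ->
  L (\sum_(p \in [set: nat]) G p) = \sum_(p < N) L (G p).
Proof. by move=> GN; rewrite (fsum_nat GN) L_sum. Qed.

End FiniteSupportLinear.

Lemma lconv_mono (F : fieldType) (U V W : lmodType F) (b : U -> V -> W) u p h k :
  bilin b -> lconv b (lser (mono u p)) h k = b u (h (k - p%:Z)).
Proof.
move=> bb; rewrite /lconv (@fsum_seq _ _ [:: p%:Z]) //.
  by rewrite big_seq1 /= /mono eqxx.
move=> q; rewrite inE => qp; case: q qp => q qp; rewrite /= ?(bilin0l bb) //.
by rewrite /mono ifN ?(bilin0l bb).
Qed.

Lemma laurent_sum (F : fieldType) (V : lmodType F) (J : Type) (s : seq J)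
    (u : J -> int -> V) :
  (forall j, is_laurent (u j)) -> is_laurent (\sum_(j <- s) u j).
Proof.
move=> ul; elim/big_rec: _ => [|j v _ vl]; first exact: laurent0.
by rewrite -[u j]scale1r; exact: laurentP.
Qed.

Lemma lconvBr (F : fieldType) (U V W : lmodType F) (b : U -> V -> W) f u v :
  bilin b -> is_laurent f -> is_laurent u -> is_laurent v ->
  lconv b f (u - v) = lconv b f u - lconv b f v.
Proof.
move=> bb fl ul vl; rewrite -[- v]scaleN1r addrC (lconvPr bb) // scaleN1r.
exact: addrC.
Qed.

Lemma lconv_sumr (F : fieldType) (U V W : lmodType F) (b : U -> V -> W)
    (J : Type) (s : seq J) (f : int -> U) (u : J -> int -> V) :
  bilin b -> is_laurent f -> (forall j, is_laurent (u j)) ->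
  lconv b f (\sum_(j <- s) u j) = \sum_(j <- s) lconv b f (u j).
Proof.
move=> bb fl ul; elim: s => [|j s IH].
  rewrite !big_nil; apply/funext => k; apply: fsbig1 => p _.
  exact: bilin0r.
rewrite !big_cons -[u j in LHS]scale1r (lconvPr bb) // ?IH ?scale1r //.
exact: laurent_sum.
Qed.

(** * Killing form and contractions of tensors *)

Section Killing.
Variables (F : fieldType) (g : lieAlgType F).

Lemma lie_bilin : bilin (@lie F g).
Proof. by split; [exact: lie_linearl | exact: lie_linearr]. Qed.

Lemma lie_anti (x y : g) : lie x y = - lie y x.
Proof.
have := liexx (x + y); rewrite (bilinDl lie_bilin) !(bilinDr lie_bilin) !liexx.
by rewrite add0r addr0 => /eqP; rewrite addr_eq0 => /eqP.
Qed.

Lemma lie_derivation (x y z : g) :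
  lie x (lie y z) = lie (lie x y) z + lie y (lie x z).
Proof.
have /eqP := lie_jacobi x y z; rewrite -addrA addr_eq0 => /eqP ->.
by rewrite opprD addrC (lie_anti z) opprK (lie_anti z) (bilinNr lie_bilin) opprK.
Qed.

Definition ad (a : g) : 'End(g) :=
  linfun (HB.pack_for {linear g -> g} (lie a)
    (GRing.isLinear.Build F g g *:%R (lie a) (lie_linearr a))).

Lemma adE a x : ad a x = lie a x. Proof. by rewrite lfunE. Qed.

Definition etrace (A : 'End(g)) : F := endo_trace A.

Lemma etrace_linear : linear (etrace : _ -> F^o).
Proof.
move=> c A B; rewrite /etrace /endo_trace scaler_sumr -big_split /=.
by apply: eq_bigr => j _; rewrite !lfunE /= lfunE /= linearD linearZ.
Qed.

Lemma etraceC (A B : 'End(g)) : etrace (A \o B)%VF = etrace (B \o A)%VF.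
Proof.
have expand (C D : 'End(g)) : etrace (C \o D)%VF =
    \sum_(j < \dim {:g}) \sum_(k < \dim {:g})
    coord (vbasis {:g}) k (D (vbasis {:g})`_j) *
    coord (vbasis {:g}) j (C (vbasis {:g})`_k).
  apply: eq_bigr => j _; rewrite lfunE /=.
  rewrite {1}(coord_vbasis (memvf (D _))) !linear_sum.
  by apply: eq_bigr => k _; rewrite !linearZ.
rewrite !expand exchange_big; apply: eq_bigr => j _; apply: eq_bigr => k _.
exact: mulrC.
Qed.

Lemma killingE (a b : g) : killing a b = etrace (ad a \o ad b)%VF.
Proof.
by apply: eq_bigr => j _; rewrite lfunE /= !adE.
Qed.

Lemma killingC (a b : g) : killing a b = killing b a.
Proof. by rewrite !killingE etraceC. Qed.

Lemma comp_lfun_bilin : bilin (fun A B : 'End(g) => (A \o B)%VF).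
Proof.
split=> y c A B; first by rewrite comp_lfunDl comp_lfunZl.
by rewrite comp_lfunDr comp_lfunZr.
Qed.

Lemma ad_linear : linear ad.
Proof.
move=> c x y; apply/lfunP => z; rewrite !lfunE /= lfunE /= !lfunE /=.
by rewrite (bilinDl lie_bilin) (bilinZl lie_bilin).
Qed.

Lemma killing_bilin : bilin (@killing F g : g -> g -> F^o).
Proof.
have killing_linearl (y : g) : linear (fun x : g => killing x y : F^o).
  move=> c x x'; rewrite !killingE ad_linear (bilinDl comp_lfun_bilin).
  by rewrite (bilinZl comp_lfun_bilin) etrace_linear.
split=> // x c y y'; rewrite !(killingC x); exact: killing_linearl.
Qed.

Lemma ad_lie (a b : g) :
  ad (lie a b) = (ad a \o ad b)%VF - (ad b \o ad a)%VF.
Proof.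
apply/lfunP => x; rewrite !lfunE /= !lfunE /= !lfunE /= !adE.
by rewrite lie_derivation addrK.
Qed.

Lemma killing_lie (a b c : g) : killing (lie a b) c = killing a (lie b c).
Proof.
rewrite !killingE !ad_lie (bilinDl comp_lfun_bilin) (bilinDr comp_lfun_bilin).
rewrite (bilinNl comp_lfun_bilin) (bilinNr comp_lfun_bilin).
rewrite -!scaleN1r ![_ + -1 *: _]addrC !etrace_linear !comp_lfunA.
have -> : etrace ((ad a \o ad c) \o ad b)%VF = etrace ((ad b \o ad a) \o ad c)%VF.
  by rewrite etraceC comp_lfunA.
by [].
Qed.

End Killing.

Section Contraction.
Variables (F : fieldType) (g : lieAlgType F).
Local Notation g2 := (tensor g g).
Local Notation g3 := (tensor (tensor g g) g).

Lemma tens_bilin (U V : vectType F) : bilin (@tens F U V).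
Proof.
split=> v c x y; apply/matrixP => p q; rewrite !mxE linearP.
  by rewrite mulrDl mulrA.
by rewrite mulrDr mulrCA.
Qed.

Lemma tens_lift_bilin (U V : vectType F) (W : lmodType F) (b : U -> V -> W) u v :
  bilin b -> tens_lift b (tens u v) = b u v.
Proof. by case; exact: tens_lift_tens. Qed.

Lemma eq_on_tens (U V : vectType F) (W : lmodType F) (f f' : tensor U V -> W) :
  linear f -> linear f' -> (forall u v, f (tens u v) = f' (tens u v)) ->
  forall t, f t = f' t.
Proof.
move=> lf lf' ff' t.
pose L : {linear tensor U V -> W} :=
  HB.pack f (GRing.isLinear.Build F _ W *:%R f lf).
pose L' : {linear tensor U V -> W} :=
  HB.pack f' (GRing.isLinear.Build F _ W *:%R f' lf').
rewrite -[LHS]/(L t) -[RHS]/(L' t) !tens_liftE /tens_lift.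
by apply: eq_bigr => p _; apply: eq_bigr => q _; rewrite /= ff'.
Qed.

Lemma tens_lift_param (U V : vectType F) (X W : lmodType F)
    (f : X -> U -> V -> W) (t : tensor U V) :
  (forall u v, linear (fun x => f x u v)) -> linear (fun x => tens_lift (f x) t).
Proof.
move=> lf c x y; rewrite /tens_lift scaler_sumr -big_split /=.
apply: eq_bigr => p _; rewrite scaler_sumr -big_split /=; apply: eq_bigr => q _.
by rewrite lf scalerDr !scalerA mulrC.
Qed.

Lemma linear_compose (X Y Z : lmodType F) (f : Y -> Z) (h : X -> Y) :
  linear f -> linear h -> linear (fun x => f (h x)).
Proof. by move=> lf lh c x y; rewrite lh lf. Qed.

(* Through the Killing form, a tensor t becomes the linear map [ctr t], with
   adjoint [ctl t]. *)
Definition ctr (V : vectType F) (t : tensor V g) (v : g) : V :=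
  tens_lift (fun a b => (killing b v : F) *: a) t.
Definition ctl (t : g2) (u : g) : g :=
  tens_lift (fun a b => (killing a u : F) *: b) t.

Lemma ctr_tens (V : vectType F) (a : V) b v :
  ctr (tens a b) v = (killing b v : F) *: a.
Proof.
rewrite /ctr tens_lift_bilin //; split=> y c x x'.
  by rewrite scalerDr !scalerA mulrC.
by rewrite (killing_bilin g).1 scalerDl scalerA.
Qed.

Lemma ctl_tens a b v : ctl (tens a b) v = (killing a v : F) *: b.
Proof.
rewrite /ctl tens_lift_bilin //; split=> y c x x'.
  by rewrite (killing_bilin g).1 scalerDl scalerA.
by rewrite scalerDr !scalerA mulrC.
Qed.

Lemma ctr_bilin (V : vectType F) : bilin (@ctr V).
Proof.
split=> [v|t]; first exact: tens_lift_linear.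
apply: tens_lift_param => a b c x y.
by rewrite (killing_bilin g).2 scalerDl scalerA.
Qed.

Lemma ctl_bilin : bilin ctl.
Proof.
split=> [v|t]; first exact: tens_lift_linear.
apply: tens_lift_param => a b c x y.
by rewrite (killing_bilin g).2 scalerDl scalerA.
Qed.

Lemma killing_ctl (t : g2) u v : killing (ctl t u) v = killing (ctr t v) u.
Proof.
apply: (@eq_on_tens g g F^o (fun t => killing (ctl t u) v)
                            (fun t => killing (ctr t v) u)).
- by move=> c s s'; rewrite (ctl_bilin).1 (killing_bilin g).1.
- by move=> c s s'; rewrite (ctr_bilin g).1 (killing_bilin g).1.
move=> a b; rewrite ctl_tens ctr_tens !(bilinZl (killing_bilin g)).
exact: mulrC.
Qed.

Lemma ctr_map (A B B' : g -> g) (t : g2) v : linear A -> linear B ->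
  (forall b, killing (B b) v = killing b (B' v)) ->
  ctr (tens_map A B t) v = A (ctr t (B' v)).
Proof.
move=> lA lB adj.
apply: (@eq_on_tens g g g (fun t => ctr (tens_map A B t) v)
                          (fun t => A (ctr t (B' v)))).
- by move=> c s s'; rewrite /tens_map tens_lift_linear (ctr_bilin g).1.
- by move=> c s s'; rewrite (ctr_bilin g).1 lA.
move=> a b; rewrite /tens_map tens_lift_bilin.
  rewrite !ctr_tens adj; pose L : {linear g -> g} :=
    HB.pack A (GRing.isLinear.Build F g g *:%R A lA).
  by rewrite -[RHS]/(L _) linearZ.
split=> x.
  exact: (linear_compose ((tens_bilin g g).1 (B x)) lA).
exact: (linear_compose ((tens_bilin g g).2 (A x)) lB).
Qed.

Lemma ctr_map_liel x (t : g2) v :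
  ctr (tens_map (lie x) id t) v = lie x (ctr t v).
Proof. by rewrite (@ctr_map _ _ id) //; exact: lie_linearr. Qed.

(** The sign is the skewness of ad x for the Killing form. *)
Lemma ctr_map_lier x (t : g2) v :
  ctr (tens_map id (lie x) t) v = - ctr t (lie x v).
Proof.
rewrite (@ctr_map _ _ (fun v => - lie x v)) ?(bilinNr (ctr_bilin g)) //.
  exact: lie_linearr.
move=> b; rewrite lie_anti (bilinNl (killing_bilin g)) killing_lie.
by rewrite (bilinNr (killing_bilin g)).
Qed.

Lemma ctr_flip (h : nat -> nat -> g2) k l v : ctr (flip h k l) v = ctl (h l k) v.
Proof.
apply: (@eq_on_tens g g g (fun t => ctr (tens_lift (fun a b => tens b a) t) v)
                          (fun t => ctl t v)).
- by move=> c s s'; rewrite tens_lift_linear (ctr_bilin g).1.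
- exact: (ctl_bilin).1.
move=> a b; rewrite tens_lift_bilin ?ctr_tens ?ctl_tens //.
by split=> x; [exact: (tens_bilin g g).2 | exact: (tens_bilin g g).1].
Qed.

(** The third factor is contracted with w and the second with v. This and the next two lemmas turn
    the three terms of the Yang-Baxter equation into identities in g; in the other two, invariance
    moves the bracket onto the test vectors. *)
Lemma ctr_br12_13 (X Y : g2) v w :
  ctr (ctr (br12_13 X Y) w) v = lie (ctr X v) (ctr Y w).
Proof.
pose T a b c d : g3 := tens (tens (lie a c) b) d.
have linT1 b c d : linear (fun a => T a b c d).
  by move=> k x y; rewrite /T (lie_bilin g).1 !(tens_bilin _ _).1.
have linT2 a c d : linear (fun b => T a b c d).
  by move=> k x y; rewrite /T (tens_bilin _ _).2 !(tens_bilin _ _).1.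
have linT3 a b d : linear (fun c => T a b c d).
  by move=> k x y; rewrite /T (lie_bilin g).2 !(tens_bilin _ _).1.
have linT4 a b c : linear (fun d => T a b c d) by exact: (tens_bilin _ _).2.
apply: (@eq_on_tens g g g (fun X => ctr (ctr (br12_13 X Y) w) v)
                          (fun X => lie (ctr X v) (ctr Y w))).
- by move=> k s s'; rewrite /br12_13 tens_lift_linear !(ctr_bilin _).1.
- by move=> k s s'; rewrite (ctr_bilin _).1 (lie_bilin g).1.
move=> a b; rewrite /br12_13 tens_lift_bilin; last first.
  by split=> x; apply: tens_lift_param => *; [exact: linT1 | exact: linT2].
apply: (@eq_on_tens g g g (fun Y => ctr (ctr (tens_lift (T a b) Y) w) v)
                          (fun Y => lie (ctr (tens a b) v) (ctr Y w))).
- by move=> k s s'; rewrite tens_lift_linear !(ctr_bilin _).1.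
- by move=> k s s'; rewrite (ctr_bilin _).1 (lie_bilin g).2.
move=> c d; rewrite tens_lift_bilin; last by split.
rewrite /T !ctr_tens (bilinZl (ctr_bilin _)) ctr_tens.
by rewrite (bilinZl (lie_bilin g)) (bilinZr (lie_bilin g)) !scalerA mulrC.
Qed.

Lemma ctr_br12_23 (X Y : g2) v w :
  ctr (ctr (br12_23 X Y) w) v = ctr X (lie (ctr Y w) v).
Proof.
pose T a b c d : g3 := tens (tens a (lie b c)) d.
have linT1 b c d : linear (fun a => T a b c d).
  by move=> k x y; rewrite /T !(tens_bilin _ _).1.
have linT2 a c d : linear (fun b => T a b c d).
  by move=> k x y; rewrite /T (lie_bilin g).1 (tens_bilin _ _).2 !(tens_bilin _ _).1.
have linT3 a b d : linear (fun c => T a b c d).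
  by move=> k x y; rewrite /T (lie_bilin g).2 (tens_bilin _ _).2 !(tens_bilin _ _).1.
have linT4 a b c : linear (fun d => T a b c d) by exact: (tens_bilin _ _).2.
apply: (@eq_on_tens g g g (fun X => ctr (ctr (br12_23 X Y) w) v)
                          (fun X => ctr X (lie (ctr Y w) v))).
- by move=> k s s'; rewrite /br12_23 tens_lift_linear !(ctr_bilin _).1.
- exact: (ctr_bilin _).1.
move=> a b; rewrite /br12_23 tens_lift_bilin; last first.
  by split=> x; apply: tens_lift_param => *; [exact: linT1 | exact: linT2].
apply: (@eq_on_tens g g g (fun Y => ctr (ctr (tens_lift (T a b) Y) w) v)
                          (fun Y => ctr (tens a b) (lie (ctr Y w) v))).
- by move=> k s s'; rewrite tens_lift_linear !(ctr_bilin _).1.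
- by move=> k s s'; rewrite (ctr_bilin _).1 (lie_bilin g).1 (ctr_bilin _).2.
move=> c d; rewrite tens_lift_bilin; last by split.
rewrite /T !ctr_tens (bilinZl (ctr_bilin _)) ctr_tens.
by rewrite (bilinZl (lie_bilin g)) (bilinZr (killing_bilin g)) killing_lie scalerA.
Qed.

Lemma ctr_br13_23 (X Y : g2) v w :
  ctr (ctr (br13_23 X Y) w) v = ctr X (lie (ctl Y v) w).
Proof.
pose T a b c d : g3 := tens (tens a c) (lie b d).
have linT1 b c d : linear (fun a => T a b c d).
  by move=> k x y; rewrite /T !(tens_bilin _ _).1.
have linT2 a c d : linear (fun b => T a b c d).
  by move=> k x y; rewrite /T (lie_bilin g).1 (tens_bilin _ _).2.
have linT3 a b d : linear (fun c => T a b c d).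
  by move=> k x y; rewrite /T (tens_bilin _ _).2 !(tens_bilin _ _).1.
have linT4 a b c : linear (fun d => T a b c d).
  by move=> k x y; rewrite /T (lie_bilin g).2 (tens_bilin _ _).2.
apply: (@eq_on_tens g g g (fun X => ctr (ctr (br13_23 X Y) w) v)
                          (fun X => ctr X (lie (ctl Y v) w))).
- by move=> k s s'; rewrite /br13_23 tens_lift_linear !(ctr_bilin _).1.
- exact: (ctr_bilin _).1.
move=> a b; rewrite /br13_23 tens_lift_bilin; last first.
  by split=> x; apply: tens_lift_param => *; [exact: linT1 | exact: linT2].
apply: (@eq_on_tens g g g (fun Y => ctr (ctr (tens_lift (T a b) Y) w) v)
                          (fun Y => ctr (tens a b) (lie (ctl Y v) w))).
- by move=> k s s'; rewrite tens_lift_linear !(ctr_bilin _).1.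
- by move=> k s s'; rewrite (ctl_bilin).1 (lie_bilin g).1 (ctr_bilin _).2.
move=> c d; rewrite tens_lift_bilin; last by split.
rewrite /T ctl_tens !ctr_tens (bilinZl (ctr_bilin _)) ctr_tens.
rewrite (bilinZl (lie_bilin g)) (bilinZr (killing_bilin g)) -killing_lie scalerA.
by rewrite mulrC.
Qed.

(** A rotation of the factors is moved onto the test vectors, so that [alt3] becomes a cyclic sum
    over (u, v, w). *)
Lemma killing_cycle3 (T : g3) u v w :
  killing (ctr (ctr (cycle3 T) w) v) u = killing (ctr (ctr T v) u) w.
Proof.
have kb := killing_bilin g.
have tri : bilin (fun a b : g => fun c : g => tens (tens b c) a : g3).
  split=> x k a b; apply/funext => c; rewrite !fctE ?(tens_bilin _ _).2 //.
  by rewrite (tens_bilin g g).1 (tens_bilin _ _).1.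
have linL (c : g) : linear (fun ab : g2 =>
    tens_lift (fun a b => tens (tens b c) a : g3) ab) by exact: tens_lift_linear.
have linR ab : linear (fun c => tens_lift (fun a b => tens (tens b c) a : g3) ab).
  apply: tens_lift_param => a b k x y.
  by rewrite (tens_bilin g g).2 (tens_bilin _ _).1.
apply: (@eq_on_tens g2 g F^o (fun T => killing (ctr (ctr (cycle3 T) w) v) u)
                          (fun T => killing (ctr (ctr T v) u) w)).
- by move=> k s s'; rewrite /cycle3 tens_lift_linear !(ctr_bilin _).1 kb.1.
- by move=> k s s'; rewrite !(ctr_bilin _).1 kb.1.
move=> ab c; rewrite /cycle3 tens_lift_bilin; last by split.
apply: (@eq_on_tens g g F^o (fun ab => killing
    (ctr (ctr (tens_lift (fun a b => tens (tens b c) a : g3) ab) w) v) u)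
    (fun ab => killing (ctr (ctr (tens ab c) v) u) w)).
- by move=> k s s'; rewrite tens_lift_linear !(ctr_bilin _).1 kb.1.
- by move=> k s s'; rewrite (tens_bilin _ _).1 !(ctr_bilin _).1 kb.1.
move=> a b; rewrite tens_lift_bilin; last first.
  split=> x k y z; first by rewrite (tens_bilin _ _).2.
  by rewrite (tens_bilin g g).1 (tens_bilin _ _).1.
rewrite !ctr_tens !(bilinZl (ctr_bilin _)) !ctr_tens !(bilinZl kb).
rewrite -[LHS]/(_ * (_ * _)) -[RHS]/(_ * (_ * _)).
by rewrite mulrC -mulrA [killing b u * _]mulrC.
Qed.

End Contraction.

Section Orthonormal.
Variables (F : fieldType) (g : lieAlgType F).
Variables (n : nat) (I : n.-tuple g) (Iorth : killing_orthonormal I).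
Local Notation g2 := (tensor g g).

Lemma coord_killing a v : coord I a v = killing v I`_a.
Proof.
rewrite [v in RHS](coord_basis Iorth.1 (memvf v)) (bilin_suml (killing_bilin g)).
rewrite (bigD1 a) //= (bilinZl (killing_bilin g)) Iorth.2 eqxx.
rewrite big1 ?addr0 => [|b ba]; first by rewrite -[_ *: _]/(_ * _) mulr1.
by rewrite (bilinZl (killing_bilin g)) Iorth.2 (negbTE ba) scaler0.
Qed.

Lemma killing_expand v : v = \sum_(a < n) (killing v I`_a : F) *: I`_a.
Proof.
rewrite {1}(coord_basis Iorth.1 (memvf v)).
by apply: eq_bigr => a _; rewrite coord_killing.
Qed.

Lemma killing_inj (a a' : g) : (forall b, killing a b = killing a' b) -> a = a'.
Proof.
move=> aa'; rewrite (killing_expand a) (killing_expand a').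
by apply: eq_bigr => b _; rewrite aa'.
Qed.

Lemma killing_nondeg (a : g) : (forall b, killing a b = 0) -> a = 0.
Proof.
by move=> a0; apply: killing_inj => b; rewrite a0 (bilin0l (killing_bilin g)).
Qed.

(** A central element has ad a = 0, hence lies in the radical of the Killing form. This allows an
    identity in g to be checked after bracketing with every vector. *)
Lemma center0 (a : g) : (forall b, lie a b = 0) -> a = 0.
Proof.
move=> a0; apply: killing_nondeg => b; rewrite killingE.
have -> : ad a = 0 by apply/lfunP => x; rewrite adE a0 lfunE.
rewrite (bilin0l (comp_lfun_bilin g)).
by have := @etrace_linear F g (-1) 0 0; rewrite scaler0 addr0 scaleN1r addNr.
Qed.

Lemma ctr_expand (V : vectType F) (t : tensor V g) :
  t = \sum_(a < n) tens (ctr t I`_a) I`_a.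
Proof.
apply: (@eq_on_tens F V g _ id (fun t => \sum_(a < n) tens (ctr t I`_a) I`_a)) => //.
  move=> c s s'; rewrite scaler_sumr -big_split /=; apply: eq_bigr => a _.
  by rewrite (ctr_bilin g _).1 (tens_bilin _ _).1.
move=> u v; rewrite {1}(killing_expand v) (bilin_sumr (tens_bilin _ _)).
apply: eq_bigr => a _; rewrite ctr_tens (bilinZr (tens_bilin _ _)).
by rewrite (bilinZl (tens_bilin _ _)).
Qed.

Lemma ctr_inj (V : vectType F) (t t' : tensor V g) :
  (forall v, ctr t v = ctr t' v) -> t = t'.
Proof.
move=> tt'; rewrite (ctr_expand t) (ctr_expand t').
by apply: eq_bigr => a _; rewrite tt'.
Qed.

Lemma ctr_Omega v : ctr (Omega I) v = v.
Proof.
rewrite /Omega (bilin_suml (ctr_bilin g _)) [RHS]killing_expand.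
by apply: eq_bigr => a _; rewrite ctr_tens killingC.
Qed.

Lemma pcoef_ctr (h : nat -> nat -> g2) k a j : pcoef I h k a j = ctr (h j k) I`_a.
Proof.
rewrite /pcoef /ctr /tens_lift; apply: eq_bigr => p _; apply: eq_bigr => q _.
by rewrite coord_killing.
Qed.

End Orthonormal.

(** * The Lie algebra D_i *)

Section Ambient.
Variables (F : fieldType) (g : lieAlgType F).
Variable m : nat.
Local Notation i := m.+1.
Local Notation ambient := ((int -> g) * {ffun 'I_m -> g})%type.
Local Notation Dcal := (@Dcal F g m.+1).
Local Notation Dform := (@Dform F g m.+1).
Local Notation Dbracket := (@Dbracket F g m.+1).
Local Notation iota := (@Diota F g m.+1).

Lemma sum_antidiagonal (V : nmodType) (G : nat -> nat -> V) (k : nat) :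
  (k < m)%N ->
  \sum_(p < m) \sum_(q < m | (p + q == k)%N) G p q =
  \sum_(p < k.+1) G p (k - p)%N.
Proof.
move=> km; rewrite (big_ord_widen m (fun p => G p (k - p)%N)) // big_mkcond.
rewrite [RHS]big_mkcond; apply: eq_bigr => p _; rewrite ltnS; case: leqP => pk.
  have qm : (k - p < m)%N by lia.
  rewrite (big_pred1 (Ordinal qm)) //= => q; apply/eqP/eqP => [pq|->].
    by apply/val_inj => /=; lia.
  by rewrite /= subnKC.
by rewrite big1 // => q /eqP; lia.
Qed.

Lemma trunc_repK (V : nmodType) (u : {ffun 'I_m -> V}) : trunc m (trunc_rep u) = u.
Proof. by apply/ffunP => k; rewrite ffunE /trunc_rep valK. Qed.

Lemma trunc_rep_trunc (V : nmodType) (f : nat -> V) k :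
  trunc_rep (trunc m f) k = if (k < m)%N then f k else 0.
Proof.
rewrite /trunc_rep; case: insubP => [p -> <-|/negbTE -> //] /=.
by rewrite ffunE.
Qed.

(** Normal form of the elements of D_i: the pair of x^(-M) a(x) and the class of f. Bracket and form
    become convolutions of a's and of f's, so their laws follow from those of g[[x]]. *)
Definition elt (M : nat) (a f : nat -> g) : ambient := (sh M a, trunc m f).

Lemma iota_elt f : iota f = elt 0 f f.
Proof. by rewrite /iota sh0. Qed.

Lemma eltP c M a a' f f' :
  c *: elt M a f + elt M a' f' = elt M (c *: a + a') (c *: f + f').
Proof.
by congr pair; rewrite /= ?shP //; apply/ffunP => k; rewrite !ffunE.
Qed.

Lemma elt0 M : elt M 0 0 = 0.
Proof.
rewrite -[RHS]/(0 : int -> g, 0 : {ffun _ -> g}); congr pair.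
by apply/funext => k; rewrite /sh; case: (k + _).
Qed.

Lemma elt_Dcal M a f : Dcal (elt M a f).
Proof. exact: sh_laurent. Qed.

Lemma iota_Dcal f : Dcal (iota f).
Proof. by rewrite iota_elt; exact: elt_Dcal. Qed.

Lemma Dcal_elt u : Dcal u ->
  exists M0, forall M, (M0 <= M)%N -> exists a f, u = elt M a f.
Proof.
case: u => u1 u2 /laurent_sh[M0 H]; exists M0 => M /H[a /= ->].
by exists a, (trunc_rep u2); rewrite /elt trunc_repK.
Qed.

Lemma Dcal0 : Dcal 0. Proof. exact: laurent0. Qed.

Lemma DcalP c u v : Dcal u -> Dcal v -> Dcal (c *: u + v).
Proof. exact: laurentP. Qed.

Lemma Dbracket_elt M a f N b h :
  Dbracket (elt M a f) (elt N b h) = elt (M + N) (sbracket a b) (sbracket f h).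
Proof.
congr pair; first exact: (lconv_sh (lie_bilin g)).
apply/ffunP => k; rewrite !ffunE.
rewrite /sbracket; have /= <- := sum_antidiagonal (fun p q => lie (f p) (h q)) (ltn_ord k).
by apply: eq_bigr => p _; apply: eq_bigr => q _; rewrite !ffunE.
Qed.

(** Here i - 2 = m - 1. For m = 0 this exponent is -1, where [lser] vanishes, in agreement with the
    empty sum in the definition of the form. *)
Lemma Dform_elt M a f N b h : Dform (elt M a f) (elt N b h) =
  sh (M + N) (conv (@killing F g : g -> g -> F^o) a b) (m%:Z - 1)
  - lser (conv (@killing F g : g -> g -> F^o) f h) (m%:Z - 1).
Proof.
rewrite /Dform; congr (_ - _).
  rewrite -(lconv_sh (killing_bilin g)) /lconv /=.
  by have -> : i%:Z - 2 = m%:Z - 1 by lia.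
rewrite [i.-1]/=; have [m0|m0] := posnP m.
  rewrite lser_neg ?m0 // big1 // => p; have := ltn_ord p.
  by rewrite [X in (_ < X)%N]m0.
have -> : m%:Z - 1 = (m.-1)%:Z by lia.
have km : (m.-1 < m)%N by lia.
rewrite /= /conv.
have /= <- := sum_antidiagonal (fun p q => killing (f p) (h q) : F^o) km.
apply: eq_bigr => p _; apply: eq_big => [q|q _]; last by rewrite !ffunE.
by apply/eqP/eqP; lia.
Qed.

Lemma sbracket_bilin : bilin (@sbracket F g).
Proof. exact: (conv_bilin (lie_bilin g)). Qed.

Lemma sbracket_anti (f h : nat -> g) : sbracket f h = - sbracket h f.
Proof.
apply/funext => k; rewrite -[LHS]/(conv (@lie F g) f h k) convC fctE -sumrN.
by apply: eq_bigr => p _; exact: lie_anti.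
Qed.

Lemma sbracket_derivation (e f h : nat -> g) :
  sbracket e (sbracket f h) =
  sbracket (sbracket e f) h + sbracket f (sbracket e h).
Proof.
have lb := lie_bilin g; rewrite -![sbracket _ _]/(conv (@lie F g) _ _).
rewrite !conv_convr // conv_convl // [X in _ = _ + X]conv3C.
apply/funext => k; rewrite fctE -big_split; apply: eq_bigr => p _ /=.
by rewrite -big_split; apply: eq_bigr => q _ /=; exact: lie_derivation.
Qed.

(** [ambient] also contains series with unbounded poles, on which the sums defining bracket and form
    may have infinite support; linearity is therefore asserted on D_i only. *)
Definition lin_on (X : lmodType F) (L : ambient -> X) :=
  forall c u v, Dcal u -> Dcal v -> L (c *: u + v) = c *: L u + L v.

Section LinOn.
Variables (X : lmodType F) (L : ambient -> X).
Hypothesis linL : lin_on L.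

Lemma lin_on0 : L 0 = 0.
Proof.
have := linL (-1) Dcal0 Dcal0; rewrite scaler0 addr0 => ->.
by rewrite scaleN1r addNr.
Qed.

Lemma lin_onD u v : Dcal u -> Dcal v -> L (u + v) = L u + L v.
Proof. by move=> Du Dv; rewrite -[u in LHS]scale1r linL // scale1r. Qed.

Lemma lin_onZ c u : Dcal u -> L (c *: u) = c *: L u.
Proof.
by move=> Du; rewrite -[c *: u]addr0 linL ?lin_on0 ?addr0 //; exact: Dcal0.
Qed.

Lemma lin_onN u : Dcal u -> L (- u) = - L u.
Proof. by move=> Du; rewrite -[- u]scaleN1r lin_onZ // scaleN1r. Qed.

End LinOn.

Lemma DcalD u v : Dcal u -> Dcal v -> Dcal (u + v).
Proof. by move=> Du Dv; rewrite -[u]scale1r; exact: DcalP. Qed.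

Lemma DcalZ c u : Dcal u -> Dcal (c *: u).
Proof. by move=> Du; rewrite -[_ *: _]addr0; apply: DcalP => //; exact: Dcal0. Qed.

Lemma DcalN u : Dcal u -> Dcal (- u).
Proof. by move=> Du; rewrite -scaleN1r; exact: DcalZ. Qed.

Lemma Dcal_sum J (r : seq J) (u : J -> ambient) :
  (forall k, Dcal (u k)) -> Dcal (\sum_(k <- r) u k).
Proof.
by move=> Du; elim/big_rec: _ => [|k v _ Dv]; [exact: Dcal0 | exact: DcalD].
Qed.

Lemma lin_on_sum (X : lmodType F) (L : ambient -> X) J (r : seq J)
    (u : J -> ambient) :
  lin_on L -> (forall k, Dcal (u k)) ->
  L (\sum_(k <- r) u k) = \sum_(k <- r) L (u k).
Proof.
move=> lL Du; elim: r => [|k r IH]; first by rewrite !big_nil lin_on0.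
by rewrite !big_cons lin_onD ?IH //; exact: Dcal_sum.
Qed.

Lemma Dcal_elt2 u v : Dcal u -> Dcal v ->
  exists M a f b h, u = elt M a f /\ v = elt M b h.
Proof.
move=> /Dcal_elt[M1 Hu] /Dcal_elt[M2 Hv].
have [a [f ->]] := Hu _ (leq_maxl M1 M2).
have [b [h ->]] := Hv _ (leq_maxr M1 M2).
by exists (maxn M1 M2), a, f, b, h.
Qed.

Lemma Dbracket_Dcal u v : Dcal u -> Dcal v -> Dcal (Dbracket u v).
Proof.
move=> Du Dv; have [M [a [f [b [h [-> ->]]]]]] := Dcal_elt2 Du Dv.
by rewrite Dbracket_elt; exact: elt_Dcal.
Qed.

Lemma Dbracket_linl v : Dcal v -> lin_on (Dbracket^~ v).
Proof.
move=> /Dcal_elt[N Hv] c u u' Du Du'; have [b [h ->]] := Hv _ (leqnn _).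
have [M [a [f [a' [f' [-> ->]]]]]] := Dcal_elt2 Du Du'.
rewrite eltP !Dbracket_elt eltP.
by rewrite !(bilinDl sbracket_bilin) !(bilinZl sbracket_bilin).
Qed.

Lemma Dbracket_anti u v : Dcal u -> Dcal v -> Dbracket u v = - Dbracket v u.
Proof.
move=> Du Dv; have [M [a [f [b [h [-> ->]]]]]] := Dcal_elt2 Du Dv.
rewrite !Dbracket_elt (sbracket_anti a) (sbracket_anti f).
by rewrite -[RHS]addr0 -[in RHS](elt0 (M + M)) -[X in X + _]scaleN1r eltP !addr0 !scaleN1r.
Qed.

Lemma Dbracket_linr u : Dcal u -> lin_on (Dbracket u).
Proof.
move=> Du c v v' Dv Dv'; rewrite Dbracket_anti //; last exact: DcalP.
rewrite (Dbracket_linl Du) // (Dbracket_anti Dv) // (Dbracket_anti Dv') //.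
by rewrite opprD opprK scalerN opprK.
Qed.

Lemma Dbracket_derivation u v w : Dcal u -> Dcal v -> Dcal w ->
  Dbracket u (Dbracket v w) =
  Dbracket (Dbracket u v) w + Dbracket v (Dbracket u w).
Proof.
move=> Du Dv /Dcal_elt[N Hw]; have [e [l ->]] := Hw _ (leqnn _).
have [M [a [f [b [h [-> ->]]]]]] := Dcal_elt2 Du Dv.
rewrite !Dbracket_elt addnA -[X in _ = X + _]scale1r eltP !scale1r.
by rewrite -!sbracket_derivation.
Qed.

Local Notation kappa := (@killing F g : g -> g -> F^o).

Lemma kconv_bilin : bilin (conv kappa).
Proof. exact: (conv_bilin (killing_bilin g)). Qed.

Lemma kconvC a b : conv kappa a b = conv kappa b a.
Proof. by rewrite convC; apply/funext => k; apply: eq_bigr => p _; rewrite killingC. Qed.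

Lemma kconv_sbracket a b c :
  conv kappa (sbracket a b) c = conv kappa a (sbracket b c).
Proof.
rewrite conv_convr ?conv_convl; try exact: (killing_bilin g).
apply/funext => k; apply: eq_bigr => p _; apply: eq_bigr => q _.
by rewrite killing_lie.
Qed.

Lemma DformC u v : Dcal u -> Dcal v -> Dform u v = Dform v u.
Proof.
move=> Du Dv; have [M [a [f [b [h [-> ->]]]]]] := Dcal_elt2 Du Dv.
by rewrite !Dform_elt (kconvC a) (kconvC f).
Qed.

Lemma Dform_linl v : Dcal v -> lin_on (Dform^~ v : _ -> F^o).
Proof.
move=> /Dcal_elt[N Hv] c u u' Du Du'; have [b [h ->]] := Hv _ (leqnn _).
have [M [a [f [a' [f' [-> ->]]]]]] := Dcal_elt2 Du Du'.
rewrite eltP !Dform_elt !(bilinDl kconv_bilin) !(bilinZl kconv_bilin).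
rewrite -!(shP (V := F^o)) !sh0 -(shP (V := F^o)) !fctE scalerBr opprD.
exact: addrACA.
Qed.

Lemma Dform_linr u : Dcal u -> lin_on (Dform u : _ -> F^o).
Proof.
move=> Du c v v' Dv Dv'; rewrite DformC ?(Dform_linl Du) //; last exact: DcalP.
by rewrite (DformC Dv) // (DformC Dv').
Qed.

Lemma Dform_bracket u v w : Dcal u -> Dcal v -> Dcal w ->
  Dform (Dbracket u v) w = Dform u (Dbracket v w).
Proof.
move=> Du Dv /Dcal_elt[N Hw]; have [e [l ->]] := Hw _ (leqnn _).
have [M [a [f [b [h [-> ->]]]]]] := Dcal_elt2 Du Dv.
by rewrite !Dbracket_elt !Dform_elt addnA !kconv_sbracket.
Qed.

Lemma iota_linear : linear iota.
Proof. by move=> c f h; rewrite !iota_elt eltP. Qed.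

Lemma iota0 : iota 0 = 0. Proof. by rewrite iota_elt elt0. Qed.

Lemma Dform_iota f h : Dform (iota f) (iota h) = 0.
Proof. by rewrite !iota_elt Dform_elt addn0 -sh0 subrr. Qed.

Lemma Dbracket_iota f h : Dbracket (iota f) (iota h) = iota (sbracket f h).
Proof. by rewrite !iota_elt Dbracket_elt. Qed.

End Ambient.
#[local] Hint Resolve iota_Dcal Dcal0 DcalD DcalN DcalZ Dcal_sum Dbracket_Dcal : core.

(** * Complements of g[[x]] *)

Section DualBasis.
Variables (F : fieldType) (g : lieAlgType F).
Variables (n : nat) (I : n.-tuple g) (Iorth : killing_orthonormal I).
Variable m : nat.
Local Notation i := m.+1.
Local Notation ambient := ((int -> g) * {ffun 'I_m -> g})%type.
Local Notation Dcal := (@Dcal F g m.+1).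
Local Notation Dform := (@Dform F g m.+1).
Local Notation iota := (@Diota F g m.+1).
Local Notation g2 := (tensor g g).
Local Notation kappa := (@killing F g : g -> g -> F^o).

Local Notation kb := (killing_bilin g).

(* [polarpart k v] is dual to v x^k under the form; [pr k] reads off the
   component of an element of D_i along it modulo iota(g[[x]]). *)
Definition polarpart (k : nat) (v : g) : ambient :=
  if (k < m)%N then (0, - trunc m (mono v (m - k - 1)%N))
  else (lmono v (m%:Z - k%:Z - 1), 0).

Definition pr (k : nat) (u : ambient) : g :=
  u.1 (m%:Z - k%:Z - 1)
  - (if (k < m)%N then trunc_rep u.2 (m - k - 1)%N else 0).

Lemma polarpart_elt k v : polarpart k v =
  if (k < m)%N then elt m 0 0 (- mono v (m - k - 1)%N)
  else elt m (k.+1 - m) (mono v 0%N) 0.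
Proof.
rewrite /polarpart; case: ltnP => km; congr pair.
- by apply/funext => j; rewrite /sh; case: (j + _).
- by apply/ffunP => j; rewrite !ffunE.
- by rewrite -lmono_sh; congr lmono; lia.
Qed.

Lemma polarpart_Dcal k v : Dcal (polarpart k v).
Proof. by rewrite polarpart_elt; case: ifP => _; exact: elt_Dcal. Qed.

Lemma mono_linear (V : lmodType F) k : linear (fun v : V => mono v k).
Proof.
move=> c v v'; apply/funext => j; rewrite !fctE /mono; case: eqP => // _.
by rewrite scaler0 addr0.
Qed.

Lemma polarpart_linear k : linear (polarpart k).
Proof.
move=> c v v'; rewrite !polarpart_elt mono_linear; case: ifP => _.
  by rewrite eltP scaler0 addr0 scalerN -opprD.
by rewrite eltP scaler0 addr0 mono_linear.
Qed.

Lemma pr_linear k : linear (pr k).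
Proof.
move=> c u v; rewrite /pr /= !fctE scalerBr [RHS]addrACA -opprD; congr (_ - _).
case: ifP => _; last by rewrite scaler0 addr0.
rewrite /trunc_rep; case: insub => [j|] /=; last by rewrite scaler0 addr0.
by rewrite !ffunE.
Qed.

Definition prL (k : nat) : {linear ambient -> g} :=
  HB.pack (pr k) (GRing.isLinear.Build F ambient g *:%R (pr k) (pr_linear k)).

Lemma pr_iota k f : pr k (iota f) = 0.
Proof.
rewrite /pr /= trunc_rep_trunc; case: ltnP => km; last first.
  by rewrite lser_neg ?subr0 //; lia.
rewrite (_ : m%:Z - k%:Z - 1 = (m - k - 1)%N); last by lia.
by rewrite ifT ?subrr //; lia.
Qed.

Lemma pr_polarpart j k v : pr j (polarpart k v) = if j == k then v else 0.
Proof.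
rewrite /pr /polarpart; case: (ltnP k m) => km /=.
  rewrite sub0r.
  have -> : - trunc m (mono v (m - k - 1)) = trunc m (- mono v (m - k - 1)).
    by apply/ffunP => l; rewrite !ffunE.
  rewrite trunc_rep_trunc; case: ltnP => jm; last by rewrite oppr0 ifN //; lia.
  rewrite ifT; last by lia.
  rewrite fctE opprK /mono; congr (if _ then _ else _).
  by apply/eqP/eqP; lia.
have -> : 0 = trunc m (0 : nat -> g) :> {ffun 'I_m -> g}.
  by apply/ffunP => l; rewrite !ffunE.
rewrite trunc_rep_trunc /lmono; set b := (_ == _); have -> : b = (j == k).
  by rewrite /b; apply/eqP/eqP; lia.
rewrite [X in _ - X](_ : _ = 0) ?subr0 //.
by case: (j < m)%N => //; case: ifP.
Qed.

(** The conditions with k >= m kill the pole of the first component; those with k < m equate the two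
    components below x^m. *)
Lemma pr_eq0 u : (forall k, pr k u = 0) -> u = iota (fun j => u.1 j%:Z).
Proof.
move=> u0; case: u u0 => u1 u2 u0; congr pair.
  apply/funext => -[k|k] //=.
  have := u0 (m + k)%N; rewrite /pr ifN ?subr0 /=; last by lia.
  by have -> : m%:Z - (m + k)%:Z - 1 = Negz k by lia.
apply/ffunP => k; rewrite ffunE /=.
have := u0 (m - k - 1)%N; rewrite /pr ifT /=; last by have := ltn_ord k; lia.
have -> : m%:Z - (m - k - 1)%N%:Z - 1 = k by have := ltn_ord k; lia.
have -> : (m - (m - k - 1) - 1)%N = k by have := ltn_ord k; lia.
by rewrite /trunc_rep valK /= => /eqP; rewrite subr_eq0 => /eqP.
Qed.

Lemma pr_bound u : Dcal u -> exists N, forall k, (N <= k)%N -> pr k u = 0.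
Proof.
case=> N uN; exists (m + `|N|)%N => k Nk; rewrite /pr uN ?ifN ?subr0 //; lia.
Qed.

Lemma eq_pr u v : (forall k, pr k u = pr k v) ->
  u = v + iota (fun j => (u - v).1 j%:Z).
Proof.
move=> uv; rewrite -[LHS](subrK v) addrC; congr (_ + _); apply: pr_eq0 => k.
by rewrite -[LHS]/(prL k (u - v)) linearB /= uv subrr.
Qed.

Lemma sh_zero M : sh M (0 : nat -> F^o) = 0.
Proof. by apply/funext => k; rewrite /sh; case: (k + _). Qed.

Lemma Dform_iota_polarpart f k v : Dform (iota f) (polarpart k v) = killing (f k) v.
Proof.
rewrite iota_elt polarpart_elt; case: ltnP => km; rewrite Dform_elt.
  rewrite (bilin0r (kconv_bilin g)) sh_zero (bilinNr (kconv_bilin g)).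
  have -> : m%:Z - 1 = (m.-1)%:Z by lia.
  rewrite -[LHS]/(0 - (- conv kappa f (mono v (m - k - 1)%N) m.-1)).
  rewrite sub0r opprK (conv_monor kb) ifT; last by lia.
  by congr (killing (f _) v); lia.
rewrite (bilin0r (kconv_bilin g)) sh0 sh_zero subr0 /sh.
have -> : m%:Z - 1 + (0 + (k.+1 - m))%N%:Z = k by lia.
by rewrite /= (conv_monor kb) subn0.
Qed.

(** Only two vectors of the second component can pair: their exponents m-k-1 and m-l-1 add up to m-1
    exactly when k + l + 1 = m. These are the exponents in (x^m - y^m)/(x - y). *)
Lemma Dform_polarpart k v l w : Dform (polarpart k v) (polarpart l w) =
  if (k + l + 1 == m)%N then - killing v w else 0.
Proof.
rewrite !polarpart_elt; case: ltnP => km; case: ltnP => lm; rewrite Dform_elt.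
- rewrite (bilin0r (kconv_bilin g)) sh_zero.
  rewrite (bilinNr (kconv_bilin g)) (bilinNl (kconv_bilin g)) opprK.
  have -> : m%:Z - 1 = (m.-1)%:Z by lia.
  rewrite /= (conv_monor kb) /mono sub0r.
  rewrite ifT; last by lia.
  have -> : (m.-1 - (m - l - 1) == m - k - 1)%N = (k + l + 1 == m)%N.
    by apply/eqP/eqP; lia.
  by case: ifP; rewrite // (bilin0l kb) oppr0.
- rewrite (bilin0l (kconv_bilin g)) (bilin0r (kconv_bilin g)) sh0 !sh_zero subr0.
  by rewrite ifN //; lia.
- rewrite (bilin0r (kconv_bilin g)) (bilin0l (kconv_bilin g)) sh0 !sh_zero subr0.
  by rewrite ifN //; lia.
rewrite (bilin0r (kconv_bilin g)) sh0 sh_zero subr0 /sh ifN; last by lia.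
have -> : m%:Z - 1 + (k.+1 - m + (l.+1 - m))%N%:Z = (k + l + 1 - m)%N by lia.
rewrite /= (conv_monor kb) leq0n subn0 /mono ifN ?(bilin0l kb) //; lia.
Qed.

Section Wvectors.
Variable h : nat -> nat -> g2.

Definition regcol (k : nat) (v : g) : nat -> g := fun j => ctr (h j k) v.

(* The vector w_{k,v} of W_r, linear in v = I_alpha. *)
Definition wl (k : nat) (v : g) : ambient := polarpart k v + iota (regcol k v).

Lemma regcol_linear k : linear (regcol k).
Proof. by move=> c v v'; apply/funext => j; rewrite !fctE /regcol (ctr_bilin _ _).2. Qed.

Lemma wl_linear k : linear (wl k).
Proof.
move=> c v v'; rewrite /wl polarpart_linear regcol_linear iota_linear.
by rewrite scalerDr [LHS]addrACA.
Qed.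

Definition wlL (k : nat) : {linear g -> ambient} :=
  HB.pack (wl k) (GRing.isLinear.Build F g ambient *:%R (wl k) (wl_linear k)).

Lemma wl0 k : wl k 0 = 0. Proof. exact: (linear0 (wlL k)). Qed.

Lemma wl_Dcal k v : Dcal (wl k v).
Proof. by apply: DcalD; [exact: polarpart_Dcal | exact: iota_Dcal]. Qed.

Lemma wvec_wl k a : wvec I i h k a = wl k I`_a.
Proof.
have pE : pcoef I h k a = regcol k I`_a.
  by apply/funext => j; rewrite (pcoef_ctr Iorth).
rewrite /wvec /wl /polarpart /= pE; case: ifP => _.
  by rewrite -[RHS]/(_ + _, _ + _) add0r.
by rewrite -[RHS]/(_ + _, _ + _) add0r.
Qed.

Lemma pr_wl j k v : pr j (wl k v) = if j == k then v else 0.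
Proof.
by rewrite /wl -[pr j]/(prL j : _ -> _) linearD /= pr_iota pr_polarpart addr0.
Qed.

Lemma Dform_iota_wl f k v : Dform (iota f) (wl k v) = killing (f k) v.
Proof.
rewrite (lin_onD (Dform_linr (iota_Dcal _ f))).
- by rewrite Dform_iota_polarpart Dform_iota addr0.
- exact: polarpart_Dcal.
- exact: iota_Dcal.
Qed.

Lemma Dform_wl k v l w : Dform (wl k v) (wl l w) =
  killing (ctr (h k l) w + ctl (h l k) w - (if (k + l + 1 == m)%N then w else 0)) v.
Proof.
rewrite (lin_onD (Dform_linl (wl_Dcal l w)));
  [|exact: polarpart_Dcal|exact: iota_Dcal].
rewrite Dform_iota_wl (lin_onD (Dform_linr (polarpart_Dcal k v)));
  [|exact: polarpart_Dcal|exact: iota_Dcal].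
rewrite Dform_polarpart DformC; [|exact: polarpart_Dcal|exact: iota_Dcal].
rewrite Dform_iota_polarpart /regcol -killing_ctl.
rewrite !(bilinDl kb) (bilinNl kb) [in RHS]addrC addrA.
rewrite !killing_ctl; congr (_ + _ + _).
by case: ifP; rewrite ?(bilin0l kb) ?oppr0 // killingC.
Qed.

Definition wsum N (z : nat -> g) : ambient := \sum_(k < N) wl k (z k).

Lemma wsum_Dcal N z : Dcal (wsum N z).
Proof. by apply: Dcal_sum => k; exact: wl_Dcal. Qed.

Lemma WspaceE r : regpart r = h ->
  Wspace I i r = [set u | exists N z, u = wsum N z].
Proof.
move=> rh; apply/seteqP; split=> u [N].
  rewrite rh => -[c ->]; exists N, (fun k => if insub k is Some j then
    \sum_(a < n) c j a *: I`_a else 0).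
  apply: eq_bigr => k _; rewrite valK -[wl k _]/(wlL k _) linear_sum.
  by apply: eq_bigr => a _; rewrite linearZ /= wvec_wl.
move=> [z ->]; exists N, (fun k a => killing (z k) I`_a); rewrite rh.
apply: eq_bigr => k _.
rewrite {1}(killing_expand Iorth (z k)) -[wl k _]/(wlL k _) linear_sum.
by apply: eq_bigr => a _; rewrite linearZ /= wvec_wl.
Qed.

Lemma pr_wsum k N z : pr k (wsum N z) = if (k < N)%N then z k else 0.
Proof.
rewrite /wsum -[LHS]/(prL k _) linear_sum /=.
under eq_bigr do rewrite pr_wl.
case: ltnP => kN.
  rewrite (bigD1 (Ordinal kN)) //= eqxx big1 ?addr0 // => j jk.
  by rewrite ifN // eq_sym; apply: contra jk => /eqP jk; apply/eqP/val_inj.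
by rewrite big1 // => j _; rewrite ifN //; have := ltn_ord j; lia.
Qed.

(** The range N is free as long as the projections vanish beyond it, so two elements of the span can
    be expanded over the same range. *)
Lemma wsum_pr u N : (exists M z, u = wsum M z) ->
  (forall k, (N <= k)%N -> pr k u = 0) -> u = wsum N (pr^~ u).
Proof.
case=> M [z uE] uN.
have widen K : (M <= K)%N -> u = wsum K (pr^~ u).
  move=> MK; rewrite {1}uE /wsum (big_ord_widen K (fun k => wl k (z k))) //.
  rewrite big_mkcond; apply: eq_bigr => k _; rewrite uE pr_wsum.
  by case: ifP; rewrite ?wl0.
rewrite {1}(widen _ (leq_maxl M N)) /wsum.
rewrite [RHS](big_ord_widen (maxn M N) (fun k => wl k (pr k u))) ?leq_maxr //.
rewrite [RHS]big_mkcond; apply: eq_bigr => k _.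
by case: ltnP => // Nk; rewrite uN ?wl0.
Qed.

Lemma Dcal_decompose u N : Dcal u -> (forall k, (N <= k)%N -> pr k u = 0) ->
  u = wsum N (pr^~ u) + iota (fun j => (u - wsum N (pr^~ u)).1 j%:Z).
Proof.
move=> Du uN; apply: eq_pr => k; rewrite pr_wsum.
by case: ltnP => // /uN.
Qed.

Lemma Dform_iota_wsum f N z :
  Dform (iota f) (wsum N z) = \sum_(k < N) killing (f k) (z k).
Proof.
rewrite (lin_on_sum _ (Dform_linr (iota_Dcal _ f))); last by move=> k; exact: wl_Dcal.
by apply: eq_bigr => k _; rewrite Dform_iota_wl.
Qed.

(** Since [pr] is a pairing with elements of iota(g[[x]]), invariance of the form gives the
    projections of a bracket. *)
Lemma Dform_pr u a k : Dcal u -> Dform u (iota (mono a k)) = killing (pr k u) a.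
Proof.
move=> Du; have [N uN] := pr_bound Du.
(* The bound is enlarged so that the index k falls inside the expansion. *)
have uN' j : (N + k.+1 <= j)%N -> pr j u = 0 by move=> Nj; apply: uN; lia.
rewrite (Dcal_decompose Du uN') (lin_onD (Dform_linl (iota_Dcal _ _)));
  [|exact: wsum_Dcal|exact: iota_Dcal].
rewrite Dform_iota addr0 DformC;
  [|exact: wsum_Dcal|exact: iota_Dcal].
rewrite Dform_iota_wsum -(Dcal_decompose Du uN').
have kN : (k < N + k.+1)%N by lia.
rewrite (bigD1 (Ordinal kN)) //= /mono eqxx big1 ?addr0; first exact: killingC.
move=> j jk; rewrite ifN ?(bilin0l kb) //.
Qed.

Definition wspan : set ambient := [set u | exists N z, u = wsum N z].

Lemma wspan_Dcal u : wspan u -> Dcal u.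
Proof. by case=> N [z ->]; exact: wsum_Dcal. Qed.

Lemma wspan_wl k v : wspan (wl k v).
Proof.
exists k.+1, (fun j => if j == k then v else 0).
rewrite /wsum big_ord_recr /= eqxx big1 ?add0r // => j _.
by rewrite ifN ?wl0 //; have := ltn_ord j; lia.
Qed.

Lemma wspanP c u v : wspan u -> wspan v -> wspan (c *: u + v).
Proof.
move=> Wu Wv; have [N uN] := pr_bound (wspan_Dcal Wu).
have [M vM] := pr_bound (wspan_Dcal Wv).
rewrite (wsum_pr (N := (N + M)%N) Wu); last by move=> k Nk; apply: uN; lia.
rewrite (wsum_pr (N := (N + M)%N) Wv); last by move=> k Nk; apply: vM; lia.
exists (N + M)%N, (c *: pr^~ u + pr^~ v).
rewrite /wsum scaler_sumr -big_split; apply: eq_bigr => k _ /=.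
by rewrite !fctE wl_linear.
Qed.

Lemma wspan0 : wspan 0.
Proof. by exists 0%N, (fun=> 0); rewrite /wsum big_ord0. Qed.

Lemma eq_wspan_pr u v : wspan u -> wspan v -> (forall k, pr k u = pr k v) -> u = v.
Proof.
move=> Wu Wv uv; have [N uN] := pr_bound (wspan_Dcal Wu).
rewrite (wsum_pr Wu uN) (wsum_pr (N := N) Wv); last by move=> k /uN; rewrite uv.
by apply: eq_bigr => k _; rewrite uv.
Qed.

Lemma wspan_iota f : wspan (iota f) -> iota f = 0.
Proof.
move=> Wf; apply: eq_wspan_pr => //; first exact: wspan0.
by move=> k; rewrite pr_iota -[RHS]/(prL k 0) linear0.
Qed.

Lemma wspan_complementary : complementary (i := i) wspan.
Proof.
split=> [u Du|f]; last exact: wspan_iota.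
have [N uN] := pr_bound Du.
exists (fun j => (u - wsum N (pr^~ u)).1 j%:Z), (wsum N (pr^~ u)).
by split; [by exists N, (pr^~ u) | rewrite addrC {1}(Dcal_decompose Du uN)].
Qed.

Lemma iota_wl_inj f f' : (forall k v, Dform (iota f) (wl k v) = Dform (iota f') (wl k v)) ->
  f = f'.
Proof.
move=> ff'; apply/funext => k; apply: (killing_inj Iorth) => v.
by rewrite -!Dform_iota_wl ff'.
Qed.

(** The identity g + tau(g) = (x^m - y^m)/(x - y) Omega at x^k y^l, with the second factor
    contracted with w. *)
Definition skew_regular := forall k l w,
  ctr (h k l) w + ctl (h l k) w = if (k + l + 1 == m)%N then w else 0.

Lemma skew_regularP :
  skew_regular <-> forall k v l w, Dform (wl k v) (wl l w) = 0.
Proof.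
split=> [sk k v l w|iso k l w]; first by rewrite Dform_wl sk subrr (bilin0l kb).
apply/eqP; rewrite -subr_eq0; apply/eqP; apply: (killing_nondeg Iorth) => v.
by rewrite -Dform_wl iso.
Qed.

Lemma wspan_isotropic u v : skew_regular -> wspan u -> wspan v -> Dform u v = 0.
Proof.
move=> /skew_regularP iso [N [z ->]] Wv.
rewrite (lin_on_sum _ (Dform_linl (wspan_Dcal Wv))); last by move=> k; exact: wl_Dcal.
apply: big1 => k _; case: Wv => M [z' ->].
rewrite (lin_on_sum _ (Dform_linr (wl_Dcal _ _))); last by move=> l; exact: wl_Dcal.
by apply: big1 => l _; exact: iso.
Qed.

(** An element orthogonal to the span splits as iota f + w with w in the span. By isotropy its
    pairing with w_{k,v} is that of iota f, which reads off f_k, so f = 0. *)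
Lemma wspan_lagrangian : skew_regular -> orthogonal_of (i := i) wspan = wspan.
Proof.
move=> sk; apply/seteqP; split=> u; last first.
  by move=> Wu; split=> [|v Wv]; [exact: wspan_Dcal | exact: wspan_isotropic].
case=> Du orth; have [f [w [Ww uE]]] := wspan_complementary.1 _ Du.
suff -> : u = w by [].
rewrite uE [f](_ : f = 0).
  by rewrite iota0 add0r.
apply: iota_wl_inj => k v; rewrite iota0.
rewrite (lin_on0 (Dform_linl (wl_Dcal k v))) -[RHS](orth _ (wspan_wl k v)) uE.
rewrite (lin_onD (Dform_linl (wl_Dcal k v)));
  [|exact: iota_Dcal|exact: wspan_Dcal].
by rewrite (wspan_isotropic sk Ww (wspan_wl k v)) addr0.
Qed.

End Wvectors.

End DualBasis.
#[local] Hint Resolve polarpart_Dcal wl_Dcal wsum_Dcal : core.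

(** * The action of g[[x]] on r *)

Section Columns.
Variables (F : fieldType) (g : lieAlgType F).
Local Notation g2 := (tensor g g).

Definition column (t : int -> nat -> g2) (l : nat) (v : g) : int -> g :=
  fun k => ctr (t k l) v.

Definition laurent_cols (t : int -> nat -> g2) := forall l, is_laurent (t^~ l).

Lemma column_linear t l : linear (column t l).
Proof. by move=> c v v'; apply/funext => k; rewrite !fctE /column (ctr_bilin _ _).2. Qed.

Lemma column_laurent t l v : laurent_cols t -> is_laurent (column t l v).
Proof.
by move=> /(_ l)[N tN]; exists N => k kN; rewrite /column tN // (bilin0l (ctr_bilin _ _)).
Qed.

Lemma tens_map0 (A B : g -> g) : tens_map A B 0 = 0.
Proof.
by rewrite /tens_map /tens_lift big1 // => p _; rewrite big1 // => q _; rewrite mxE scale0r.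
Qed.

Lemma column_act f t l v : laurent_cols t -> column (act f t) l v =
  lconv (@lie F g) (lser f) (column t l v)
  - \sum_(q < l.+1) column t (l - q) (lie (f q) v).
Proof.
move=> tl; apply/funext => k; have cb := ctr_bilin g g.
rewrite -[RHS]/(lconv _ _ _ k - (\sum_(q < l.+1) column t (l - q) (lie (f q) v)) k).
rewrite fct_sumE /column /act (bilinDl cb); congr (_ + _); last first.
  rewrite (bilin_suml cb) -sumrN; apply: eq_bigr => q _.
  by rewrite ctr_map_lier.
have [N tN] := tl l.
(* For such p the exponent k - p lies below the pole bound N. *)
have far p : (`|k - N|.+1 <= p)%N -> t (k - p%:Z) l = 0 by move=> Hp; apply: tN; lia.
rewrite (fsum_nat (N := `|k - N|.+1)); last first.
  by move=> p /far ->; exact: tens_map0.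
rewrite (bilin_suml cb) /lconv (@fsum_int _ 0 `|k - N|.+1).
- by apply: eq_bigr => p _; rewrite ctr_map_liel add0r.
- by move=> p p0; rewrite lser_neg // (bilin0l (lie_bilin g)).
move=> [p|p] Hp; last by rewrite lser_neg // (bilin0l (lie_bilin g)).
by rewrite far ?(bilin0l cb) ?(bilin0r (lie_bilin g)) //; lia.
Qed.

Variables (n : nat) (I : n.-tuple g) (Iorth : killing_orthonormal I).

Lemma eq_column (t t' : int -> nat -> g2) : (forall l v, column t l v = column t' l v) -> t = t'.
Proof.
move=> tt'; apply/funext => k; apply/funext => l; apply: (ctr_inj Iorth) => v.
exact: (congr1 (fun f => f k) (tt' l v)).
Qed.

End Columns.

Section RMatrixColumns.
Variables (F : fieldType) (g : lieAlgType F).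
Variables (n : nat) (I : n.-tuple g) (Iorth : killing_orthonormal I).
Variable m : nat.
Local Notation Dform := (@Dform F g m.+1).
Local Notation Dbracket := (@Dbracket F g m.+1).
Local Notation iota := (@Diota F g m.+1).
Local Notation g2 := (tensor g g).
Local Notation kb := (killing_bilin g).
Local Notation lb := (lie_bilin g).
Local Notation cb := (ctr_bilin g g).

Variable h : nat -> nat -> g2.
Definition rmat : int -> nat -> g2 := polar I (mono (1 : F) m) + lser2 h.

Lemma regpart_rmat : regpart rmat = h.
Proof. exact: regpart_polar. Qed.

(** The expansion y^m/(x - y) = sum_j x^(-j-1) y^(m+j) places Omega at the exponents (m-l-1, l). *)
Lemma ctr_rmat_neg (k : int) l v : (k < 0)%R ->
  ctr (rmat k l) v = if k == m%:Z - l%:Z - 1 then v else 0.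
Proof.
case: k => // j _; rewrite /rmat !fctE /= addr0 /mono.
case: ifP => jl; last by rewrite ifF ?(bilin0l cb) //; apply/eqP; lia.
have -> : (l - j == m)%N = (Negz j == m%:Z - l%:Z - 1) by apply/eqP/eqP; lia.
case: ifP => _; first by rewrite scale1r (ctr_Omega Iorth).
by rewrite scale0r (bilin0l cb).
Qed.

Lemma ctl_rmat_neg (k : int) l v : (k < 0)%R ->
  ctl (rmat k l) v = if k == m%:Z - l%:Z - 1 then v else 0.
Proof.
move=> k0; apply: (killing_inj Iorth) => u; rewrite killing_ctl ctr_rmat_neg //.
by case: ifP => _; rewrite ?(bilin0l kb) // killingC.
Qed.

Lemma ctr_rmat_nat (k l : nat) v : ctr (rmat k l) v = ctr (h k l) v.
Proof. by rewrite /rmat !fctE /= add0r. Qed.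

Lemma ctl_rmat_nat (k l : nat) v : ctl (rmat k l) v = ctl (h k l) v.
Proof. by rewrite /rmat !fctE /= add0r. Qed.

Lemma rmat_laurent : laurent_cols rmat.
Proof.
move=> l; exists (m%:Z - l%:Z - 1 - m%:Z) => k kN; apply: (ctr_inj Iorth) => v.
by rewrite ctr_rmat_neg ?ifF ?(bilin0l cb) //; [apply/eqP|]; lia.
Qed.

Lemma wl_column l v : (wl m h l v).1 = column rmat l v.
Proof.
apply/funext => k; rewrite /wl /= fctE /column.
have [k0|k0] := ltP k 0.
  rewrite (lser_neg _ k0) addr0 ctr_rmat_neg // /polarpart.
  by case: ltnP => lm //=; rewrite ifF //; apply/eqP; lia.
case: k k0 => // k _; rewrite ctr_rmat_nat /polarpart /= /regcol.
case: ltnP => lm /=; first exact: add0r.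
by rewrite /lmono ifF ?add0r //; apply/eqP; lia.
Qed.

(** By invariance the projection is a pairing of [f, a x^k] with w_{l,v}, and the coefficient of x^l
    in [f, a x^k] is [f_(l-k), a]. *)
Lemma pr_iota_wl f l v k : pr k (Dbracket (iota f) (wl m h l v)) =
  if (k <= l)%N then lie (f (l - k)%N) v else 0.
Proof.
have Df := iota_Dcal m f; have Dw := wl_Dcal m h l v.
apply: (killing_inj Iorth) => a.
rewrite -(Dform_pr h) // (Dbracket_anti Df Dw).
rewrite (lin_onN (Dform_linl (iota_Dcal m _))) //.
rewrite Dform_bracket //   Dbracket_iota DformC //.
rewrite Dform_iota_wl -[sbracket _ _]/(conv _ _ _) (conv_monor lb).
case: ifP => _; last by rewrite !(bilin0l kb) oppr0.
by rewrite lie_anti (bilinNl kb) opprK killing_lie killingC.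
all: by auto.
Qed.

(** The bracket and the sum of the w's have the same projections, so they differ by iota of a
    series. That series is read off the first component, where [column_act] recognizes the action of
    f on r. *)
Lemma Dbracket_iota_wl f l v : Dbracket (iota f) (wl m h l v) =
  \sum_(q < l.+1) wl m h (l - q) (lie (f q) v)
  + iota (fun j => ctr (act f rmat j%:Z l) v).
Proof.
set w := \sum_(q < _) _.
have w1 : w.1 = \sum_(q < l.+1) column rmat (l - q) (lie (f q) v).
  rewrite /w (big_morph fst (id1 := 0) (op1 := +%R)) //.
  by apply: eq_bigr => q _; exact: wl_column.
rewrite {1}(@eq_pr _ _ _ (Dbracket (iota f) (wl m h l v)) w).
  congr (_ + iota _); apply/funext => j.
  rewrite -[RHS]/(column (act f rmat) l v j) (column_act _ _ _ rmat_laurent) -w1.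
  by rewrite -wl_column.
move=> k; rewrite pr_iota_wl -[RHS]/(prL g m k w) /w linear_sum /=.
under eq_bigr do rewrite pr_wl.
case: leqP => kl.
  have ql : (l - k < l.+1)%N by lia.
  rewrite (bigD1 (Ordinal ql)) //= ifT; last by apply/eqP; lia.
  rewrite big1 ?addr0 // => q qk; rewrite ifN //; apply: contra qk => /eqP kE.
  by apply/eqP/val_inj => /=; have := ltn_ord q; lia.
by rewrite big1 // => q _; rewrite ifN //; lia.
Qed.

(** The first component of [Dbracket_iota_wl] exhibits the columns of the action as columns of an
    element of iota(g[[x]]), which has no pole. *)
Lemma act_rmat_neg f k l : (k < 0)%R -> act f rmat k l = 0.
Proof.
move=> k0; apply: (ctr_inj Iorth) => v; rewrite (bilin0l cb).
have /(congr1 fst)/(congr1 (fun u => u k)) := Dbracket_iota_wl f l v.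
rewrite [in RHS]/= fctE (lser_neg _ k0) addr0.
rewrite (big_morph fst (id1 := 0) (op1 := +%R)) //.
under eq_bigr do rewrite wl_column.
rewrite -[ctr _ _]/(column _ l v k) (column_act _ _ _ rmat_laurent) fctE -wl_column.
by move=> E; apply/eqP; rewrite subr_eq0; apply/eqP.
Qed.

Lemma lser2_neg_dr f : lser2 (neg_dr rmat f) = - dr rmat f.
Proof.
apply/funext => -[k|k]; apply/funext => l //=.
by rewrite /dr -[RHS]/(- act f rmat (Negz k) l) act_rmat_neg ?oppr0.
Qed.

(** By invariance the left side is - B([f, w_{l,w}], w_{k,v}). In [Dbracket_iota_wl] the w's
    contribute nothing, by isotropy, and the rest is the action of f; the antisymmetry sign is the
    sign of - dr. *)
Lemma Dform_neg_dr f k v l w : skew_regular m h ->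
  Dform (iota f) (Dbracket (wl m h k v) (wl m h l w)) =
  killing (ctr (neg_dr rmat f k l) w) v.
Proof.
move=> sk; have Dw := wl_Dcal m h; have Df := iota_Dcal m f.
rewrite (Dbracket_anti (Dw k v)) // (lin_onN (Dform_linr Df)) //.
rewrite -Dform_bracket // Dbracket_iota_wl.
rewrite (lin_onD (Dform_linl (Dw k v))); last 2 first.
- exact: Dcal_sum.
- exact: iota_Dcal.
rewrite Dform_iota_wl (lin_on_sum _ (Dform_linl (Dw k v))) // big1 ?add0r.
  by rewrite -(bilinNl kb) -(bilinNl cb).
by move=> q _; apply: (skew_regularP Iorth _ _).1.
all: by auto.
Qed.

End RMatrixColumns.

(** * The Yang-Baxter equation *)

Section YangBaxter.
Variables (F : fieldType) (g : lieAlgType F).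
Variables (n : nat) (I : n.-tuple g) (Iorth : killing_orthonormal I).
Variable m : nat.
Local Notation Dcal := (@Dcal F g m.+1).
Local Notation Dbracket := (@Dbracket F g m.+1).
Local Notation g2 := (tensor g g).
Local Notation g3 := (tensor (tensor g g) g).
Local Notation kb := (killing_bilin g).
Local Notation lb := (lie_bilin g).
Local Notation cb := (ctr_bilin g g).

Variable h : nat -> nat -> g2.
Local Notation r := (rmat I m h).
Local Notation wl := (wl m h).

(* For b >= 0 the contracted Yang-Baxter equation says that
   [w_{b,v}, w_{c,w}] = - sum_p w_{p, cyb_coef p} in first components; for
   b < 0 the two summands of [cyb_coef] cancel. *)
Definition cyb_coef (b : int) (c : nat) (v w : g) (p : nat) : g :=
  lie (ctr (r (b - p%:Z) c) w) v
  + (if (p <= c)%N then lie (ctl (r b (c - p)) v) w else 0).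

(** Origin of the bound: once p > b, the first summand comes from the pole of r and is nonzero at p
    = b + c + 1 - m at most; the second one requires p <= c. *)
Lemma cyb_coef_far b c v w p : (`|b| + c + 2 <= p)%N -> cyb_coef b c v w p = 0.
Proof.
move=> pN; rewrite /cyb_coef ifN ?addr0; last by lia.
rewrite (ctr_rmat_neg Iorth) ?ifF ?(bilin0l lb) //; last by lia.
by apply/eqP; lia.
Qed.

Lemma cyb_coef_neg b c v w p : (b < 0)%R -> cyb_coef b c v w p = 0.
Proof.
move=> b0; rewrite /cyb_coef (ctr_rmat_neg Iorth) ?(ctl_rmat_neg Iorth) //; last by lia.
case: leqP => pc.
  have -> : (b - p%:Z == m%:Z - c%:Z - 1) = (b == m%:Z - (c - p)%N%:Z - 1).
    by apply/eqP/eqP; lia.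
  case: ifP => _; last by rewrite !(bilin0l lb) addr0.
  by rewrite lie_anti addNr.
by rewrite ifF ?(bilin0l lb) ?addr0 //; apply/eqP; lia.
Qed.

Definition cyb_term (a b : int) (c : nat) : g3 :=
  \sum_(p \in [set: int]) br12_13 (lser (r p) b) (r (a - p) c)
  + \sum_(p \in [set: nat]) br12_23 (r a p) (r (b - p%:Z) c)
  + \sum_(p < c.+1) br13_23 (r a p) (r b (c - p)%N).

Lemma ctr_ctr_linear v w : linear (fun X : g3 => ctr (ctr X w) v).
Proof. by move=> k s s'; rewrite !(ctr_bilin _ _).1. Qed.

Lemma br12_13_0l (X : g2) : br12_13 0 X = 0.
Proof.
apply: (ctr_inj Iorth) => w; apply: (ctr_inj Iorth) => v.
by rewrite ctr_br12_13 !(bilin0l (ctr_bilin _ _)) (bilin0l lb).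
Qed.

Lemma br12_13_0r (X : g2) : br12_13 X 0 = 0.
Proof.
apply: (ctr_inj Iorth) => w; apply: (ctr_inj Iorth) => v.
by rewrite ctr_br12_13 !(bilin0l (ctr_bilin _ _)) (bilin0r lb).
Qed.

Lemma br12_23_0r (X : g2) : br12_23 X 0 = 0.
Proof.
apply: (ctr_inj Iorth) => w; apply: (ctr_inj Iorth) => v.
by rewrite ctr_br12_23 !(bilin0l (ctr_bilin _ _)) (bilin0l lb) (bilin0r cb).
Qed.

Lemma ctr_cyb_term a b c v w : ctr (ctr (cyb_term a b c) w) v =
  lconv (@lie F g) (fun k => ctr (lser (r k) b) v) (column r c w) a
  + \sum_(p < `|b| + c + 2) column r p (cyb_coef b c v w p) a.
Proof.
have linT := ctr_ctr_linear v w.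
have rl := rmat_laurent Iorth m h.
rewrite /cyb_term !(bilinDl (ctr_bilin _ _)) -addrA; congr (_ + _).
  have [Lc rc] := rl c.
  have [Lb rb] : is_laurent (fun k => lser (r k) b).
    case: (b) => b'; last by exists 0.
    by have [Lb rb] := rl b'; exists Lb => k /rb.
  rewrite (@linear_fsum_int _ _ _ _ linT Lb (a - Lc)).
  - by apply: eq_fsbigr => p _; rewrite ctr_br12_13.
  - by move=> p /rb ->; exact: br12_13_0l.
  by move=> p Hp; rewrite rc ?br12_13_0r //; lia.
have [Lc rc] := rl c.
rewrite (@linear_fsum_nat _ _ _ _ linT (`|b| + c + 2)); last first.
  move=> p Hp; rewrite [X in br12_23 _ X](_ : _ = 0) ?br12_23_0r //.
  apply: (ctr_inj Iorth) => u; rewrite (ctr_rmat_neg Iorth) ?ifF ?(bilin0l cb) //.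
    by apply/eqP; lia.
  by lia.
rewrite (bilin_suml (ctr_bilin g g2)) (bilin_suml (ctr_bilin g g)).
rewrite [X in _ + X](_ : _ = \sum_(p < `|b| + c + 2) (if (p <= c)%N then
    ctr (r a p) (lie (ctl (r b (c - p)%N) v) w) else 0)); last first.
  rewrite (big_ord_widen (`|b| + c + 2) (fun p =>
    ctr (ctr (br13_23 (r a p) (r b (c - p)%N)) w) v)); last by lia.
  rewrite big_mkcond; apply: eq_bigr => p _; rewrite ltnS; case: ifP => // _.
  exact: ctr_br13_23.
rewrite -big_split; apply: eq_bigr => p _ /=.
rewrite ctr_br12_23 /column /cyb_coef (bilinDr cb); congr (_ + _).
by case: ifP => // _; rewrite (bilin0r cb).
Qed.

(** For b < 0 the equation is automatic: r has no negative power of y, so the first term vanishes,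
    and the other two cancel by [cyb_coef_neg]. *)
Lemma cybeP : cybe r <-> forall (b c : nat) v w,
  lconv (@lie F g) (column r b v) (column r c w)
  + \sum_(p < b + c + 2) column r p (cyb_coef b c v w p) = 0.
Proof.
split=> [E b c v w|E a b c].
  apply/funext => a; rewrite fctE fct_sumE.
  have := ctr_cyb_term a b c v w; rewrite -/(cyb_term a b c).
  rewrite [cyb_term a b c]E !(bilin0l (ctr_bilin _ _)) => /esym; exact.
rewrite -/(cyb_term a b c).
apply: (ctr_inj Iorth) => w; apply: (ctr_inj Iorth) => v.
rewrite ctr_cyb_term !(bilin0l (ctr_bilin _ _)).
case: b => b.
  have := congr1 (fun f => f a) (E b c v w).
  by rewrite -[LHS]/(lconv _ _ _ a + (\sum_(p < b + c + 2) _) a) fct_sumE.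
rewrite [X in X + _](_ : _ = 0) ?add0r; last first.
  rewrite /lconv -[RHS](@fsbig1 _ 0 +%R int setT (fun=> 0)) //.
  by apply: eq_fsbigr => p _; rewrite (bilin0l cb) (bilin0l lb).
apply: big1 => p _; rewrite cyb_coef_neg //.
by rewrite /column (bilin0r cb).
Qed.

Lemma Dbracket_wl1 b v c w :
  (Dbracket (wl b v) (wl c w)).1 = lconv (@lie F g) (column r b v) (column r c w).
Proof. by rewrite -!(wl_column Iorth). Qed.

(* Antisymmetry of the bracket makes the w_p, with the symmetrized
   coefficients, sum to zero; for p >= m the pole of w_p isolates each one. *)
Lemma cybe_skew_coef (b c : nat) v w p : cybe r -> (m <= p < b + c + 2)%N ->
  cyb_coef b c v w p + cyb_coef c b w v p = 0.
Proof.
move=> /cybeP E /andP[mp pN].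
have := E c b w v; have := E b c v w.
rewrite -!Dbracket_wl1 (@Dbracket_anti _ _ _ (wl c w)) //.
rewrite [(c + b)%N]addnC => E1 E2; have := congr2 +%R E1 E2.
rewrite [X in _ + (X + _)]/= addrACA subrr add0r -big_split addr0 /=.
move/(congr1 (fun f => f (m%:Z - p%:Z - 1))).
rewrite fct_sumE (bigD1 (Ordinal pN)) //= big1 => [|q qp].
  rewrite addr0 fctE /column !(ctr_rmat_neg Iorth) ?eqxx //; lia.
rewrite fctE /column !(ctr_rmat_neg Iorth); [|lia..].
suff -> : (m%:Z - p%:Z - 1 == m%:Z - q%:Z - 1) = false by rewrite addr0.
apply: contraNF qp => /eqP pq; apply/eqP/val_inj => /=; lia.
Qed.

Lemma cybe_skew : cybe r -> skew_regular m h.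
Proof.
move=> E b c w; apply/eqP; rewrite -subr_eq0; apply/eqP; apply: (center0 Iorth) => v.
(* For p > c multiplication by y^p misses y^c, so [cybe_skew_coef] at
   (b + p, c) involves a single coefficient of r + tau(r). *)
pose p := (m + c.+1)%N.
rewrite -[RHS](@cybe_skew_coef (b + p)%N c v w p E); last by lia.
rewrite /cyb_coef [in RHS]ifN; last by lia.
rewrite addr0 [in RHS]ifT; last by lia.
have -> : (b + p)%N%:Z - p%:Z = b by lia.
rewrite ctr_rmat_nat addnK ctl_rmat_nat (ctr_rmat_neg Iorth); last by lia.
(* The pole of r in the exchanged coefficient contributes [v, w] = - [w, v] when b + c + 1 = m: this
   is the right-hand side of the skew-symmetry condition. *)
have -> : (c%:Z - p%:Z == m%:Z - (b + p)%N%:Z - 1) = (b + c + 1 == m)%N.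
  by apply/eqP/eqP; lia.
rewrite !(bilinDl lb) (bilinNl lb) -addrA; congr (_ + _); rewrite addrC.
congr (_ + _); case: (b + c + 1 == m)%N; first by rewrite -lie_anti.
by rewrite !(bilin0l lb) oppr0.
Qed.

(** The projection is a pairing with a x^p, hence by [Dform_neg_dr] the (b,c) coefficient of - dr(a
    x^p). The actions of a x^p on the first and second factor of r give the two summands of
    [cyb_coef]. *)
Lemma pr_Dbracket_wl (b c : nat) v w p : skew_regular m h ->
  pr p (Dbracket (wl b v) (wl c w)) = - cyb_coef b c v w p.
Proof.
move=> sk; apply: (killing_inj Iorth) => a.
rewrite -(Dform_pr h); last by auto.
rewrite DformC; [|by auto..].
rewrite (Dform_neg_dr Iorth) // /neg_dr /regpart -[ctr _ _]/(ctr (- act _ r b c) w).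
rewrite (bilinNl cb) !(bilinNl kb) -[ctr _ _]/(column (act (mono a p) r) c w b).
rewrite (column_act _ _ _ (rmat_laurent Iorth m h)).
rewrite -[X in killing X _]/(lconv _ _ _ _ - (\sum_(q < c.+1) _) _) fct_sumE.
rewrite (lconv_mono _ _ _ _ lb) (bilinDl kb) (bilinDl kb); congr (- (_ + _)).
  by rewrite killing_lie killingC.
rewrite (bilinNl kb) /column.
case: leqP => pc; last first.
  rewrite big1 ?(bilin0l kb) ?oppr0 // => q _.
  by rewrite /mono ifF ?(bilin0l lb) ?(bilin0r cb) //; apply/eqP; have := ltn_ord q; lia.
have pc' : (p < c.+1)%N by [].
rewrite (bigD1 (Ordinal pc')) //= big1 => [|q qp]; last first.
  rewrite /mono ifN ?(bilin0l lb) ?(bilin0r cb) //.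
rewrite addr0 /mono eqxx -killing_ctl lie_anti (bilinNr kb) opprK.
by rewrite -killing_lie.
Qed.

(** By [pr_Dbracket_wl] the equation says that the bracket and its projection to the span along
    iota(g[[x]]) have equal first components. Their difference lies in iota(g[[x]]), where a
    vanishing first component forces it to be zero. *)
Lemma cybe_wspan : skew_regular m h -> (cybe r <->
  forall (b c : nat) v w, wspan h (Dbracket (wl b v) (wl c w))).
Proof.
move=> sk; rewrite cybeP; split=> [E|E] b c v w.
  set X := Dbracket _ _.
  have XN p : (b + c + 2 <= p)%N -> pr p X = 0.
    by move=> pN; rewrite pr_Dbracket_wl // cyb_coef_far ?oppr0 //.
  have DX : Dcal X by rewrite /X; auto.
  rewrite (Dcal_decompose h DX XN).
  rewrite [Diota _ _](_ : _ = 0) ?addr0; first by exists (b + c + 2)%N, (fun p => pr p X).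
  rewrite -[RHS](iota0 g m); congr (Diota _ _); apply/funext => j.
  have X1 : (wsum m h (b + c + 2) (fun p => pr p X)).1 = X.1.
    rewrite /wsum (big_morph fst (id1 := 0) (op1 := +%R)) // /X Dbracket_wl1.
    apply/eqP; rewrite -subr_eq0 -oppr_eq0 opprB; apply/eqP.
    rewrite -[RHS](E b c v w); congr (_ + _); rewrite -sumrN.
    apply: eq_bigr => p _; rewrite (wl_column Iorth) pr_Dbracket_wl //.
    by apply/funext => k; rewrite fctE /column (bilinNr cb) opprK.
  by rewrite -[LHS]/(X.1 j - (wsum m h _ _).1 j) X1 subrr.
have := E b c v w; set X := Dbracket _ _ => WX.
have XN p : (b + c + 2 <= p)%N -> pr p X = 0.
  by move=> pN; rewrite pr_Dbracket_wl // cyb_coef_far ?oppr0 //.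
have := congr1 fst (wsum_pr WX XN); rewrite {1}/X Dbracket_wl1 => ->.
rewrite /wsum (big_morph fst (id1 := 0) (op1 := +%R)) // -big_split big1 // => p _.
rewrite (wl_column Iorth) pr_Dbracket_wl //=.
by apply/funext => k; rewrite fctE /column (bilinNr cb) addNr.
Qed.

End YangBaxter.

(** * The bijection between r-matrices and Lagrangian complements *)

Section Lagrangian.
Variables (F : fieldType) (g : lieAlgType F).
Variables (n : nat) (I : n.-tuple g) (Iorth : killing_orthonormal I).
Variable m : nat.
Local Notation i := m.+1.
Local Notation ambient := ((int -> g) * {ffun 'I_m -> g})%type.
Local Notation Dbracket := (@Dbracket F g m.+1).
Local Notation iota := (@Diota F g m.+1).
Local Notation g2 := (tensor g g).
Local Notation cb := (ctr_bilin g g).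
Local Notation R := (rmatrices I (mono (1 : F) m)).

Lemma rmatrices_rmat r : R r -> r = rmat I m (regpart r) /\ cybe r.
Proof. by case=> -[h ->] E; rewrite [regpart _]regpart_polar. Qed.

Lemma rmatrices_skew r : R r -> skew_regular m (regpart r).
Proof. by move=> /rmatrices_rmat[rE]; rewrite {1}rE; exact: (cybe_skew Iorth). Qed.

Lemma Wspace_wspan r : Wspace I i r = wspan (regpart r).
Proof. exact: (WspaceE Iorth). Qed.

Lemma subalgebra_sum (W : set ambient) J (s : seq J) (u : J -> ambient) :
  is_subalgebra (i := i) W -> (forall k, W (u k)) -> W (\sum_(k <- s) u k).
Proof.
case=> _ W0 WP _ Wu; elim/big_rec: _ => // k v _ Wv.
by rewrite -[u k]scale1r; exact: WP.
Qed.

Lemma wspan_subalgebra h :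
  (forall b c v w, wspan h (Dbracket (wl m h b v) (wl m h c w))) ->
  is_subalgebra (i := i) (wspan h).
Proof.
move=> Wbr; have Wsum J (s : seq J) (u : J -> ambient) :
    (forall k, wspan h (u k)) -> wspan h (\sum_(k <- s) u k).
  move=> Wu; elim/big_rec: _ => [|k v _ Wv]; first exact: wspan0.
  by rewrite -[u k]scale1r; exact: wspanP.
split; [exact: wspan_Dcal | exact: wspan0 | by move=> *; exact: wspanP |].
move=> u v [N [z ->]] [M [z' ->]].
rewrite /wsum (lin_on_sum _ (Dbracket_linl _)) //; last by auto.
apply: (Wsum _ _ (fun k : 'I_N => _)) => k.
rewrite (lin_on_sum _ (Dbracket_linr _)) //.
by apply: (Wsum _ _ (fun k : 'I_M => _)) => l.
Qed.

Lemma Wspace_lagrangian r : R r -> lagrangian_complements g i (Wspace I i r).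
Proof.
move=> Rr; have sk := rmatrices_skew Rr; have [rE E] := rmatrices_rmat Rr.
rewrite Wspace_wspan; split; last 2 first.
- exact: (wspan_lagrangian Iorth).
- exact: wspan_complementary.
by apply: wspan_subalgebra; apply/(cybe_wspan Iorth sk); rewrite -rE.
Qed.

Lemma eq_regular (h h' : nat -> nat -> g2) :
  (forall k v, regcol h k v = regcol h' k v) -> h = h'.
Proof.
move=> hh'; apply/funext => j; apply/funext => k; apply: (ctr_inj Iorth) => v.
exact: (congr1 (fun f => f j) (hh' k v)).
Qed.

Lemma iota_inj f f' : iota f = iota f' -> f = f'.
Proof.
by move=> /(congr1 fst) /= ff'; apply/funext => k; exact: (congr1 (fun f => f k%:Z) ff').
Qed.

(** Elements of a span are determined by their projections, so w_{k,v}, and with it the column of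
    the series, can be recovered from the span. *)
Lemma wspan_inj (h h' : nat -> nat -> g2) :
  wspan (m := m) h = wspan (m := m) h' -> h = h'.
Proof.
move=> hh'; apply: eq_regular => k v.
suff /addrI/iota_inj : wl m h k v = wl m h' k v by [].
apply: (eq_wspan_pr (h := h)); first exact: wspan_wl.
  by rewrite hh'; exact: wspan_wl.
by move=> j; rewrite !pr_wl.
Qed.

Lemma Wspace_inj r r' : R r -> R r' -> Wspace I i r = Wspace I i r' -> r = r'.
Proof.
move=> /rmatrices_rmat[-> _] /rmatrices_rmat[-> _].
by rewrite !Wspace_wspan !regpart_rmat => /wspan_inj ->.
Qed.

(** Splitting [polarpart k I_a] along iota(g[[x]]) and W gives an element [polarpart k I_a + iota p]
    of W, and p serves as the column of h. The span of h is then contained in W, and two nested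
    complements coincide. *)
Lemma complementary_wspan (W : set ambient) :
  is_subalgebra (i := i) W -> complementary (i := i) W -> exists h, W = wspan h.
Proof.
move=> subW [WD Wi]; have [WDcal W0 WP _] := subW.
have regular k (a : 'I_n) : exists p, W (polarpart m k I`_a + iota p).
  have [f [w [Ww wE]]] := WD _ (polarpart_Dcal m k I`_a).
  exists (- f); suff -> : polarpart m k I`_a + iota (- f) = w by [].
  rewrite wE -[- f]addr0 -[- f]scaleN1r iota_linear iota0 addr0 scaleN1r.
  by rewrite [_ + w]addrC addrK.
pose p k a := projT1 (cid (regular k a)).
pose h j k : g2 := \sum_(a < n) tens (p k a j) I`_a.
have hp k (a : 'I_n) : regcol h k I`_a = p k a.
  apply/funext => j; rewrite /regcol /h (bilin_suml cb) (bigD1 a) //=.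
  rewrite ctr_tens Iorth.2 eqxx scale1r big1 ?addr0 // => b ba.
  by rewrite ctr_tens Iorth.2 (negbTE ba) scale0r.
have Wwl k v : W (wl m h k v).
  rewrite (killing_expand Iorth v) -[wl m h k _]/(wlL m h k _) linear_sum.
  apply: subalgebra_sum => // a; rewrite linearZ /= -[_ *: _]addr0; apply: WP => //.
  by rewrite /wl hp; exact: projT2 (cid (regular k a)).
have sub u : wspan h u -> W u.
  by case=> N [z ->]; exact: subalgebra_sum.
exists h; apply/seteqP; split=> u; last exact: sub.
move=> Wu; have [f [w [Ww uE]]] := (wspan_complementary m h).1 _ (WDcal _ Wu).
suff f0 : iota f = 0 by rewrite uE f0 add0r.
apply: Wi; have -> : iota f = (-1) *: w + u by rewrite uE scaleN1r addrCA addNr addr0.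
by apply: WP => //; exact: sub.
Qed.

Lemma lagrangian_wspan (W : set ambient) : lagrangian_complements g i W ->
  exists h, [/\ W = wspan h, skew_regular m h & cybe (rmat I m h)].
Proof.
case=> subW lagW compW; have [h Wh] := complementary_wspan subW compW.
have sk : skew_regular m h.
  apply/(skew_regularP Iorth) => k v l w.
  have : W (wl m h k v) by rewrite Wh; exact: wspan_wl.
  by rewrite -lagW => -[_]; apply; rewrite Wh; exact: wspan_wl.
exists h; split=> //; apply/(cybe_wspan Iorth sk) => b c v w.
by rewrite -Wh; case: subW => _ _ _; apply; rewrite Wh; exact: wspan_wl.
Qed.

Lemma Wspace_bij : set_bij R (lagrangian_complements g i) (Wspace I i).
Proof.
split; first exact: Wspace_lagrangian.
  by move=> r r'; rewrite !inE; exact: Wspace_inj.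
move=> W /lagrangian_wspan[h [-> _ E]]; exists (rmat I m h).
  by split=> //; exists h.
by rewrite Wspace_wspan regpart_rmat.
Qed.

End Lagrangian.

(** * The action of g[[x]] on two-variable series *)

Section Action.
Variables (F : fieldType) (g : lieAlgType F).
Variables (n : nat) (I : n.-tuple g) (Iorth : killing_orthonormal I).
Local Notation g2 := (tensor g g).
Local Notation lb := (lie_bilin g).
Local Notation cb := (ctr_bilin g g).
Implicit Types (f h : nat -> g) (t : int -> nat -> g2).

Lemma act_laurent f t : laurent_cols t -> laurent_cols (act f t).
Proof.
move=> tl l; have [N tN] := laurent_bound l tl; exists N => k kN.
rewrite /act fsbig1 ?add0r => [|p _].
  by rewrite big1 // => q _; rewrite tN ?tens_map0 ?leq_subr.
by rewrite tN ?tens_map0 //; lia.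
Qed.

Lemma ctr_act f t k l v : laurent_cols t -> ctr (act f t k l) v =
  lconv (@lie F g) (lser f) (column t l v) k
  - \sum_(q < l.+1) ctr (t k (l - q)%N) (lie (f q) v).
Proof.
move=> tl; rewrite -[LHS]/(column (act f t) l v k) column_act //.
by rewrite -[LHS]/(_ k - (\sum_(q < l.+1) _) k) fct_sumE.
Qed.

Lemma act_linearl t : laurent_cols t -> linear (fun f => act f t).
Proof.
move=> tl c f h; apply/funext => k; apply/funext => l; apply: (ctr_inj Iorth) => v.
rewrite -[RHS]/(ctr (c *: act f t k l + act h t k l) v) cb.1 !ctr_act //.
have -> : lser (c *: f + h) = c *: lser f + lser h by rewrite !sh0 shP.
rewrite (lconvPl lb); [|exact: lser_laurent|exact: lser_laurent|exact: column_laurent].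
rewrite -[X in X - _]/(c *: lconv _ _ _ k + lconv _ _ _ k).
rewrite scalerBr [RHS]addrACA -opprD; congr (_ - _).
rewrite scaler_sumr -big_split; apply: eq_bigr => q _ /=.
by rewrite fctE lb.1 cb.2.
Qed.

Lemma act_linearr f t t' c : laurent_cols t -> laurent_cols t' ->
  act f (c *: t + t') = c *: act f t + act f t'.
Proof.
move=> tl tl'; have ctl : laurent_cols (c *: t + t').
  by move=> l; exact: (laurentP c (tl l) (tl' l)).
apply/funext => k; apply/funext => l; apply: (ctr_inj Iorth) => v.
rewrite -[RHS]/(ctr (c *: act f t k l + act f t' k l) v) cb.1 !ctr_act //.
have -> : column (c *: t + t') l v = c *: column t l v + column t' l v.
  by apply/funext => j; rewrite /column cb.1.
rewrite (lconvPr lb); [|exact: lser_laurent|exact: column_laurent..].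
rewrite -[X in X - _]/(c *: lconv _ _ _ k + lconv _ _ _ k).
rewrite scalerBr [RHS]addrACA -opprD; congr (_ - _).
rewrite scaler_sumr -big_split; apply: eq_bigr => q _ /=.
by rewrite cb.1.
Qed.

Lemma act_oppl f t : laurent_cols t -> act (- f) t = - act f t.
Proof.
by move=> tl; rewrite -[LHS]/(mk_linear (act_linearl tl) _) linearN.
Qed.

Lemma act_oppr f t : laurent_cols t -> act f (- t) = - act f t.
Proof.
move=> tl; have tl0 : laurent_cols (0 : int -> nat -> g2) by move=> l; exists 0.
have := act_linearr f (-1) tl0 tl0; rewrite scaler0 addr0 scaleN1r addNr => act0.
by have := act_linearr f (-1) tl tl0; rewrite act0 !addr0 !scaleN1r.
Qed.

Lemma lconv_lie_sbracket f h (u : int -> g) : is_laurent u ->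
  lconv (@lie F g) (lser (sbracket f h)) u =
  lconv (@lie F g) (lser f) (lconv (@lie F g) (lser h) u)
  - lconv (@lie F g) (lser h) (lconv (@lie F g) (lser f) u).
Proof.
move=> /laurent_sh[M Hu]; have [a ->] := Hu _ (leqnn _).
rewrite !sh0 !(lconv_sh lb) !add0n; apply/funext => k.
rewrite -[RHS]/(sh M _ k - sh M _ k) /sh; case: (k + _) => [p|p] /=; last by rewrite subr0.
rewrite -![conv _ _ _ p]/(sbracket _ _ p) -[conv _ f _]/(sbracket f _).
apply/esym/eqP; rewrite subr_eq; apply/eqP.
exact: (congr1 (fun x => x p) (sbracket_derivation f h a)).
Qed.

Lemma act_sbracket f h t : laurent_cols t ->
  act (sbracket f h) t = act f (act h t) - act h (act f t).
Proof.
move=> tl; have fl := act_laurent f tl; have hl := act_laurent h tl.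
apply/funext => k; apply/funext => l; apply: (ctr_inj Iorth) => v.
rewrite -[RHS]/(ctr (act f (act h t) k l - act h (act f t) k l) v).
rewrite [RHS](bilinDl cb) (bilinNl cb) !ctr_act //.
rewrite lconv_lie_sbracket; last exact: column_laurent.
(* L is the action on the first factor, D the iterated action on the second. The mixed sums in
   [expand] are symmetric in e and e', so they cancel in the commutator; Jacobi is then used in each
   variable separately. *)
pose L e u := lconv (@lie F g) (lser e) u k.
pose D (e e' : nat -> g) := \sum_(q < l.+1) \sum_(q' < (l - q).+1)
  ctr (t k (l - q - q')%N) (lie (e' q') (lie (e q) v)).
have expand e e' : lconv (@lie F g) (lser e) (column (act e' t) l v) k
    - \sum_(q < l.+1) ctr (act e' t k (l - q)%N) (lie (e q) v) =
    L e (lconv (@lie F g) (lser e') (column t l v)) + D e e'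
    - (\sum_(q < l.+1) L e (column t (l - q) (lie (e' q) v))
       + \sum_(q < l.+1) L e' (column t (l - q) (lie (e q) v))).
  have Ll j w : is_laurent (column t j w) by exact: column_laurent.
  have -> : \sum_(q < l.+1) ctr (act e' t k (l - q)%N) (lie (e q) v) =
      \sum_(q < l.+1) L e' (column t (l - q) (lie (e q) v)) - D e e'.
    rewrite -sumrN -big_split; apply: eq_bigr => q _ /=.
    by rewrite ctr_act.
  rewrite column_act // (lconvBr lb (lser_laurent e)); last 2 first.
  - by apply: (lconv_laurent lb) => //; exact: lser_laurent.
  - exact: laurent_sum.
  rewrite (lconv_sumr _ lb (lser_laurent e)) //.
  rewrite -[X in X - _]/(L e _ - (\sum_(q < l.+1) _) k) fct_sumE.
  by rewrite opprB opprD [RHS]addrACA.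
have Dff : D f h - D h f = - \sum_(q < l.+1) ctr (t k (l - q)%N) (lie (sbracket f h q) v).
  pose G p q := ctr (t k (l - p - q)%N) (lie (lie (f p) (h q)) v).
  have -> : \sum_(q < l.+1) ctr (t k (l - q)%N) (lie (sbracket f h q) v) =
      \sum_(q < l.+1) \sum_(p < q.+1) G p (q - p)%N.
    apply: eq_bigr => q _; rewrite (bilin_suml lb) (bilin_sumr cb).
    apply: eq_bigr => p _; rewrite /G; congr (ctr (t k _) _).
    by have := ltn_ord p; lia.
  rewrite (sum_triangle G) /D (exchange_triangle (fun q q' =>
    ctr (t k (l - q - q')%N) (lie (f q') (lie (h q) v)))) -sumrB -sumrN.
  apply: eq_bigr => q _; rewrite -sumrB -sumrN; apply: eq_bigr => q' _.
  rewrite /G [(l - q' - q)%N]subnAC -(bilinNr cb) -(bilinDr cb) -(bilinNr cb).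
  by congr ctr; rewrite [in X in _ - X]lie_derivation opprD addrCA subrr addr0.
rewrite -Dff (expand f h) (expand h f) [X in _ - (_ - X)]addrC.
rewrite opprB [RHS]addrA subrK opprD [RHS]addrACA.
by [].
Qed.

Lemma act_inj t t' : laurent_cols t -> laurent_cols t' ->
  (forall f, act f t = act f t') -> t = t'.
Proof.
move=> tl tl' tt'; apply/funext => k; apply/funext => l; apply: (ctr_inj Iorth) => v.
apply/eqP; rewrite -subr_eq0; apply/eqP; apply: (center0 Iorth) => a.
rewrite lie_anti; apply/eqP; rewrite oppr_eq0 (bilinDr lb) (bilinNr lb) subr_eq0.
apply/eqP.
(* In a x^(l+1) only the action on the first factor reaches y^l. *)
have col_mono u : laurent_cols u ->
    ctr (act (mono a l.+1) u (k + l.+1%:Z) l) v = lie a (ctr (u k l) v).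
  move=> ul; rewrite ctr_act // (lconv_mono _ _ _ _ lb) /column addrK.
  rewrite big1 ?subr0 // => q _; rewrite /mono ifN ?(bilin0l lb) ?(bilin0r cb) //.
  by have := ltn_ord q; lia.
by rewrite -!col_mono // tt'.
Qed.

End Action.

(** * The double *)

Section Functionals.
Variables (F : fieldType) (g : lieAlgType F).
Variables (n : nat) (I : n.-tuple g) (Iorth : killing_orthonormal I).
Variable m : nat.
Local Notation ambient := ((int -> g) * {ffun 'I_m -> g})%type.
Local Notation Dcal := (@Dcal F g m.+1).
Local Notation Dform := (@Dform F g m.+1).
Local Notation iota := (@Diota F g m.+1).
Local Notation g2 := (tensor g g).
Local Notation kb := (killing_bilin g).
Local Notation cb := (ctr_bilin g g).
Local Notation dualseries := ((nat -> g) -> F^o).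
Implicit Types (phi psi : dualseries).

(* phi is the pairing of g[[x]], through the Killing form, with the polynomial
   of coefficients [repf phi]. *)
Definition repf phi (k : nat) : g := \sum_(a < n) (phi (mono I`_a k) : F) *: I`_a.

Lemma functional_mono phi a k : linear phi -> phi (mono a k) = killing a (repf phi k).
Proof.
move=> lphi; rewrite {1}(killing_expand Iorth a).
rewrite -[LHS]/(mk_linear lphi (mk_linear (@mono_linear F g k) _)) !linear_sum.
rewrite (bilin_sumr kb); apply: eq_bigr => b _.
by rewrite !linearZ (bilinZr kb) /= -[LHS]/(_ * _) mulrC.
Qed.

Lemma truncation (V : nmodType) (f : nat -> V) N :
  xadic_eq N f (\sum_(k < N) mono (f k) k).
Proof.
move=> k kN; rewrite fct_sumE (bigD1 (Ordinal kN)) //= /mono eqxx big1 ?addr0 //.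
by move=> j jk; rewrite ifN //; apply: contra jk => /eqP jk; apply/eqP/val_inj.
Qed.

(** Continuity at 0 makes phi vanish on x^N g[[x]] for some N, so phi depends on f_0, ..., f_(N-1)
    only. *)
Lemma cont_functional_rep phi : cont_functional phi ->
  exists N, (forall k, (N <= k)%N -> repf phi k = 0) /\
    forall f, phi f = \sum_(k < N) killing (f k) (repf phi k).
Proof.
case=> lphi cphi; have [N phiN] := cphi 0.
have phi0 : phi 0 = 0 by rewrite -[LHS]/(mk_linear lphi 0) linear0.
have mono0 a k : (N <= k)%N -> phi (mono a k) = 0.
  move=> Nk; rewrite -(phiN (mono a k)) // => j jN.
  by rewrite /mono ifN //; lia.
exists N; split=> [k Nk|f].
  by apply: big1 => a _; rewrite mono0 // scale0r.
have -> : phi f = phi (\sum_(k < N) mono (f k) k).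
  apply/eqP; rewrite -subr_eq0 -[phi f]/(mk_linear lphi f).
  rewrite -[phi (\sum_(k < N) _)]/(mk_linear lphi _) -linearB /= -(phiN (f - _)).
    by rewrite phi0.
  by move=> j jN; rewrite -[RHS]/(f j - (\sum_(k < N) mono (f k) k) j) -(truncation f jN) subrr.
rewrite -[LHS]/(mk_linear lphi _) linear_sum; apply: eq_bigr => k _ /=.
exact: functional_mono.
Qed.

Lemma sum_cont_functional N (z : nat -> g) :
  cont_functional (fun f => \sum_(k < N) killing (f k) (z k) : F^o).
Proof.
split=> [c f f'|f].
  rewrite scaler_sumr -big_split; apply: eq_bigr => k _ /=.
  by rewrite fctE kb.1.
by exists N => f' ff'; apply: eq_bigr => k _; rewrite ff'.
Qed.

Lemma Dform_iota_pr f u N : Dcal u -> (forall k, (N <= k)%N -> pr k u = 0) ->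
  Dform (iota f) u = \sum_(k < N) killing (f k) (pr k u).
Proof.
move=> Du uN; rewrite {1}(Dcal_decompose 0 Du uN).
rewrite (lin_onD (Dform_linr (iota_Dcal m f))) // Dform_iota addr0.
exact: Dform_iota_wsum.
Qed.

Lemma Dform_cont_functional u : Dcal u -> cont_functional (fun f => Dform (iota f) u : F^o).
Proof.
move=> Du; have [N uN] := pr_bound Du.
have -> : (fun f => Dform (iota f) u) = fun f => \sum_(k < N) killing (f k) (pr k u).
  by apply/funext => f; exact: Dform_iota_pr.
exact: (sum_cont_functional N (fun k => pr k u)).
Qed.

Lemma repf_Dform u k : Dcal u -> repf (fun f => Dform (iota f) u) k = pr k u.
Proof.
move=> Du; apply: (killing_inj Iorth) => a.
rewrite killingC -(functional_mono a k (Dform_cont_functional Du).1).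
by rewrite DformC // (Dform_pr 0).
Qed.

Lemma repf_linear k c phi psi : repf (c *: phi + psi) k = c *: repf phi k + repf psi k.
Proof.
rewrite /repf scaler_sumr -big_split; apply: eq_bigr => a _ /=.
by rewrite fctE scalerDl scalerA.
Qed.

Lemma functionalP c phi psi : cont_functional phi -> cont_functional psi ->
  cont_functional (c *: phi + psi).
Proof.
move=> [lphi cphi] [lpsi cpsi]; split=> [d f f'|f].
  rewrite -[LHS]/(c *: phi _ + psi _) lphi lpsi.
  rewrite -[X in _ = d *: X + _]/(c *: phi f + psi f).
  rewrite -[X in _ = _ + X]/(c *: phi f' + psi f') !scalerDr.
  by rewrite [LHS]addrACA !scalerA mulrC.
have [M1 H1] := cphi f; have [M2 H2] := cpsi f.
exists (maxn M1 M2) => f' ff'; rewrite -[LHS]/(c *: phi f + psi f).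
rewrite (H1 f') ?(H2 f') // => k kM; apply: ff'.
  exact: leq_trans kM (leq_maxr _ _).
exact: leq_trans kM (leq_maxl _ _).
Qed.

Lemma fun_tens_sum phi psi N M t :
  linear phi -> linear psi ->
  (forall k, (N <= k)%N -> repf phi k = 0) -> (forall l, (M <= l)%N -> repf psi l = 0) ->
  fun_tens phi psi t =
  \sum_(k < N) \sum_(l < M) killing (ctr (t k l) (repf psi l)) (repf phi k).
Proof.
move=> lphi lpsi phiN psiM; rewrite /fun_tens.
have term k l : tens_lift (fun a b => phi (mono a k) * psi (mono b l) : F^o) (t k l) =
    killing (ctr (t k l) (repf psi l)) (repf phi k).
  rewrite (_ : (fun a b => _) = fun a b =>
    killing a (repf phi k) * killing b (repf psi l) : F^o); last first.
    by apply/funext => a; apply/funext => b; rewrite !functional_mono.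
  apply: (@eq_on_tens F g g F^o (tens_lift (fun a b =>
    killing a (repf phi k) * killing b (repf psi l) : F^o))
    (fun s => killing (ctr s (repf psi l)) (repf phi k))).
  - exact: tens_lift_linear.
  - by move=> c s s'; rewrite cb.1 kb.1.
  move=> a b; rewrite tens_lift_bilin; last first.
    split=> y c x x'; rewrite -[RHS]/(c * (_ * _) + _ * _).
      have -> : killing (c *: x + x') _ = c * killing x _ + killing x' _ := kb.1 _ c x x'.
      by rewrite mulrDl -mulrA.
    have -> : killing (c *: x + x') _ = c * killing x _ + killing x' _ := kb.1 _ c x x'.
    by rewrite mulrDr mulrCA.
  rewrite ctr_tens (bilinZl kb); exact: mulrC.
rewrite (@fsum_seq _ _ [seq (k, l) | k <- seq.iota 0 N, l <- seq.iota 0 M]).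
- rewrite big_allpairs -{1}[N]subn0 -/(index_iota 0 N) big_mkord; apply: eq_bigr => k _.
  by rewrite -{1}[M]subn0 -/(index_iota 0 M) big_mkord; apply: eq_bigr => l _; exact: term.
- by apply: allpairs_uniq => [||[? ?] [? ?]]; rewrite ?iota_uniq.
move=> [k l] kl; rewrite /= term.
have [kN|/phiN->] := ltnP k N; last by rewrite (bilin0r kb).
have [lM|/psiM->] := ltnP l M; last by rewrite (bilin0r cb) (bilin0l kb).
by case/negP: kl; apply/allpairsP; exists (k, l); rewrite !mem_iota.
Qed.

Lemma fun_tens1_sum phi N t l : linear phi ->
  (forall k, (N <= k)%N -> repf phi k = 0) ->
  fun_tens1 phi t l = \sum_(k < N) ctl (t k l) (repf phi k).
Proof.
move=> lphi phiN; rewrite /fun_tens1.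
have term k : tens_lift (fun a b => phi (mono a k) *: b) (t k l) =
    ctl (t k l) (repf phi k).
  rewrite /ctl; congr tens_lift; apply/funext => a; apply/funext => b.
  by rewrite functional_mono.
rewrite (fsum_nat (N := N)).
  by apply: eq_bigr => k _; exact: term.
by move=> k /phiN kN; rewrite term kN (bilin0r (ctl_bilin g)).
Qed.

Section DualElements.
Variable h : nat -> nat -> g2.

(** The element of the span that represents phi through the form, as its pairing with [iota f] is
    [phi f]. For continuous phi this identifies g{x} with the span. *)
Definition dual_elt phi : ambient := \sum_(k \in [set: nat]) wl m h k (repf phi k).

Lemma dual_elt_wsum phi N : (forall k, (N <= k)%N -> repf phi k = 0) ->
  dual_elt phi = wsum m h N (repf phi).
Proof. by move=> phiN; apply: fsum_nat => k /phiN ->; rewrite wl0. Qed.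

Lemma dual_elt_wspan phi : cont_functional phi -> wspan h (dual_elt phi).
Proof.
by move=> /cont_functional_rep[N [phiN _]]; rewrite (dual_elt_wsum phiN); exists N, (repf phi).
Qed.

Lemma dual_elt_Dcal phi : cont_functional phi -> Dcal (dual_elt phi).
Proof. by move=> /dual_elt_wspan; exact: wspan_Dcal. Qed.

Lemma pr_dual_elt phi k : cont_functional phi -> pr k (dual_elt phi) = repf phi k.
Proof.
move=> /cont_functional_rep[N [phiN _]]; rewrite (dual_elt_wsum phiN) pr_wsum.
by case: ltnP => // /phiN.
Qed.

Lemma Dform_iota_dual_elt f phi : cont_functional phi ->
  Dform (iota f) (dual_elt phi) = phi f.
Proof.
move=> /cont_functional_rep[N [phiN phiE]].
by rewrite (dual_elt_wsum phiN) Dform_iota_wsum phiE.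
Qed.

Lemma dual_elt_Dform u : wspan h u -> dual_elt (fun f => Dform (iota f) u) = u.
Proof.
move=> Wu; have Du := wspan_Dcal Wu; have cu := Dform_cont_functional Du.
apply: (eq_wspan_pr (h := h)) => //; first exact: dual_elt_wspan.
by move=> k; rewrite pr_dual_elt // repf_Dform.
Qed.

Lemma dual_elt_linear c phi psi : cont_functional phi -> cont_functional psi ->
  dual_elt (c *: phi + psi) = c *: dual_elt phi + dual_elt psi.
Proof.
move=> cphi cpsi; have clin := functionalP c cphi cpsi.
apply: (eq_wspan_pr (h := h)); [exact: dual_elt_wspan | by apply: wspanP; exact: dual_elt_wspan |].
move=> k; rewrite pr_dual_elt // repf_linear -[RHS]/(prL g m k _) linearP /=.
by rewrite !pr_dual_elt.
Qed.

End DualElements.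

End Functionals.

(** * From an r-matrix to a Lie bialgebra with double D_i *)

Section Bialgebra.
Variables (F : fieldType) (g : lieAlgType F).
Variables (n : nat) (I : n.-tuple g) (Iorth : killing_orthonormal I).
Variable m : nat.
Local Notation i := m.+1.
Local Notation ambient := ((int -> g) * {ffun 'I_m -> g})%type.
Local Notation Dcal := (@Dcal F g m.+1).
Local Notation Dform := (@Dform F g m.+1).
Local Notation Dbracket := (@Dbracket F g m.+1).
Local Notation iota := (@Diota F g m.+1).
Local Notation g2 := (tensor g g).
Local Notation g3 := (tensor (tensor g g) g).
Local Notation kb := (killing_bilin g).
Local Notation cb := (ctr_bilin g g).
Local Notation R := (rmatrices I (mono (1 : F) m)).
Local Notation dualseries := ((nat -> g) -> F^o).

Section DeltaTensor.
Variable delta : (nat -> g) -> (nat -> nat -> g2).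
Hypothesis ldelta : linear delta.
Hypothesis cdelta : forall f N, exists M, forall f', xadic_eq M f f' ->
  xyadic_eq N (delta f) (delta f').

Lemma delta_mono_far p q : exists N, forall k a, (N <= k)%N -> delta (mono a k) p q = 0.
Proof.
have [N dN] := cdelta 0 (p + q).+1; exists N => k a Nk.
rewrite -(dN (mono a k)) //; last by move=> j jN; rewrite /mono ifN //; lia.
by rewrite -[delta 0]/(mk_linear ldelta 0) linear0.
Qed.

(** The bound depends on p and q only: by continuity, delta(a x^k) has no x^p y^q term for large k.
    A uniform bound lets the sum be compared with other expansions over a common range. *)
Lemma ctr_delta_tens1 p q : exists N0, forall N t l w, (N0 <= N)%N ->
  ctr (delta_tens1 delta t p q l) w =
  \sum_(k < N) delta (mono (ctr (t k l) w) k) p q.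
Proof.
have [N0 dN] := delta_mono_far p q; exists N0 => N t l w NN.
have term k s : ctr (tens_lift (fun a b => tens (delta (mono a k) p q) b : g3) s) w =
    delta (mono (ctr s w) k) p q.
  have ldk : linear (fun a : g => delta (mono a k) p q).
    by move=> c a a'; rewrite mono_linear ldelta.
  apply: (@eq_on_tens F g g g2 (fun s => ctr (tens_lift (fun a b =>
    tens (delta (mono a k) p q) b : g3) s) w)
    (fun s => delta (mono (ctr s w) k) p q)).
  - by move=> c s1 s2; rewrite tens_lift_linear (ctr_bilin g _).1.
  - by move=> c s1 s2; rewrite cb.1 ldk.
  move=> a b; rewrite tens_lift_bilin; last first.
    split=> x c y y'; first by rewrite ldk (tens_bilin _ _).1.
    exact: (tens_bilin _ _).2.
  by rewrite !ctr_tens -[RHS]/(mk_linear ldk _) linearZ.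
rewrite /delta_tens1 (@linear_fsum_nat _ _ _ _ ((ctr_bilin g g2).1 w) N).
  by apply: eq_bigr => k _; exact: term.
move=> k Nk; apply: (ctr_inj Iorth) => w'; rewrite (bilin0l (ctr_bilin g g2)).
have lk : linear (fun s => ctr (tens_lift (fun a b => tens (delta (mono a k) p q) b : g3) s) w').
  by move=> c s1 s2; rewrite tens_lift_linear (ctr_bilin g _).1.
apply: (@eq_on_tens F g g g2 _ (fun=> 0) lk).
  by move=> c s1 s2; rewrite scaler0 addr0.
move=> a b; rewrite tens_lift_bilin; last first.
  split=> x c y y'; last exact: (tens_bilin _ _).2.
  by rewrite mono_linear ldelta -[_ p q]/(c *: delta _ p q + delta _ p q) (tens_bilin _ _).1.
by rewrite ctr_tens dN ?scaler0 //; exact: leq_trans Nk.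
Qed.

End DeltaTensor.

Variable r : int -> nat -> g2.
Hypothesis Rr : R r.
Local Notation h := (regpart r).
Local Notation wl := (wl m h).
Local Notation delta := (neg_dr r).

Let rE : r = rmat I m h. Proof. exact: (rmatrices_rmat Rr).1. Qed.
Let sk : skew_regular m h. Proof. exact: (rmatrices_skew Iorth Rr). Qed.
Let rl : laurent_cols r. Proof. by rewrite rE; exact: rmat_laurent. Qed.
Let subW : is_subalgebra (i := i) (wspan h).
Proof. by rewrite -(Wspace_wspan Iorth); have [] := Wspace_lagrangian Iorth Rr. Qed.

Lemma pairing_delta f k v l w :
  Dform (iota f) (Dbracket (wl k v) (wl l w)) = killing (ctr (delta f k l) w) v.
Proof. by rewrite (Dform_neg_dr Iorth) // -rE. Qed.

Lemma lser2_delta f : lser2 (delta f) = - dr r f.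
Proof. by rewrite [in LHS]rE [in RHS]rE (lser2_neg_dr Iorth). Qed.

Lemma delta_linear : linear delta.
Proof.
move=> c f f'; apply/funext => k; apply/funext => l.
rewrite /neg_dr /regpart /dr (act_linearl Iorth rl c f f').
rewrite -[LHS]/(- (c *: act f r k l + act f' r k l)).
by rewrite -[RHS]/(c *: (- act f r k l) - act f' r k l) scalerN opprD.
Qed.

Lemma r_far k l : (k < - l%:Z - 1)%R -> r k l = 0.
Proof.
move=> kl; apply: (ctr_inj Iorth) => v; rewrite rE (ctr_rmat_neg Iorth); last by lia.
by rewrite ifF ?(bilin0l cb) //; apply/eqP; lia.
Qed.

Lemma delta_continuous f N : exists M, forall f', xadic_eq M f f' ->
  xyadic_eq N (delta f) (delta f').
Proof.
(* The coefficient of y^l in r has a pole of order at most l + 1, so f_p enters at x^k y^l only for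
   p <= k + l + 1 <= N. *)
exists N.+1 => f' ff' k l klN.
rewrite /neg_dr /regpart /dr -![(- act _ _) _ _]/(- act _ _ _ _); congr (- _).
rewrite /act; congr (_ + _); last first.
  by apply: eq_bigr => q _; rewrite ff' //; have := ltn_ord q; lia.
apply: eq_fsbigr => p _; have [pN|pN] := ltnP p N.+1; first by rewrite ff'.
by rewrite r_far ?tens_map0 //; lia.
Qed.

Lemma delta_skew f : delta f + flip (delta f) = 0.
Proof.
apply/funext => k; apply/funext => l; apply: (ctr_inj Iorth) => v.
rewrite -[LHS]/(ctr (delta f k l + flip (delta f) k l) v) (bilinDl cb) ctr_flip.
apply: (killing_inj Iorth) => u.
rewrite (bilinDl kb) killing_ctl -!pairing_delta (bilin0l cb) (bilin0l kb).
rewrite (Dbracket_anti (wl_Dcal m h k u)) // (lin_onN (Dform_linr _)); [|by auto..].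
exact: addNr.
Qed.

Lemma wspan_decompose u : wspan h u ->
  exists N0, forall N, (N0 <= N)%N -> u = \sum_(k < N) wl k (pr k u).
Proof.
move=> Wu; have [N0 uN] := pr_bound (wspan_Dcal Wu); exists N0 => N NN.
by rewrite {1}(wsum_pr (N := N) Wu) // => k Nk; apply: uN; lia.
Qed.

(** This is where W_r being a subalgebra enters: the inner bracket expands in the w_k, with its
    projections as coefficients, and these are again pairings with - dr. *)
Lemma pairing_delta_tens1 f p q l u v w :
  killing (ctr (ctr (delta_tens1 delta (delta f) p q l) w) v) u =
  Dform (iota f) (Dbracket (Dbracket (wl p u) (wl q v)) (wl l w)).
Proof.
have WX : wspan h (Dbracket (wl p u) (wl q v)).
  by case: subW => _ _ _; apply; exact: wspan_wl.
have [N1 dE] := ctr_delta_tens1 delta_linear delta_continuous p q.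
have [N2 XE] := wspan_decompose WX.
rewrite [in RHS](XE (maxn N1 N2)) ?leq_maxr //.
rewrite (lin_on_sum _ (Dbracket_linl (wl_Dcal _ _ _ _))) //.
rewrite (lin_on_sum _ (Dform_linr (iota_Dcal _ _))); last by auto.
rewrite (dE (maxn N1 N2)) ?leq_maxl // (bilin_suml cb) (bilin_suml kb).
apply: eq_bigr => k _; rewrite pairing_delta -[in LHS]pairing_delta.
by rewrite DformC ?(Dform_pr h) 1?killingC; auto.
Qed.

(** Tested on f and three vectors, the alternating sum is the pairing of f with the cyclic sum of
    [[w_p, w_q], w_l], so Jacobi in D_i applies. *)
Lemma delta_cojacobi f : alt3 (delta_tens1 delta (delta f)) = 0.
Proof.
apply/funext => p; apply/funext => q; apply/funext => l.
apply: (ctr_inj Iorth) => w; apply: (ctr_inj Iorth) => v.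
apply: (killing_inj Iorth) => u.
rewrite /alt3 !(bilinDl (ctr_bilin g _)) !(bilinDl kb) !(bilin0l (ctr_bilin g _)).
rewrite (bilin0l kb) !killing_cycle3 !pairing_delta_tens1.
have D1 := wl_Dcal m h p u; have D2 := wl_Dcal m h q v; have D3 := wl_Dcal m h l w.
rewrite -!(lin_onD (Dform_linr (iota_Dcal m f))); [|by auto..].
rewrite -[RHS](lin_on0 (Dform_linr (iota_Dcal m f))); congr Defs.Dform.
rewrite (Dbracket_anti (Dbracket_Dcal D1 D2) D3) (Dbracket_derivation D3 D1 D2).
rewrite opprD (Dbracket_anti D1 (Dbracket_Dcal D3 D2)) opprK.
rewrite (Dbracket_anti D3 D2) (lin_onN (Dbracket_linl D1)); last by auto.
by rewrite [X in X + _ + _]addrC subrK addNr.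
Qed.

Lemma delta_cocycle f f' : lser2 (delta (sbracket f f')) =
  act f (lser2 (delta f')) - act f' (lser2 (delta f)).
Proof.
rewrite !lser2_delta /dr !(act_oppr Iorth); try exact: act_laurent.
by rewrite (act_sbracket Iorth) // opprB opprK addrC.
Qed.

Lemma delta_bialgebra : lie_bialgebra delta.
Proof.
split; [exact: delta_linear | exact: delta_continuous | exact: delta_skew
  | exact: delta_cojacobi | exact: delta_cocycle].
Qed.

Local Notation dual_elt := (dual_elt I m h).
Local Notation repf := (repf I).

Local Notation dbl := (@Defs.double F g).

Definition double_iso (u : (nat -> g) * dualseries) : ambient :=
  iota u.1 + dual_elt u.2.

Lemma double_iso_Dcal u : dbl u -> Dcal (double_iso u).
Proof. by move=> cu; apply: DcalD => //; exact: dual_elt_Dcal. Qed.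

Lemma double_iso_bij : set_bij dbl Dcal double_iso.
Proof.
split; first exact: double_iso_Dcal.
  move=> [a phi] [b psi]; rewrite !inE => cphi cpsi; rewrite /double_iso /= => E.
  have rep k : repf phi k = repf psi k.
    have := congr1 (prL g m k) E; rewrite !linearD /= !pr_iota !add0r.
    by rewrite !(pr_dual_elt Iorth).
  have dualE : dual_elt phi = dual_elt psi by apply: eq_fsbigr => k _; rewrite rep.
  have -> : phi = psi.
    apply/funext => f; rewrite -[LHS](Dform_iota_dual_elt Iorth m h f cphi) /= dualE.
    exact: (Dform_iota_dual_elt Iorth m h f cpsi).
  by move: E; rewrite dualE => /addIr/iota_inj ->.
move=> u Du; have [f [w [Ww uE]]] := (wspan_complementary m h).1 _ Du.
exists (f, fun e => Dform (iota e) w); first exact: (Dform_cont_functional (wspan_Dcal Ww)).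
by rewrite /double_iso (dual_elt_Dform Iorth).
Qed.

Lemma double_iso_linear c u v : dbl u -> dbl v ->
  double_iso (c *: u + v) = c *: double_iso u + double_iso v.
Proof.
move=> cu cv; rewrite /double_iso /= iota_linear (dual_elt_linear Iorth) //.
by rewrite scalerDr [LHS]addrACA.
Qed.

Lemma double_iso_form u v : dbl u -> dbl v ->
  Dform (double_iso u) (double_iso v) = double_form u v.
Proof.
case: u v => [a phi] [b psi] cphi cpsi; rewrite /double_iso /double_form /=.
have Dphi := dual_elt_Dcal Iorth m h cphi; have Dpsi := dual_elt_Dcal Iorth m h cpsi.
rewrite (lin_onD (Dform_linl (DcalD (iota_Dcal m b) Dpsi))) //.
rewrite (lin_onD (Dform_linr (iota_Dcal m a))) // (lin_onD (Dform_linr Dphi)) //.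
rewrite Dform_iota (DformC Dphi) // !(Dform_iota_dual_elt Iorth) //.
rewrite (wspan_isotropic Iorth sk); [|exact: dual_elt_wspan..].
by rewrite add0r addr0 addrC.
Qed.

Lemma pairing_dual_elt f phi psi : cont_functional phi -> cont_functional psi ->
  Dform (iota f) (Dbracket (dual_elt phi) (dual_elt psi)) = fun_tens phi psi (delta f).
Proof.
move=> cphi cpsi; have [N [phiN _]] := cont_functional_rep Iorth cphi.
have [M [psiM _]] := cont_functional_rep Iorth cpsi.
rewrite (fun_tens_sum Iorth _ cphi.1 cpsi.1 phiN psiM).
rewrite (dual_elt_wsum m h phiN) (dual_elt_wsum m h psiM) /wsum.
rewrite (lin_on_sum _ (Dbracket_linl _)) //; last by auto.
rewrite (lin_on_sum _ (Dform_linr (iota_Dcal m f))); last by auto.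
apply: eq_bigr => k _; rewrite (lin_on_sum _ (Dbracket_linr _)) //.
rewrite (lin_on_sum _ (Dform_linr (iota_Dcal m f))); last by auto.
by apply: eq_bigr => l _; exact: pairing_delta.
Qed.

Lemma pairing_dual_elt_wl a phi l v : cont_functional phi ->
  Dform (iota a) (Dbracket (dual_elt phi) (wl l v)) =
  killing (fun_tens1 phi (delta a) l) v.
Proof.
move=> cphi; have [N [phiN _]] := cont_functional_rep Iorth cphi.
rewrite (fun_tens1_sum Iorth _ _ cphi.1 phiN) (dual_elt_wsum m h phiN) /wsum.
rewrite (lin_on_sum _ (Dbracket_linl _)) //.
rewrite (lin_on_sum _ (Dform_linr (iota_Dcal m a))); last by auto.
rewrite (bilin_suml kb); apply: eq_bigr => k _.
by rewrite pairing_delta killing_ctl.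
Qed.

(** The bracket X is recovered from its pairings. Those with iota(g[[x]]) give its functional
    component; those with the w_{l,v} give its series component, because W_r is isotropic and closed
    under the bracket, so that its own part is invisible to them. *)
Lemma double_iso_bracket u v : dbl u -> dbl v ->
  double_iso (double_bracket delta u v) = Dbracket (double_iso u) (double_iso v).
Proof.
case: u v => [a phi] [b psi] cphi cpsi.
have Dphi := dual_elt_Dcal Iorth m h cphi; have Dpsi := dual_elt_Dcal Iorth m h cpsi.
have Da := iota_Dcal m a; have Db := iota_Dcal m b.
set X := Dbracket _ _.
have XE : X = iota (sbracket a b) + Dbracket (iota a) (dual_elt psi)
    + (Dbracket (dual_elt phi) (dual_elt psi) - Dbracket (iota b) (dual_elt phi)).
  rewrite /X /double_iso /= (lin_onD (Dbracket_linl (DcalD Db Dpsi))) //.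
  rewrite (lin_onD (Dbracket_linr Da)) // (lin_onD (Dbracket_linr Dphi)) //.
  by rewrite Dbracket_iota (Dbracket_anti Dphi Db) [X in _ + X]addrC.
have DX : Dcal X by rewrite /X; apply: Dbracket_Dcal; exact: double_iso_Dcal.
rewrite /double_bracket.
set chi := (X in (_, X)); set e := (X in (X, _)).
have chiE : chi = fun c => Dform (iota c) X.
  apply/funext => c; have Dc := iota_Dcal m c.
  rewrite XE !(lin_onD (Dform_linr Dc)) ?(lin_onN (Dform_linr Dc)); auto.
  rewrite Dform_iota add0r pairing_dual_elt //.
  rewrite -!(Dform_bracket Dc) // !Dbracket_iota !(Dform_iota_dual_elt Iorth) //.
  rewrite (sbracket_anti c a) (sbracket_anti c b).
  rewrite -[psi _]/(mk_linear cpsi.1 _) -[phi (- _)]/(mk_linear cphi.1 _) !linearN /=.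
  by rewrite opprK [RHS]addrC.
have cchi : cont_functional chi by rewrite chiE; exact: Dform_cont_functional.
have DdX : Dcal (dual_elt chi) by exact: dual_elt_Dcal.
have prX k : pr k X = pr k (dual_elt chi).
  by rewrite (pr_dual_elt Iorth) // chiE (repf_Dform Iorth).
have [e' XE'] : exists e', X = dual_elt chi + iota e'.
  by eexists; exact: (eq_pr prX).
suff ee' : e = e' by rewrite XE' ee' addrC.
apply: (iota_wl_inj Iorth (m := m) (h := h)) => l v.
have Dw := wl_Dcal m h l v.
have <- : Dform X (wl l v) = Dform (iota e') (wl l v).
  have Wchi := dual_elt_wspan Iorth m h cchi.
  rewrite XE' (lin_onD (Dform_linl Dw)) //.
  by rewrite (wspan_isotropic Iorth sk Wchi (wspan_wl m h l v)) add0r.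
rewrite XE !(lin_onD (Dform_linl Dw)) ?(lin_onN (Dform_linl Dw)); auto.
rewrite !(Dform_bracket _ _ Dw) // !pairing_dual_elt_wl //.
have Wbr : wspan h (Dbracket (dual_elt phi) (dual_elt psi)).
  case: subW => _ _ _; apply.
    exact: (dual_elt_wspan Iorth m h cphi).
  exact: (dual_elt_wspan Iorth m h cpsi).
rewrite -(Dform_bracket Dphi Dpsi Dw) (wspan_isotropic Iorth sk Wbr (wspan_wl m h l v)).
rewrite !Dform_iota_wl add0r -(bilinNl kb) -!(bilinDl kb).
by congr killing.
Qed.

Lemma delta_has_double : has_double i delta.
Proof.
exists double_iso; split.
- exact: double_iso_bij.
- by move=> *; exact: double_iso_linear.
- exact: double_iso_bracket.
- exact: double_iso_form.
move=> f; rewrite /double_iso /= (dual_elt_wsum m h (N := 0)) ?/wsum ?big_ord0 ?addr0 //.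
by move=> k _; apply: big1 => a _; exact: scale0r.
Qed.

End Bialgebra.

(** * From a Lie bialgebra with double D_i back to an r-matrix *)

Section DoubleToRMatrix.
Variables (F : fieldType) (g : lieAlgType F).
Variables (n : nat) (I : n.-tuple g) (Iorth : killing_orthonormal I).
Variable m : nat.
Local Notation i := m.+1.
Local Notation ambient := ((int -> g) * {ffun 'I_m -> g})%type.
Local Notation Dcal := (@Dcal F g m.+1).
Local Notation Dform := (@Dform F g m.+1).
Local Notation Dbracket := (@Dbracket F g m.+1).
Local Notation iota := (@Diota F g m.+1).
Local Notation g2 := (tensor g g).
Local Notation kb := (killing_bilin g).
Local Notation cb := (ctr_bilin g g).
Local Notation R := (rmatrices I (mono (1 : F) m)).
Local Notation dualseries := ((nat -> g) -> F^o).
Local Notation dbl := (@Defs.double F g).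

Lemma zero_functional : cont_functional (0 : dualseries).
Proof. by split=> [c f f'|f]; [rewrite scaler0 addr0 | exists 0%N]. Qed.

Lemma functional0 (phi : dualseries) : cont_functional phi -> phi 0 = 0.
Proof. by case=> lphi _; rewrite -[LHS]/(mk_linear lphi 0) linear0. Qed.

Lemma sbracket0l (f : nat -> g) : sbracket 0 f = 0.
Proof. exact: (bilin0l (sbracket_bilin g)). Qed.

Lemma fun_tens1_0 (phi : dualseries) : cont_functional phi ->
  fun_tens1 phi (0 : nat -> nat -> g2) = 0.
Proof.
move=> cphi; have [N [phiN _]] := cont_functional_rep Iorth cphi.
apply/funext => l; rewrite (fun_tens1_sum Iorth _ _ cphi.1 phiN).
by apply: big1 => k _; rewrite (bilin0l (ctl_bilin g)).
Qed.

(** Closure of g{x} under the dual bracket. Only coefficients at x^k y^l with k < N and l < M enter,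
    so agreement modulo (x,y)^(N+M) is enough. *)
Lemma fun_tens_functional (delta : (nat -> g) -> (nat -> nat -> g2))
    (phi psi : dualseries) :
  linear delta ->
  (forall f N, exists M, forall f', xadic_eq M f f' -> xyadic_eq N (delta f) (delta f')) ->
  cont_functional phi -> cont_functional psi ->
  cont_functional (fun c => fun_tens phi psi (delta c)).
Proof.
move=> ldelta cdelta cphi cpsi.
have [N [phiN _]] := cont_functional_rep Iorth cphi.
have [M [psiM _]] := cont_functional_rep Iorth cpsi.
have E t := fun_tens_sum Iorth t cphi.1 cpsi.1 phiN psiM.
split=> [c f f'|f].
  rewrite !E ldelta scaler_sumr -big_split; apply: eq_bigr => k _ /=.
  rewrite scaler_sumr -big_split; apply: eq_bigr => l _ /=.
  by rewrite -[(_ + _) _ _]/(c *: delta f k l + delta f' k l) cb.1 kb.1.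
have [K HK] := cdelta f (N + M)%N; exists K => f' /HK ff'; rewrite !E.
apply: eq_bigr => k _; apply: eq_bigr => l _; rewrite ff' //.
by have := ltn_ord k; have := ltn_ord l; lia.
Qed.

Section FromDouble.
Variable delta : (nat -> g) -> (nat -> nat -> g2).
Hypothesis ldelta : linear delta.
Hypothesis cdelta : forall f N, exists M, forall f', xadic_eq M f f' ->
  xyadic_eq N (delta f) (delta f').
Variable Phi : (nat -> g) * dualseries -> ambient.
Hypothesis Phi_bij : set_bij dbl Dcal Phi.
Hypothesis Phi_linear : forall (c : F) u v, dbl u -> dbl v ->
  Phi (c *: u + v) = c *: Phi u + Phi v.
Hypothesis Phi_bracket : forall u v, dbl u -> dbl v ->
  Phi (double_bracket delta u v) = Dbracket (Phi u) (Phi v).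
Hypothesis Phi_form : forall u v, dbl u -> dbl v ->
  Dform (Phi u) (Phi v) = double_form u v.
Hypothesis Phi_iota : forall f, Phi (f, 0) = iota f.

Definition dual_image : set ambient :=
  [set u | exists2 phi, cont_functional phi & u = Phi (0, phi)].

Lemma double_bracket_dual phi psi : cont_functional phi -> cont_functional psi ->
  double_bracket delta (0, phi) (0, psi) = (0, fun c => fun_tens phi psi (delta c)).
Proof.
move=> cphi cpsi; rewrite /double_bracket.
have -> : delta 0 = 0 by rewrite -[LHS]/(mk_linear ldelta 0) linear0.
rewrite sbracket0l !fun_tens1_0 // addr0 subr0; congr pair.
apply/funext => c; rewrite -[LHS]/(_ + phi (sbracket 0 c) - psi (sbracket 0 c)).
by rewrite sbracket0l !functional0 // addr0 subr0.
Qed.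

Lemma Phi_split a phi : cont_functional phi -> Phi (a, phi) = iota a + Phi (0, phi).
Proof.
move=> cphi; have -> : (a, phi) = 1 *: (a, 0) + (0, phi).
  congr pair; first by rewrite /= scale1r addr0.
  by rewrite /= scaler0 add0r.
by rewrite Phi_linear ?scale1r ?Phi_iota //; exact: zero_functional.
Qed.

Lemma dual_image_pairing f phi : cont_functional phi ->
  Dform (iota f) (Phi (0, phi)) = phi f.
Proof.
move=> cphi; rewrite -Phi_iota Phi_form //; last exact: zero_functional.
by rewrite /double_form /= add0r.
Qed.

Lemma dual_image_lagrangian : lagrangian_complements g i dual_image.
Proof.
have [PhiD Phi_inj Phi_surj] := Phi_bij.
have Phi00 : Phi (0, 0) = 0 by rewrite Phi_iota iota0.
split.
- split=> [u [phi cphi ->]||c u v [phi cphi ->] [psi cpsi ->]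
    |u v [phi cphi ->] [psi cpsi ->]].
  + exact: PhiD.
  + by exists 0; [exact: zero_functional | rewrite Phi00].
  + exists (c *: phi + psi); first exact: functionalP.
    by rewrite -Phi_linear //; congr (Phi (_, _)); rewrite /= scaler0 addr0.
  + exists (fun c => fun_tens phi psi (delta c)); first exact: fun_tens_functional.
    by rewrite -Phi_bracket // double_bracket_dual.
- apply/seteqP; split=> u.
    case=> /Phi_surj[[a phi] cphi <-] orth.
    (* The continuous functionals B(-, w_{k,v}), formed with the zero series as h, separate the
       points of g[[x]], and orthogonality makes each of them vanish on a. *)
    have a0 : a = 0.
      apply: (iota_wl_inj Iorth (m := m) (h := 0)) => k v.
      have cv := Dform_cont_functional (wl_Dcal m 0 k v).
      have : dual_image (Phi (0, fun f => Dform (iota f) (wl m 0 k v))).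
        by exists (fun f => Dform (iota f) (wl m 0 k v)).
      move=> /orth; rewrite Phi_form // /double_form /= functional0 // add0r => ->.
      by rewrite iota0 (lin_on0 (Dform_linl (wl_Dcal m 0 k v))).
    by exists phi => //; rewrite a0.
  move=> [phi cphi ->]; split; first exact: PhiD.
  move=> w [psi cpsi ->]; rewrite Phi_form // /double_form /=.
  by rewrite !functional0 // addr0.
split=> [u /Phi_surj[[a phi] cphi <-]|f [phi cphi fE]].
  by exists a, (Phi (0, phi)); split; [exists phi | exact: Phi_split].
have := Phi_inj (f, 0) (0, phi); rewrite !inE Phi_iota => /(_ zero_functional cphi fE).
by case=> -> _; exact: iota0.
Qed.

(** The functional behind w_{k,v} is f |-> killing (f k) v. The dual bracket of two such functionals
    is the (k,l) coefficient of delta paired with v and w, while [Dform_neg_dr] computes the same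
    pairing for - dr. *)
Lemma delta_neg_dr h : dual_image = wspan h -> skew_regular m h ->
  neg_dr (rmat I m h) = delta.
Proof.
move=> Wh sk; apply/funext => f; apply/funext => k; apply/funext => l.
apply: (ctr_inj Iorth) => w; apply: (killing_inj Iorth) => v.
rewrite -(Dform_neg_dr Iorth f k v l w sk).
have dual_wl j x : exists2 phi, cont_functional phi &
    wl m h j x = Phi (0, phi) /\ forall p, repf I phi p = if p == j then x else 0.
  have [phi cphi E] : dual_image (wl m h j x) by rewrite Wh; exact: wspan_wl.
  exists phi => //; split=> // p; rewrite -(pr_wl m h).
  have cE : phi = fun f => Dform (iota f) (wl m h j x).
    by apply/funext => e; rewrite E dual_image_pairing.
  by rewrite cE (repf_Dform Iorth).
have [phi cphi [-> phiE]] := dual_wl k v; have [psi cpsi [-> psiE]] := dual_wl l w.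
rewrite -Phi_bracket // double_bracket_dual // dual_image_pairing; last first.
  exact: fun_tens_functional.
rewrite (fun_tens_sum Iorth _ cphi.1 cpsi.1 (N := k.+1) (M := l.+1)); last 2 first.
- by move=> p kp; rewrite phiE ifN //; lia.
- by move=> p lp; rewrite psiE ifN //; lia.
rewrite big_ord_recr /= big1 ?add0r => [|p _]; last first.
  apply: big1 => q _; rewrite phiE ifN ?(bilin0r kb) //.
  by have := ltn_ord p; rewrite /=; lia.
rewrite big_ord_recr /= big1 ?add0r => [|q _]; last first.
  rewrite psiE ifN ?(bilin0r cb) ?(bilin0l kb) //.
  by have := ltn_ord q; rewrite /=; lia.
by rewrite phiE psiE !eqxx.
Qed.

End FromDouble.

Lemma neg_dr_bij : set_bij R (bialgebras_with_double g i) neg_dr.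
Proof.
split.
- by move=> r Rr; split; [exact: (delta_bialgebra Iorth Rr) | exact: (delta_has_double Iorth Rr)].
- move=> r r'; rewrite !inE => Rr Rr' E.
  have laurent s : R s -> laurent_cols s.
    by move=> /rmatrices_rmat[-> _]; exact: rmat_laurent.
  apply: (act_inj Iorth); [exact: laurent | exact: laurent |] => f.
  by apply: oppr_inj; rewrite -!(lser2_delta Iorth (m := m)) // E.
move=> delta [[ldelta cdelta _ _ _] [Phi [bijP linP brP formP iotaP]]].
have lagW := dual_image_lagrangian ldelta cdelta bijP linP brP formP iotaP.
have [h [Wh sk E]] := lagrangian_wspan Iorth lagW.
exists (rmat I m h); first by split=> //; exists h.
exact: (delta_neg_dr ldelta cdelta brP formP iotaP Wh sk).
Qed.

End DoubleToRMatrix.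

(** * Automorphisms *)

Section Automorphism.
Variables (F : fieldType) (g : lieAlgType F).
Implicit Types (phi psi : (nat -> g) -> (nat -> g)).

Lemma app_bilin : bilin (fun (A : 'End(g)) (x : g) => A x).
Proof.
split=> [x c A B|A c x y]; first by rewrite !lfunE /= !lfunE.
by rewrite linearP.
Qed.

Lemma fx_linear phi : is_fx_automorphism phi -> linear phi.
Proof.
move=> [_ phiD phiZ _] c f h; rewrite phiD; congr (_ + _).
have smul_const (c' : F) (e : nat -> g) : smul (mono c' 0%N) e = c' *: e.
  apply/funext => k; rewrite /smul big_ord_recl /= subn0 big1 ?addr0 // => p _.
  exact: scale0r.
by rewrite -!smul_const phiZ.
Qed.

Lemma smul_shift (j : nat) (f : nat -> g) k :
  smul (mono (1 : F) j) f k = if (j <= k)%N then f (k - j)%N else 0.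
Proof.
rewrite /smul; case: leqP => jk.
  have jk' : (j < k.+1)%N by [].
  rewrite (bigD1 (Ordinal jk')) //= /mono eqxx scale1r big1 ?addr0 // => p pj.
  rewrite ifN ?scale0r //; apply: contra pj => /eqP pj; exact/eqP/val_inj.
rewrite big1 // => p _; rewrite /mono ifN ?scale0r //; have := ltn_ord p; lia.
Qed.

Section Coefficients.
Variable phi : (nat -> g) -> (nat -> g).
Hypothesis aphi : is_fx_automorphism phi.

Let lphi0 (k : nat) : linear (fun a : g => phi (mono a 0%N) k).
Proof. by move=> c a b; rewrite mono_linear (fx_linear aphi). Qed.

Definition fx_coef (k : nat) : 'End(g) := linfun (mk_linear (lphi0 k)).

Lemma fx_coefE k a : fx_coef k a = phi (mono a 0%N) k.
Proof. by rewrite lfunE. Qed.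

(* phi commutes with x^(k+1), so modulo x^(k+1) it only sees f_0, ..., f_k. *)
Lemma fx_conv f : phi f = conv (fun (A : 'End(g)) (x : g) => A x) fx_coef f.
Proof.
have [_ phiD phiZ _] := aphi; pose L := mk_linear (fx_linear aphi).
apply/funext => k; pose tail : nat -> g := fun j => f (j + k.+1)%N.
have fE : f = \sum_(j < k.+1) mono (f j) j + smul (mono (1 : F) k.+1) tail.
  apply/funext => j.
  rewrite -[RHS]/((\sum_(p < k.+1) mono (f p) p) j + smul (mono 1 k.+1) tail j).
  rewrite smul_shift; case: leqP => jk; first by rewrite addr0 -(truncation f (N := k.+1) jk).
  rewrite /tail subnK // fct_sumE big1 ?add0r // => p _.
  by rewrite /mono ifN //; have := ltn_ord p; lia.
rewrite {1}fE phiD phiZ -[(_ + _) k]/(phi _ k + smul (mono 1 k.+1) (phi tail) k).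
rewrite smul_shift ltnn addr0 -[phi _]/(L _) linear_sum fct_sumE.
rewrite /conv (sum_convC (fun p q => fx_coef p (f q))); apply: eq_bigr => j _ /=.
have -> : mono (f j) j = smul (mono (1 : F) j) (mono (f j) 0%N).
  apply/funext => p; rewrite smul_shift /mono.
  case: leqP => jp; last by rewrite ifN //; lia.
  by congr (if _ then _ else _); apply/eqP/eqP; lia.
rewrite phiZ smul_shift ifT ?fx_coefE //.
by have := ltn_ord j; lia.
Qed.

Lemma laurent_ext_lconv u :
  laurent_ext phi u = lconv (fun (x : g) (A : 'End(g)) => A x) u (lser fx_coef).
Proof.
apply/funext => k; apply: eq_fsbigr => p _.
by case: (k - p) => q /=; rewrite ?fx_coefE ?lfunE.
Qed.

(** By [fx_conv], coefficients of phi f below x^m involve only those of f below x^m. *)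
Lemma trunc_ext_trunc m f : trunc_ext phi (trunc m f) = trunc m (phi f).
Proof.
apply/ffunP => k; rewrite !ffunE !(fx_conv _); apply: eq_bigr => p _.
by rewrite trunc_rep_trunc ifT //; have := ltn_ord k; lia.
Qed.

End Coefficients.

Lemma inverse_fx phi psi : is_fx_automorphism phi ->
  cancel phi psi -> cancel psi phi -> is_fx_automorphism psi.
Proof.
move=> [_ phiD phiZ phiB] phiK psiK; have inj := can_inj phiK; split.
- by exists phi.
- by move=> f h; apply: inj; rewrite phiD !psiK.
- by move=> s f; apply: inj; rewrite phiZ !psiK.
by move=> f h; apply: inj; rewrite phiB !psiK.
Qed.

Local Notation kappa := (@killing F g : g -> g -> F^o).
Local Notation kb := (killing_bilin g).
Local Notation lb := (lie_bilin g).
Local Notation cb := (ctr_bilin g g).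
Local Notation "A ** B" := (conv (fun X Y : 'End(g) => (X \o Y)%VF) A B)
  (at level 40, left associativity).

Lemma compA (A B C : nat -> 'End(g)) : A ** (B ** C) = A ** B ** C.
Proof.
rewrite conv_convr ?conv_convl; try exact: (comp_lfun_bilin g).
apply/funext => k; apply: eq_bigr => p _; apply: eq_bigr => q _.
exact: comp_lfunA.
Qed.

Lemma comp1r (A : nat -> 'End(g)) : A ** mono \1%VF 0%N = A.
Proof.
apply/funext => k; rewrite (conv_monor (comp_lfun_bilin g)) /= subn0.
exact: comp_lfun1r.
Qed.

Lemma etrace_conv (A B : nat -> 'End(g)) k : etrace ((A ** B) k) = etrace ((B ** A) k).
Proof.
pose tr := mk_linear (@etrace_linear F g).
have trsum (C D : nat -> 'End(g)) : etrace ((C ** D) k) =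
    \sum_(p < k.+1) etrace (C p \o D (k - p)%N)%VF.
  by rewrite -[LHS]/(tr _) linear_sum.
rewrite !trsum (sum_convC (fun p q => etrace (A p \o B q)%VF)).
by apply: eq_bigr => p _; exact: etraceC.
Qed.

Definition Ad (f : nat -> g) : nat -> 'End(g) := fun k => ad (f k).

Lemma kconv_etrace f h k : conv kappa f h k = etrace ((Ad f ** Ad h) k).
Proof.
rewrite -[RHS]/(mk_linear (@etrace_linear F g) _) linear_sum.
by apply: eq_bigr => p _; rewrite killingE.
Qed.

Lemma fx_coef_inv phi psi (aphi : is_fx_automorphism phi)
    (apsi : is_fx_automorphism psi) :
  cancel psi phi -> fx_coef aphi ** fx_coef apsi = mono \1%VF 0%N.
Proof.
move=> psiK; apply/funext => k; apply/lfunP => a.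
have -> : mono \1%VF 0%N k a = mono a 0%N k.
  by rewrite /mono; case: ifP => _; rewrite lfunE.
rewrite -[in RHS](psiK (mono a 0%N)) (fx_conv aphi) /conv sum_lfunE.
by apply: eq_bigr => p _; rewrite comp_lfunE -(fx_coefE apsi).
Qed.

Section Inverse.
Variables phi psi : (nat -> g) -> (nat -> g).
Hypotheses (aphi : is_fx_automorphism phi) (apsi : is_fx_automorphism psi).
Hypotheses (phiK : cancel phi psi) (psiK : cancel psi phi).
Local Notation Phi := (fx_coef aphi).
Local Notation Psi := (fx_coef apsi).

Lemma Ad_fx f : Ad (phi f) ** Phi = Phi ** Ad f.
Proof.
have [_ _ _ phiB] := aphi.
apply/funext => k; apply/lfunP => a.
have -> : (Ad (phi f) ** Phi) k a = sbracket (phi f) (phi (mono a 0%N)) k.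
  rewrite /conv sum_lfunE; apply: eq_bigr => p _.
  by rewrite comp_lfunE adE fx_coefE.
rewrite -phiB (fx_conv aphi) /conv sum_lfunE; apply: eq_bigr => p _.
rewrite comp_lfunE adE -[sbracket _ _]/(conv _ _ _) (conv_monor lb) /=.
by rewrite subn0.
Qed.

(* Ad(phi f) = Phi Ad(f) Phi^-1, and the trace is cyclic. *)
Lemma kconv_fx f h : conv kappa (phi f) (phi h) = conv kappa f h.
Proof.
apply/funext => k; rewrite !kconv_etrace.
have -> : Ad (phi f) ** Ad (phi h) = Phi ** (Ad f ** Ad h ** Psi).
  rewrite -[Ad (phi f) ** _]comp1r -(fx_coef_inv aphi apsi psiK) compA.
  by rewrite -[_ ** Ad (phi h) ** _]compA Ad_fx !compA Ad_fx.
by rewrite etrace_conv -compA (fx_coef_inv apsi aphi phiK) comp1r.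
Qed.

Lemma kconv_fx_adj f h : conv kappa (phi f) h = conv kappa f (psi h).
Proof. by rewrite -{1}(psiK h) kconv_fx. Qed.

(** The adjunction between phi and psi, applied to constant series and read at x^k. *)
Lemma killing_fx_coef k x v : killing (Phi k x) v = killing x (Psi k v).
Proof.
have := congr1 (fun u => u k) (kconv_fx_adj (mono x 0%N) (mono v 0%N)).
by rewrite (conv_monor kb) (conv_mono0l kb) /= subn0 -!fx_coefE.
Qed.

End Inverse.

(** * Automorphisms acting on two-variable series *)

Section GaugeAction.
Variables (n : nat) (I : n.-tuple g) (Iorth : killing_orthonormal I).
Variables phi psi : (nat -> g) -> (nat -> g).
Hypotheses (aphi : is_fx_automorphism phi) (apsi : is_fx_automorphism psi).
Hypotheses (phiK : cancel phi psi) (psiK : cancel psi phi).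
Local Notation Phi := (fx_coef aphi).
Local Notation Psi := (fx_coef apsi).
Local Notation appr := (fun (x : g) (A : 'End(g)) => A x).

Lemma appr_bilin : bilin appr.
Proof. by case: app_bilin. Qed.

Lemma laurent_ext_linear : forall c u v, is_laurent u -> is_laurent v ->
  laurent_ext phi (c *: u + v) = c *: laurent_ext phi u + laurent_ext phi v.
Proof.
move=> c u v ul vl; rewrite !(laurent_ext_lconv aphi) (lconvPl appr_bilin) //.
exact: lser_laurent.
Qed.

Lemma laurent_ext_laurent u : is_laurent u -> is_laurent (laurent_ext phi u).
Proof.
move=> ul; rewrite (laurent_ext_lconv aphi).
by apply: (lconv_laurent appr_bilin) => //; exact: lser_laurent.
Qed.

Lemma laurent_ext_sh M a : laurent_ext phi (sh M a) = sh M (phi a).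
Proof.
rewrite (laurent_ext_lconv aphi) sh0 (lconv_sh appr_bilin) addn0.
by rewrite convC -(fx_conv aphi).
Qed.

Lemma tens2_ext_neg t N l k : (forall q k, (q <= l)%N -> (k < N)%R -> t k q = 0) ->
  (k < N)%R -> tens2_ext phi t k l = 0.
Proof.
move=> tN kN; apply: fsbig1 => p _; apply: big1 => q _.
have [pN|pN] := ltP p N; first by rewrite tN ?tens_map0 // -ltnS.
rewrite /tens_map /tens_lift big1 // => a _; rewrite big1 // => b _.
by rewrite lser_neg ?(bilin0l (tens_bilin g g)) ?scaler0 //; lia.
Qed.

Lemma tens2_ext_laurent t : laurent_cols t -> laurent_cols (tens2_ext phi t).
Proof.
move=> tl l; have [N tN] := laurent_bound l tl; exists N => k.
exact: tens2_ext_neg.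
Qed.

(** In the variable x, phi acts on whole columns; in the variable y it is moved onto v, where its
    adjoint psi appears. *)
Lemma column_tens2_ext t l v : laurent_cols t ->
  column (tens2_ext phi t) l v =
  \sum_(q < l.+1) laurent_ext phi (column t q (Psi (l - q)%N v)).
Proof.
move=> tl; apply/funext => k; rewrite fct_sumE /column.
have [N tN] := laurent_bound l tl.
have map0 (B : g -> g) (s : tensor g g) (j : int) : (j < 0)%R ->
    tens_map (fun a => lser (phi (mono a 0%N)) j) B s = 0.
  move=> j0; rewrite /tens_map /tens_lift big1 // => a _; rewrite big1 // => b _.
  by rewrite lser_neg // (bilin0l (tens_bilin g g)) scaler0.
pose K := `|k - N|.+1.
rewrite /tens2_ext (@fsum_int _ N K); last 2 first.
- by move=> p pN; apply: big1 => q _; rewrite tN ?tens_map0 // -ltnS.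
- by move=> p Kp; apply: big1 => q _; rewrite map0 //; rewrite /K in Kp; lia.
rewrite (bilin_suml cb); under eq_bigr do rewrite (bilin_suml cb).
rewrite exchange_big; apply: eq_bigr => q _ /=.
rewrite (laurent_ext_lconv aphi) /lconv (@fsum_int _ N K); last 2 first.
- by move=> p pN; rewrite (tN _ _ (leq_ord q) pN) (bilin0l cb) (bilin0l appr_bilin).
- move=> p Kp; rewrite [lser _ _](_ : _ = 0) ?lfunE //.
  by apply: lser_neg; rewrite /K in Kp; lia.
apply: eq_bigr => p _; set j := k - _.
have lserE a : lser (phi (mono a 0%N)) j = lser Phi j a.
  by case: j => j' /=; rewrite ?fx_coefE ?lfunE.
rewrite (@ctr_map _ _ _ _ (Psi (l - q)%N)).
- exact: lserE.
- by move=> c a b; rewrite !lserE linearP.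
- by move=> c a b; rewrite mono_linear (fx_linear aphi).
by move=> b; rewrite -fx_coefE; exact: killing_fx_coef.
Qed.

Lemma laurent_ext_lie f u : is_laurent u ->
  laurent_ext phi (lconv (@lie F g) (lser f) u) =
  lconv (@lie F g) (lser (phi f)) (laurent_ext phi u).
Proof.
have [_ _ _ phiB] := aphi.
move=> /laurent_sh[M Hu]; have [a ->] := Hu _ (leqnn _).
rewrite !sh0 (lconv_sh lb) !laurent_ext_sh (lconv_sh lb).
by rewrite -[conv _ f a]/(sbracket f a) phiB.
Qed.

Lemma tens2_ext_act f t : laurent_cols t ->
  tens2_ext phi (act f t) = act (phi f) (tens2_ext phi t).
Proof.
move=> tl; have tl' := tens2_ext_laurent tl; have fl := act_laurent f tl.
have cl j x : is_laurent (column t j x) by exact: column_laurent.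
pose G j x := laurent_ext phi (column t j x).
have Gl j : linear (G j).
  by move=> c x y; rewrite /G column_linear laurent_ext_linear.
have Gsum j (J : Type) (s : seq J) (x : J -> g) :
    G j (\sum_(a <- s) x a) = \sum_(a <- s) G j (x a).
  by rewrite -[LHS]/(mk_linear (Gl j) _) linear_sum.
have phi_sum (J : Type) (s : seq J) (u : J -> int -> g) :
    (forall a, is_laurent (u a)) ->
    laurent_ext phi (\sum_(a <- s) u a) = \sum_(a <- s) laurent_ext phi (u a).
  move=> ul; elim: s => [|a s IH].
    rewrite !big_nil; have := laurent_ext_linear (-1) (@laurent0 F g) (@laurent0 F g).
    by rewrite scaler0 addr0 => ->; rewrite scaleN1r addNr.
  rewrite !big_cons -IH -[u a in LHS]scale1r laurent_ext_linear ?scale1r //.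
  exact: laurent_sum.
apply: (eq_column Iorth) => l v.
rewrite column_tens2_ext // column_act // column_tens2_ext //.
rewrite (lconv_sumr _ lb); [|exact: lser_laurent|by move=> q; exact: laurent_ext_laurent].
(* On the second factor the two sides produce the coefficients of [f, psi v] and of psi [phi f, v],
   which are equal because psi is a Lie homomorphism inverse to phi. *)
pose S j := \sum_(q < j.+1) lie (f q) (Psi (j - q)%N v).
have SE j : S j = \sum_(q < j.+1) Psi (j - q)%N (lie (phi f q) v).
  have psiB : psi (sbracket (phi f) (mono v 0%N)) = sbracket f (psi (mono v 0%N)).
    by have [_ _ _ ->] := apsi; rewrite phiK.
  have := congr1 (fun u => u j) psiB; rewrite (fx_conv apsi).
  rewrite /conv (sum_convC (fun p q => Psi p (sbracket (phi f) (mono v 0%N) q))) /sbracket.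
  move=> /esym; under eq_bigr do rewrite -(fx_coefE apsi).
  rewrite -/(S j) => ->; apply: eq_bigr => q _.
  rewrite -[\sum_(p < q.+1) _]/(conv (@lie F g) (phi f) (mono v 0%N) q).
  by rewrite (conv_monor lb) /= subn0.
rewrite [X in _ - X](_ : _ = \sum_(q < l.+1) G q (S (l - q)%N)); last first.
  under eq_bigr => q _ do rewrite column_tens2_ext //.
  rewrite (exchange_triangle (fun q q' =>
    G q' (Psi (l - q - q')%N (lie (phi f q) v)))).
  apply: eq_bigr => q _; rewrite SE Gsum; apply: eq_bigr => q' _.
  by rewrite subnAC.
rewrite [X in _ - X](_ : _ = \sum_(q < l.+1) \sum_(q' < q.+1)
    G (q - q')%N (lie (f q') (Psi (l - q)%N v))); last first.
  pose G' q' s := G s (lie (f q') (Psi (l - q' - s)%N v)).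
  transitivity (\sum_(q < l.+1) \sum_(q' < q.+1) G' q' (q - q')%N); last first.
    apply: eq_bigr => q _; apply: eq_bigr => q' _; rewrite /G'.
    by have -> : (l - q' - (q - q') = l - q)%N by have := ltn_ord q'; lia.
  rewrite (sum_triangle G') (exchange_triangle G'); apply: eq_bigr => s _.
  by rewrite /S Gsum; apply: eq_bigr => q' _; rewrite /G' subnAC.
rewrite -sumrB; apply: eq_bigr => q _; rewrite column_act //.
rewrite -scaleN1r addrC laurent_ext_linear; last 2 first.
- exact: laurent_sum.
- by apply: (lconv_laurent lb) => //; exact: lser_laurent.
by rewrite scaleN1r addrC laurent_ext_lie // phi_sum.
Qed.

End GaugeAction.

(** * Automorphisms acting on D_i and on the complements *)

Section AmbientAction.
Variables (n : nat) (I : n.-tuple g) (Iorth : killing_orthonormal I).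
Variable m : nat.
Local Notation i := m.+1.
Local Notation ambient := ((int -> g) * {ffun 'I_m -> g})%type.
Local Notation Dcal := (@Dcal F g m.+1).
Local Notation Dform := (@Dform F g m.+1).
Local Notation iota := (@Diota F g m.+1).
Local Notation R := (rmatrices I (mono (1 : F) m)).

Definition Dext phi (u : ambient) : ambient :=
  (laurent_ext phi u.1, trunc_ext phi u.2).

Lemma Dext_elt phi M a f : is_fx_automorphism phi ->
  Dext phi (elt m M a f) = elt m M (phi a) (phi f).
Proof.
by move=> aphi; congr pair; [exact: laurent_ext_sh | exact: trunc_ext_trunc].
Qed.

Lemma Dext_Dcal phi u : is_fx_automorphism phi -> Dcal u -> Dcal (Dext phi u).
Proof.
move=> aphi /Dcal_elt[M Hu]; have [a [f ->]] := Hu _ (leqnn _).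
by rewrite Dext_elt //; exact: elt_Dcal.
Qed.

Lemma Dext_linear phi : is_fx_automorphism phi -> lin_on (Dext phi).
Proof.
move=> aphi c u v Du Dv; have [M [a [f [b [h [-> ->]]]]]] := Dcal_elt2 Du Dv.
by rewrite eltP !Dext_elt // eltP !(fx_linear aphi).
Qed.

Lemma Dext_iota phi f : is_fx_automorphism phi -> Dext phi (iota f) = iota (phi f).
Proof. by move=> aphi; rewrite !iota_elt Dext_elt. Qed.

Variables phi psi : (nat -> g) -> (nat -> g).
Hypotheses (aphi : is_fx_automorphism phi) (apsi : is_fx_automorphism psi).
Hypotheses (phiK : cancel phi psi) (psiK : cancel psi phi).
Local Notation Psi := (fx_coef apsi).

Lemma DextK u : Dcal u -> Dext psi (Dext phi u) = u.
Proof.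
move=> /Dcal_elt[M Hu]; have [a [f ->]] := Hu _ (leqnn _).
by rewrite !Dext_elt // !phiK.
Qed.

Lemma Dform_Dext u v : Dcal u -> Dcal v -> Dform (Dext phi u) (Dext phi v) = Dform u v.
Proof.
move=> Du Dv; have [M [a [f [b [h [-> ->]]]]]] := Dcal_elt2 Du Dv.
by rewrite !Dext_elt // !Dform_elt !(kconv_fx aphi apsi).
Qed.

Lemma Dform_Dext_iota u f : Dcal u -> Dform (Dext phi u) (iota f) = Dform u (iota (psi f)).
Proof.
by move=> Du; rewrite -[f in LHS]psiK -(Dext_iota _ aphi) Dform_Dext.
Qed.

Variable h : nat -> nat -> tensor g g.

(* The vectors w_{l,v} of the r-matrix (phi (x) phi) r: this uses that the
   adjoint of phi for the Killing form is its inverse psi. *)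
Definition gauged_wl l v : ambient :=
  \sum_(q < l.+1) Dext phi (wl m h q (Psi (l - q)%N v)).

Lemma gauged_wl_Dcal l v : Dcal (gauged_wl l v).
Proof. by apply: Dcal_sum => q; exact: Dext_Dcal. Qed.

(** Pairing with a x^k gives the x^l coefficient of the Killing form of psi(a x^k) and psi(v), and
    psi preserves that form. *)
Lemma pr_gauged_wl k l v : pr k (gauged_wl l v) = if k == l then v else 0.
Proof.
apply: (killing_inj Iorth) => a; rewrite -(Dform_pr 0); last exact: gauged_wl_Dcal.
rewrite (lin_on_sum _ (Dform_linl (iota_Dcal _ _))); last by move=> q; exact: Dext_Dcal.
transitivity (conv kappa (psi (mono a k)) (psi (mono v 0%N)) l).
  apply: eq_bigr => q _; rewrite Dform_Dext_iota // DformC // Dform_iota_wl.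
  by rewrite fx_coefE.
rewrite (kconv_fx apsi aphi) // (conv_monor kb) /= subn0 /mono eq_sym.
by case: ifP => _; rewrite ?(bilin0l kb) // killingC.
Qed.

Lemma gauged_wl1 l v : (gauged_wl l v).1 = column (tens2_ext phi (rmat I m h)) l v.
Proof.
rewrite (column_tens2_ext aphi apsi) //; last exact: rmat_laurent.
rewrite /gauged_wl (big_morph fst (id1 := 0) (op1 := +%R)) //.
by apply: eq_bigr => q _; rewrite -(wl_column Iorth).
Qed.

Lemma gauged_wl_Dext l v : exists2 w, wspan h w & gauged_wl l v = Dext phi w.
Proof.
exists (\sum_(q < l.+1) wl m h q (Psi (l - q)%N v)); last first.
  by rewrite (lin_on_sum _ (Dext_linear aphi)).
elim/big_rec: _ => [|q w _ Ww]; first exact: wspan0.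
by rewrite -[wl _ _ _ _]scale1r; apply: wspanP => //; exact: wspan_wl.
Qed.

(** Controls the second component, about which r says nothing directly: u - v lies in iota(g[[x]])
    and has first component zero. *)
Lemma eq_fst_pr (u v : ambient) : u.1 = v.1 -> (forall k, pr k u = pr k v) -> u = v.
Proof.
move=> uv1 uv; rewrite (eq_pr uv) -[RHS]addr0; congr (_ + _).
rewrite -[RHS](iota0 g m); congr (Diota i _); apply/funext => j.
by rewrite -[LHS]/(u.1 j%:Z - v.1 j%:Z) uv1 subrr.
Qed.

Lemma gauge_wspan h' : rmat I m h' = tens2_ext phi (rmat I m h) ->
  wspan h' = Dext phi @` wspan h.
Proof.
move=> rr'; have wlE l v : wl m h' l v = gauged_wl l v.
  apply: eq_fst_pr => [|k]; first by rewrite gauged_wl1 (wl_column Iorth) rr'.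
  by rewrite pr_wl pr_gauged_wl.
have DW u : wspan h u -> Dcal u by exact: wspan_Dcal.
have sub : wspan h' `<=` Dext phi @` wspan h.
  move=> _ [N [z ->]]; rewrite /wsum; elim/big_rec: _ => [|k u _ [w Ww <-]].
    by exists 0; [exact: wspan0 | exact: (lin_on0 (Dext_linear aphi))].
  have [w' Ww' E] := gauged_wl_Dext k (z k).
  exists (1 *: w' + w); first exact: wspanP.
  by rewrite (Dext_linear aphi) ?scale1r ?wlE ?E //; exact: DW.
(* The reverse inclusion again compares complements: the iota part f of an image is pulled back by
   psi into the span of h, where it must vanish. *)
apply/seteqP; split=> // _ [w Ww <-].
have [f [w' [Ww' E]]] := (wspan_complementary m h').1 _ (Dext_Dcal aphi (DW _ Ww)).
suff f0 : iota f = 0 by rewrite E f0 add0r.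
have [w0 Ww0 E0] := sub _ Ww'.
have : iota (psi f) = (-1) *: w0 + w.
  rewrite -[RHS]DextK; last by apply: DcalP; exact: DW.
  rewrite (Dext_linear aphi); [|exact: DW|exact: DW].
  by rewrite E0 E scaleN1r addrCA addNr addr0 Dext_iota.
move=> psif; have /wspan_iota psif0 : wspan h (iota (psi f)).
  by rewrite psif; exact: wspanP.
by rewrite -[f]psiK -(Dext_iota _ aphi) psif0 (lin_on0 (Dext_linear aphi)).
Qed.

Lemma wspan_gauge h' : wspan h' = Dext phi @` wspan h ->
  rmat I m h' = tens2_ext phi (rmat I m h).
Proof.
move=> Wh'; apply: (eq_column Iorth) => l v.
rewrite -(wl_column Iorth) -gauged_wl1; congr fst.
apply: (eq_wspan_pr (h := h')); first exact: wspan_wl.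
  have [w Ww ->] := gauged_wl_Dext l v.
  by rewrite Wh'; exists w.
by move=> k; rewrite pr_wl pr_gauged_wl.
Qed.

End AmbientAction.

End Automorphism.

(** * Comparison of the three equivalence relations *)

Section Equivalences.
Variables (F : fieldType) (g : lieAlgType F).
Variables (n : nat) (I : n.-tuple g) (Iorth : killing_orthonormal I).
Variable m : nat.
Local Notation i := m.+1.
Local Notation R := (rmatrices I (mono (1 : F) m)).

Lemma fx_automorphism_inverse (phi : (nat -> g) -> (nat -> g)) :
  is_fx_automorphism phi ->
  exists psi, [/\ is_fx_automorphism psi, cancel phi psi & cancel psi phi].
Proof.
move=> aphi; have [[psi phiK psiK] _ _ _] := aphi.
by exists psi; split=> //; exact: inverse_fx aphi phiK psiK.
Qed.

Lemma rmatrices_laurent r : R r -> laurent_cols r.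
Proof. by move=> /rmatrices_rmat[-> _]; exact: rmat_laurent. Qed.

Lemma tens2_ext_neg_dr r phi psi f : R r -> is_fx_automorphism phi ->
  is_fx_automorphism psi -> cancel phi psi -> cancel psi phi ->
  tens2_ext phi (lser2 (neg_dr r f)) = - act (phi f) (tens2_ext phi r).
Proof.
move=> Rr aphi apsi phiK psiK; have rl := rmatrices_laurent Rr.
rewrite (lser2_delta Iorth Rr) /dr -(act_oppl Iorth) //.
rewrite (tens2_ext_act Iorth aphi apsi phiK psiK) // -(act_oppl Iorth).
  by rewrite -[phi (- f)]/(mk_linear (fx_linear aphi) _) linearN.
exact: tens2_ext_laurent.
Qed.

(** Since [tens2_ext phi] intertwines the actions of f and phi f, an isomorphism says that r' and
    (phi (x) phi) r are acted on alike by all phi f. As phi is onto, [act_inj] makes them equal. *)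
Lemma bialgebra_iso_gauge r r' : R r -> R r' ->
  bialgebra_iso (neg_dr r) (neg_dr r') <-> gauge_equiv r r'.
Proof.
move=> Rr Rr'; split=> -[phi aphi E]; exists phi => //;
  have [psi [apsi phiK psiK]] := fx_automorphism_inverse aphi.
  apply: (act_inj Iorth); [exact: rmatrices_laurent| |move=> f].
    by apply: tens2_ext_laurent => //; exact: rmatrices_laurent.
  have := E (psi f).
  rewrite (tens2_ext_neg_dr _ Rr aphi apsi phiK psiK) (lser2_delta Iorth Rr') psiK.
  by move/oppr_inj.
by move=> f; rewrite (tens2_ext_neg_dr _ Rr aphi apsi phiK psiK) -E (lser2_delta Iorth Rr').
Qed.

Lemma gauge_subspace_iso r r' : R r -> R r' ->
  gauge_equiv r r' <-> subspace_iso (Wspace I i r) (Wspace I i r').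
Proof.
move=> Rr Rr'; rewrite !(Wspace_wspan Iorth).
have [rE _] := rmatrices_rmat Rr; have [rE' _] := rmatrices_rmat Rr'.
split=> -[phi aphi E]; exists phi => //;
  have [psi [apsi phiK psiK]] := fx_automorphism_inverse aphi.
  by apply: (gauge_wspan Iorth aphi apsi phiK psiK); rewrite -rE -rE'.
by rewrite rE rE'; exact: (wspan_gauge Iorth aphi apsi phiK psiK E).
Qed.

End Equivalences.

Theorem theorem2 (F : closedFieldType) (charF : [pchar F] =i pred0)
    (g : lieAlgType F) (gsimple : simple_lie g)
    (n : nat) (I : n.-tuple g) (Iorth : killing_orthonormal I)
    (i : nat) (hi : i \in [:: 1%N; 2%N; 3%N]) :
  let R := rmatrices I (mono (1 : F) i.-1) in
  [/\ forall r, R r -> forall f, lser2 (neg_dr r f) = - dr r f,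
      set_bij R (bialgebras_with_double g i) neg_dr,
      set_bij R (lagrangian_complements g i) (Wspace I i),
      forall r r', R r -> R r' ->
        (bialgebra_iso (neg_dr r) (neg_dr r') <-> gauge_equiv r r')
    & forall r r', R r -> R r' ->
        (gauge_equiv r r' <-> subspace_iso (Wspace I i r) (Wspace I i r'))].
Proof.
case: i hi => [|m] // _ R; split.
- by move=> r Rr f; exact: (lser2_delta Iorth (m := m)).
- exact: (neg_dr_bij Iorth m).
- exact: (Wspace_bij Iorth m).
- by move=> r r'; exact: (bialgebra_iso_gauge Iorth (m := m)).
by move=> r r'; exact: (gauge_subspace_iso Iorth (m := m)).
Qed.
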